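(* Let $m>0$, $a_1,a_2\in(-\infty,4m^2)$, $\tilde b_0,\tilde b_1\in\mathbb{R}$, and let $b_0,b_1,b_2\in\mathbb{R}$ and distinct real $\gamma_0,\gamma_1,\gamma_2\in(-\infty,4m^2)$ satisfy $\gamma_i(a_1-\gamma_i)(a_2-\gamma_i)J(\gamma_i)=b_0+b_1\gamma_i+b_2\gamma_i^2$ for $i=0,1,2$. Let $\epsilon>0$. Then for every $\mathsf S\in C^\infty_{\mathrm{pc}}(\mathcal M)$ with support in $\{t\ge-\epsilon\}$ the equation $$\phi+W_{\mathrm{ret}}(\phi)=\mathsf S$$ has a unique solution $\phi\in C^\infty_{\mathrm{pc}}(\mathcal M)$; it is supported in $\{t\ge-\epsilon\}$ and is given by the series $\phi=\sum_{n\ge0}(-1)^nW_{\mathrm{ret}}^n(\mathsf S)$, which converges absolutely in $C^\infty_{\mathrm{pc}}(\mathcal M)$.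
   Context: $\mathcal M=\mathbb{R}^{1+3}$ Minkowski, $\square=-\partial_t^2+\Delta$; $C^\infty_{\mathrm{pc}}(\mathcal M)$ carries its LF-topology (strict inductive limit over past-compact sets $K$ of the Fréchet spaces of smooth functions supported in $K$, with seminorms $\sup_K|\partial^\alpha\varphi|$). For $M\in\mathbb{R}$, $\mathsf G^M_{\mathrm{ret}}$ is the retarded Green operator of $\square-M$ on past-compact functions. $\rho(M)=\frac{1}{16\pi^2}\sqrt{1-\frac{4m^2}{M}}\frac1M$, $J(\gamma)=\int_{4m^2}^\infty\frac{\rho(M)}{M-\gamma}dM$. Put $\varsigma(M)=\frac{M(M-a_1)(M-a_2)}{(M-\gamma_0)(M-\gamma_1)(M-\gamma_2)}\rho(M)$ on $[4m^2,\infty)$, $g(z)=\int_{4m^2}^\infty\frac{\varsigma(M)}{M-z}dM$, $\mathrm{p.v.}\,g(M)$ its principal value on $(4m^2,\infty)$, fix $c\in(0,4m^2)$ and $\mu_{\mathrm{con}}(M)=\frac{\varsigma(M)}{(M-c)\left((\mathrm{p.v.}\,g(M))^2+\pi^2\varsigma(M)^2\right)}$. Define $\mathcal G_\varsigma^{-1}:C^\infty_{\mathrm{pc}}\to C^\infty_{\mathrm{pc}}$ by $\mathcal G_\varsigma^{-1}\Phi=-\frac{1}{g(c)}\Phi-\int_{4m^2}^\infty\mu_{\mathrm{con}}(M)\mathsf G^M_{\mathrm{ret}}((\square-c)\Phi)\,dM$ (the retarded inverse of $\phi\mapsto\int_{4m^2}^\infty\varsigma(M)\mathsf G^M_{\mathrm{ret}}\phi\,dM$).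 Let $\mathsf G_{L,\mathrm{ret}}$ be the retarded Green operator of $L=(\square-\gamma_0)(\square-\gamma_1)(\square-\gamma_2)$, i.e. $\mathsf G_{L,\mathrm{ret}}=\sum_i c_i\mathsf G^{\gamma_i}_{\mathrm{ret}}$ with $\frac{1}{\prod_i(M-\gamma_i)}=\sum_i\frac{c_i}{M-\gamma_i}$. Finally $W_{\mathrm{ret}}(\phi):=\mathsf G_{L,\mathrm{ret}}\big(\mathcal G_\varsigma^{-1}\big((\tilde b_1-b_1)\square\phi+(\tilde b_0-b_0)\phi\big)\big)$. *)

(* Defs.v *)
From HB Require Import structures.
From mathcomp Require Import all_boot all_order all_algebra.
From mathcomp Require Import all_classical all_reals all_analysis.
Set Implicit Arguments. Unset Strict Implicit. Unset Printing Implicit Defensive.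
Import Order.TTheory GRing.Theory Num.Theory.
Import numFieldNormedType.Exports.
Local Open Scope classical_set_scope.
Local Open Scope ring_scope.

Section Minkowski.
Variable R : realType.

Definition pt := 'rV[R]_4.
Definition crd (x : pt) (i : 'I_4) : R := x ord0 i.
Definition tcoord (x : pt) : R := crd x 0.
Definition evec (i : 'I_4) : pt := delta_mx ord0 i.

Definition dpartial (i : 'I_4) (f : pt -> R) : pt -> R :=
  fun x => derive f x (evec i).

Fixpoint dmulti (s : seq 'I_4) (f : pt -> R) : pt -> R :=
  if s is i :: s' then dpartial i (dmulti s' f) else f.

Definition smooth (f : pt -> R) : Prop :=
  forall s : seq 'I_4, continuous (dmulti s f) /\
    forall (i : 'I_4) (x : pt), derivable (dmulti s f) x (evec i).

Definition supp (f : pt -> R) : set pt := closure [set x | f x != 0].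

Definition Jminus (p : pt) : set pt :=
  [set x | tcoord x <= tcoord p /\
     (crd x 1 - crd p 1) ^+ 2 + (crd x 2 - crd p 2) ^+ 2 + (crd x 3 - crd p 3) ^+ 2
       <= (tcoord p - tcoord x) ^+ 2].

Definition past_compact (K : set pt) : Prop :=
  forall p : pt, compact (K `&` Jminus p).

Definition Cpc (f : pt -> R) : Prop :=
  smooth f /\ exists K, past_compact K /\ supp f `<=` K.

Definition box (f : pt -> R) : pt -> R :=
  fun x => - dmulti [:: 0; 0] f x + dmulti [:: 1; 1] f x
           + dmulti [:: 2; 2] f x + dmulti [:: 3; 3] f x.

(* retarded Green operator of (box - M) on past-compact functions:
   G f is the unique u in C^infty_pc with (box - M) u = f (0 if there is none) *)
Definition KGsol (M : R) (f u : pt -> R) : Prop :=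
  Cpc u /\ (fun x => box u x - M * u x) = f.

Definition Gret (M : R) (f : pt -> R) : pt -> R :=
  xget (fun _ => 0)
    [set u | KGsol M f u /\ forall v, KGsol M f v -> v = u].

Definition leb := (@lebesgue_measure R).

Definition from (a : R) : set R := [set x | a <= x].

Variable m : R.

Definition rho (M : R) : R :=
  (16 * pi ^+ 2)^-1 * Num.sqrt (1 - 4 * m ^+ 2 / M) / M.

Definition Jfun (g : R) : R :=
  \int[leb]_(M in from (4 * m ^+ 2)) (rho M / (M - g)).

Variables (a1 a2 g0 g1 g2 : R).

Definition varsigma (M : R) : R :=
  M * (M - a1) * (M - a2) / ((M - g0) * (M - g1) * (M - g2)) * rho M.

Definition gfun (z : R) : R :=
  \int[leb]_(M in from (4 * m ^+ 2)) (varsigma M / (M - z)).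

Definition pvg (z : R) : R :=
  lim ((fun d : R => \int[leb]_(M in from (4 * m ^+ 2) `\` `]z - d, z + d[)
                       (varsigma M / (M - z))) @ 0^'+).

Variable c : R.

Definition mucon (M : R) : R :=
  varsigma M / ((M - c) * (pvg M ^+ 2 + pi ^+ 2 * varsigma M ^+ 2)).

Definition Ginv (Phi : pt -> R) : pt -> R :=
  fun x => - (gfun c)^-1 * Phi x
    - \int[leb]_(M in from (4 * m ^+ 2))
         (mucon M * Gret M (fun y => box Phi y - c * Phi y) x).

(* retarded Green operator of L = (box-g0)(box-g1)(box-g2) *)
Definition GLret (f : pt -> R) : pt -> R :=
  fun x => ((g0 - g1) * (g0 - g2))^-1 * Gret g0 f x
         + ((g1 - g0) * (g1 - g2))^-1 * Gret g1 f x
         + ((g2 - g0) * (g2 - g1))^-1 * Gret g2 f x.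

Variables (b0 b1 bt0 bt1 : R).

Definition Wret (phi : pt -> R) : pt -> R :=
  GLret (Ginv (fun x => (bt1 - b1) * box phi x + (bt0 - b0) * phi x)).

End Minkowski.

(* absolute convergence of sum_n u n in the LF space C^infty_pc(M):
   all terms supported in one past-compact K, and for every compact C and every
   multi-index s the sup-seminorms over C are summable *)
Definition abs_conv_pc (R : realType) (u : nat -> pt R -> R) : Prop :=
  (forall n, Cpc (u n)) /\
  (exists K, past_compact K /\ forall n, supp (u n) `<=` K) /\
  (forall (C : set (pt R)) (s : seq 'I_4), compact C ->
     exists b : nat -> R, (exists B : R, forall N, \sum_(n < N) b n <= B) /\
       forall n x, C x -> `|dmulti s (u n) x| <= b n).

(* Main.v *)
(* Every retarded operator is an integral over the backward cone: with s = tau^2 - r^2,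
   products of n operators G^M have an entire kernel E(s), and integrating by parts in
   null coordinates turns box into -4 (s E')'.  An energy estimate for this ODE gives
   |E(s)| <= D^n s^(n-1) / (n-1)!, uniformly in all masses M bounded below.

   The resolvent identity M G^M = G^M box - 1 rewrites W_ret as a combination of the
   G^(gamma_i) and of integrals of G^M and G^M G^(gamma_i) against mu_con(M) / M dM.
   This weight is integrable: near 4 m^2 it is at most 1 / (pi^2 varsigma M (M - c)),
   with an inverse square root singularity, and at infinity p.v. g(M) <= -C log M / M
   makes it O(1 / (M log^2 M)).  All operators commute by uniqueness of retarded
   solutions, so every W_ret brings one more G and W_ret^n S is bounded, locally
   uniformly with all derivatives, by D^n / (n-1)!.  Supports stay in the causal future
   of supp S, and the Neumann series converges; applied to the difference of two
   solutions the same bound gives uniqueness. *)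
Require Import Defs.
From HB Require Import structures.
From mathcomp Require Import all_boot all_order all_algebra.
From mathcomp Require Import all_classical all_reals all_analysis.
From mathcomp Require Import ring lra measurable_realfun.
Import Order.TTheory GRing.Theory Num.Theory.
Import numFieldNormedType.Exports.
Local Open Scope classical_set_scope.
Local Open Scope ring_scope.
Set Implicit Arguments. Unset Strict Implicit. Unset Printing Implicit Defensive.

(** * Parametric integrals *)

(** The obstacle is loss of derivatives. As written, [Wret] lets [box] act on its argument twice
    before anything is integrated, and one Green operator costs a first derivative, because the
    retarded fundamental solution contains a delta function on the light cone. Iterating such
    estimates would require ever more derivatives of S, on which nothing is known beyond smoothness.
    Both losses are removed exactly. A product of Green operators is one integral with kernel
    [E Ms], so any number of factors costs first derivatives of the datum only once. And the
    Lagrange weights c_i of the three masses, with sum c_i = sum c_i gamma_i = 0, cancel every term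
    in which [box] falls on phi. The second obstacle is the unbounded range of M. The decay 1 /
    log^2 M of mu_con is not integrable, so one power of M has to be traded away. Bounds on power
    series coefficients grow with |M|; they serve only for convergence, and the quantitative bounds
    come from the energy of the ODE, in which the large term M l is absorbed into the energy
    itself. *)

Section Continuity.
Context {R : realType} {U : topologicalType}.
Implicit Types f g : U -> R.

Lemma ctsD f g : continuous f -> continuous g -> continuous (fun u => f u + g u).
Proof. by move=> cf cg u; apply: cvgD; [exact: cf|exact: cg]. Qed.

Lemma ctsB f g : continuous f -> continuous g -> continuous (fun u => f u - g u).
Proof. by move=> cf cg u; apply: cvgB; [exact: cf|exact: cg]. Qed.

Lemma ctsM f g : continuous f -> continuous g -> continuous (fun u => f u * g u).
Proof. by move=> cf cg u; apply: cvgM; [exact: cf|exact: cg]. Qed.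

Lemma ctsN f : continuous f -> continuous (fun u => - f u).
Proof. by move=> cf u; apply: cvgN; exact: cf. Qed.

Lemma cts_cst (r : R) : continuous (fun _ : U => r).
Proof. by move=> u; exact: cvg_cst. Qed.

Lemma cts_norm f : continuous f -> continuous (fun u => `|f u|).
Proof. by move=> cf u; apply: cvg_norm; exact: cf. Qed.

Lemma cts_comp (V W : topologicalType) (h : V -> W) (k : U -> V) :
  continuous h -> continuous k -> continuous (fun u => h (k u)).
Proof. by move=> ch ck u; apply: (@continuous_comp _ _ _ k h); [exact: ck|exact: ch]. Qed.

Lemma cts_pair (V W : topologicalType) (h : U -> V) (k : U -> W) :
  continuous h -> continuous k -> continuous (fun u => (h u, k u)).
Proof. by move=> ch ck u; apply: cvg_pair; [exact: ch|exact: ck]. Qed.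

End Continuity.

Lemma cts_id (U : topologicalType) : continuous (fun u : U => u).
Proof. by move=> u; exact: cvg_id. Qed.

Lemma cts_fst (U V : topologicalType) : continuous (fun z : U * V => z.1).
Proof. by move=> u; exact: cvg_fst. Qed.

Lemma cts_snd (U V : topologicalType) : continuous (fun z : U * V => z.2).
Proof. by move=> u; exact: cvg_snd. Qed.

Section Derivatives.
Context {R : realType}.

(** The difference quotient with h multiplied out: h = 0 needs no separate case, and estimates of
    integrals can be fed in directly. *)
Lemma is_derive_eps (V : normedModType R) (f : V -> R) (x v : V) (df : R) :
  (forall e : R, 0 < e -> exists2 d : R, 0 < d & forall h : R, `|h| < d ->
     `|f (x + h *: v) - f x - h * df| <= e * `|h|) ->
  is_derive x v f df.
Proof.
move=> H.
have cv : (fun h : R => h^-1 *: (f (h *: v + x) - f x)) @ 0^' --> df.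
  apply/cvgrPdist_le => e e0; have [d d0 Hd] := H _ e0.
  exists d => // h /=; rewrite sub0r normrN => hd h0.
  have -> : df - h^-1 *: (f (h *: v + x) - f x) =
            - (h^-1 * (f (x + h *: v) - f x - h * df)).
    by rewrite [h *: v + x]addrC mulrBr mulKf// opprB.
  rewrite normrN normrM normfV mulrC ler_pdivrMr ?normr_gt0//.
  exact: Hd.
apply: DeriveDef; first by apply/cvg_ex; exists df.
exact: cvg_lim.
Qed.

Lemma is_derive_epsP (V : normedModType R) (f : V -> R) (x v : V) (df : R) :
  is_derive x v f df ->
  (forall e : R, 0 < e -> exists2 d : R, 0 < d & forall h : R, `|h| < d ->
     `|f (x + h *: v) - f x - h * df| <= e * `|h|).
Proof.
move=> [fx fE] e e0.
have : (fun h : R => h^-1 *: (f (h *: v + x) - f x)) @ 0^' --> df.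
  by rewrite -fE; exact: fx.
move=> /cvgrPdist_le/(_ e e0) [d /= d0 Hd]; exists d => // h hd.
have [->|h0] := eqVneq h 0.
  by rewrite scale0r addr0 subrr mul0r subr0 normr0 mulr0.
have := Hd h; rewrite /= sub0r normrN => /(_ hd h0).
have -> : df - h^-1 *: (f (h *: v + x) - f x) =
            - (h^-1 * (f (x + h *: v) - f x - h * df)).
  by rewrite [h *: v + x]addrC mulrBr mulKf// opprB.
by rewrite normrN normrM normfV mulrC ler_pdivrMr ?normr_gt0.
Qed.

Lemma mvt_between (g dg : R -> R) (x h : R) :
  (forall t : R, is_derive t 1 g (dg t)) ->
  exists2 k : R, `|k| <= `|h| & g (x + h) - g x = h * dg (x + k).
Proof.
move=> dgP.
have cg : continuous g.
  by move=> t; apply: differentiable_continuous; apply/derivable1_diffP; case: (dgP t).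
have [h0|h0] := lerP 0 h.
  have [] := @MVT_segment R g dg x (x + h).
  - by rewrite lerDl.
  - exact: continuous_subspaceT.
  move=> c /itvP cI E; exists (c - x).
    by rewrite !ger0_norm// ?subr_ge0 ?cI// lerBlDl cI.
  by rewrite E addrC addKr mulrC addrC subrK.
have [] := @MVT_segment R g dg (x + h) x.
- by rewrite gerDl ltW.
- exact: continuous_subspaceT.
move=> c /itvP cI E; exists (c - x).
  rewrite ler0_norm ?subr_le0 ?cI// ltr0_norm// opprB lerBlDl -lerBlDr opprK.
  by rewrite cI.
rewrite [x + (c - x)]addrC subrK -opprB E; ring.
Qed.

End Derivatives.

Section ParamInt.
Context {R : realType}.

(* sealed: unification must not unfold integrals when it compares them *)
Lemma Int_seal : {I : R -> R -> (R -> R) -> R |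
  I = fun a b f => (\int[@lebesgue_measure R]_(x in `[a, b]) f x)%R}.
Proof. by eexists. Qed.

Definition Int (a b : R) (f : R -> R) : R := sval Int_seal a b f.

Lemma IntE a b f : Int a b f = (\int[@lebesgue_measure R]_(x in `[a, b]) f x)%R.
Proof. by rewrite /Int (svalP Int_seal). Qed.

Lemma eq_Int a b (f g : R -> R) :
  (forall x, a <= x -> x <= b -> f x = g x) -> Int a b f = Int a b g.
Proof.
move=> fg; rewrite !IntE; apply: eq_Rintegral => x; rewrite inE/= in_itv/= => /andP[? ?].
exact: fg.
Qed.

Lemma Int_integrable a b (f : R -> R) : continuous f ->
  (@lebesgue_measure R).-integrable `[a, b] (EFin \o f).
Proof.
move=> cf; apply: continuous_compact_integrable; first exact: segment_compact.
exact: continuous_subspaceT.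
Qed.

Lemma IntD a b (f g : R -> R) : continuous f -> continuous g ->
  Int a b (fun x => f x + g x) = Int a b f + Int a b g.
Proof. by move=> cf cg; rewrite !IntE RintegralD//; exact: Int_integrable. Qed.

Lemma IntZ a b (f : R -> R) r : continuous f ->
  Int a b (fun x => r * f x) = r * Int a b f.
Proof. by move=> cf; rewrite !IntE RintegralZl//; exact: Int_integrable. Qed.

Lemma IntB a b (f g : R -> R) : continuous f -> continuous g ->
  Int a b (fun x => f x - g x) = Int a b f - Int a b g.
Proof. by move=> cf cg; rewrite !IntE RintegralB//; exact: Int_integrable. Qed.

Lemma Int_cst a b r : a <= b -> Int a b (fun=> r) = r * (b - a).
Proof.
move=> ab; rewrite !IntE Rintegral_cst//= lebesgue_measure_itv/= lte_fin.
by case: ltgtP ab => //= -> _; rewrite subrr.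
Qed.

Lemma Int0 a b (f : R -> R) : (forall x, a <= x -> x <= b -> f x = 0) ->
  Int a b f = 0.
Proof.
move=> f0; rewrite (eq_Int (g := fun=> 0))//.
by rewrite !IntE Rintegral_cst// mul0r.
Qed.

Lemma Int_bound a b (f : R -> R) C : a <= b -> continuous f ->
  (forall x, a <= x -> x <= b -> `|f x| <= C) -> `|Int a b f| <= C * (b - a).
Proof.
move=> ab cf fC; rewrite -Int_cst// !IntE.
apply: le_trans (le_normr_Rintegral _ _) _ => //; first exact: Int_integrable.
apply: le_Rintegral => //.
- by apply: Int_integrable => x; apply: (@continuous_comp _ _ _ f); [exact: cf|exact: norm_continuous].
- by apply: Int_integrable => x; exact: cst_continuous.
- by move=> x /=; rewrite in_itv/= => /andP[? ?]; exact: fC.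
Qed.

Lemma Int_FTC a b (f F : R -> R) : a <= b -> continuous f ->
  (forall x : R, is_derive x 1 F (f x)) -> Int a b f = F b - F a.
Proof.
rewrite le_eqVlt => /predU1P[<-|ab] cf dF.
  by rewrite subrr !IntE set_itv1 Rintegral_set1.
have cF : continuous F.
  by move=> t; apply: differentiable_continuous; apply/derivable1_diffP; case: (dF t).
rewrite !IntE /Rintegral (@continuous_FTC2 _ f F)//.
- exact: continuous_subspaceT.
- split.
  + by move=> x _; case: (dF x).
  + by apply: cvg_at_right_filter; exact: cF.
  + by apply: cvg_at_left_filter; exact: cF.
- by move=> x _; rewrite derive1E; case: (dF x).
Qed.

Lemma compact_unif_near (U : topologicalType) (f : U -> R -> R) a b (u0 : U) e :
  continuous (fun z : U * R => f z.1 z.2) -> 0 < e ->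
  \forall u \near u0, forall s, a <= s -> s <= b -> `|f u s - f u0 s| <= e.
Proof.
move=> cf e0.
have /compact_near_coveringP K := @segment_compact R a b.
have := K U (nbhs u0) (fun u s => `|f u s - f u0 s| <= e) _.
have H : forall x, `[a, b]%classic x ->
  \forall x' \near x & i \near u0, `|f i x' - f u0 x'| <= e.
  move=> x _.
  have e20 : 0 < e / 2 by rewrite divr_gt0.
  have /cvgrPdist_le/(_ _ e20) := cf (u0, x).
  move=> [[A B] /= [Au Bx]] AB.
  exists (B, A) => //= -[s u] /= [Bs Au'].
  have h1 := AB (u, s) (conj Au' Bs).
  have h2 := AB (u0, s) (conj (nbhs_singleton Au) Bs).
  move: h1 h2; rewrite /= !ler_distl => /andP[? ?] /andP[? ?].
  apply/andP; split; lra.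
move=> /(_ _ H); apply: filterS => u Hu s as_ sb.
by apply: Hu; rewrite /= in_itv/= as_ sb.
Qed.

Lemma sect1_continuous (U V : topologicalType) (T : topologicalType) (f : U -> V -> T) u :
  continuous (fun z : U * V => f z.1 z.2) -> continuous (f u).
Proof.
move=> cf v; apply: (@continuous_comp _ _ _ (fun v : V => (u, v)) (fun z : U * V => f z.1 z.2)).
  by apply: cvg_pair; [exact: cvg_cst|exact: cvg_id].
exact: cf.
Qed.

Lemma Int_continuous (U : topologicalType) (f : U -> R -> R) a b : a <= b ->
  continuous (fun z : U * R => f z.1 z.2) ->
  continuous (fun u => Int a b (f u)).
Proof.
move=> ab cf u0; apply/cvgrPdist_le => e e0.
have cfu u : continuous (f u) by exact: sect1_continuous cf.
(* The added 1 keeps the denominator positive when a = b. *)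
pose e' := e / (b - a + 1).
have ba1 : 0 < b - a + 1 by lra.
have e'0 : 0 < e' by rewrite divr_gt0.
have := compact_unif_near a b u0 cf e'0; apply: filterS => u Hu.
rewrite -IntB//.
apply: le_trans (Int_bound (C := e') ab _ _) _.
- exact: ctsB.
- by move=> x ax xb; rewrite distrC; exact: Hu.
- rewrite /e' mulrAC ler_pdivrMr// ler_pM2l//; lra.
Qed.

(** The mean value theorem turns the increment in t into h times [df] at an intermediate time
    depending on s; the uniformity over the segment makes this dependence harmless. *)
Lemma Int_derive (f df : R -> R -> R) a b (t : R) : a <= b ->
  (forall t s : R, is_derive t 1 (f^~ s) (df t s)) ->
  continuous (fun z : R * R => f z.1 z.2) ->
  continuous (fun z : R * R => df z.1 z.2) ->
  is_derive t 1 (fun t => Int a b (f t)) (Int a b (df t)).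
Proof.
move=> ab fdf cf cdf; apply: is_derive_eps => e e0.
have cfu u : continuous (f u) by exact: sect1_continuous cf.
have cdfu u : continuous (df u) by exact: sect1_continuous cdf.
pose e' := e / (b - a + 1).
have ba1 : 0 < b - a + 1 by lra.
have e'0 : 0 < e' by rewrite divr_gt0.
have [d /= d0 Hd] := compact_unif_near a b t cdf e'0.
exists d => // h hd; rewrite -[h *: 1]/(h * 1) mulr1.
have c1 : continuous (fun x => h * df t x) by apply: ctsM => //; exact: cts_cst.
have c2 : continuous (fun x => f (t + h) x - f t x) by exact: ctsB.
rewrite -IntZ// -!IntB//.
apply: le_trans (Int_bound (C := e' * `|h|) ab _ _) _; first exact: ctsB.
- move=> x ax xb.
  have [k kh ->] := @mvt_between R (f^~ x) (df^~ x) t h (fun t => fdf t x).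
  rewrite -mulrBr normrM mulrC ler_wpM2r//.
  apply: Hd => //=; rewrite opprD addNKr normrN.
  exact: le_lt_trans kh hd.
- rewrite -mulrA [`|h| * _]mulrC mulrA ler_wpM2r//.
  rewrite /e' mulrAC ler_pdivrMr// ler_pM2l//; lra.
Qed.

End ParamInt.

(** * Smooth functions on Minkowski space *)

Lemma continuous_epsP (R : realType) (V : normedModType R) (g : V -> R) (x : V) :
  {for x, continuous g} <-> forall e : R, 0 < e ->
    exists2 d : R, 0 < d & forall u, `|u - x| < d -> `|g u - g x| <= e.
Proof.
split=> [/cvgrPdist_le H e e0|H].
  have /nbhs_normP[d /= d0 K] := H e e0; exists d => // u ux.
  by rewrite distrC; apply: K; rewrite /= distrC.
apply/cvgrPdist_le => e e0; have [d d0 K] := H e e0.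
by apply/nbhs_normP; exists d => // u ux; rewrite distrC; apply: K; rewrite distrC.
Qed.

Lemma continuous_eps_fin (R : realType) (V : normedModType R) (I : finType)
    (f : I -> V -> R) (x : V) (e : R) :
  (forall i, {for x, continuous (f i)}) -> 0 < e ->
  exists2 d : R, 0 < d & forall i u, `|u - x| < d -> `|f i u - f i x| <= e.
Proof.
move=> cf e0.
have : \forall u \near x, forall i, `|f i x - f i u| <= e.
  apply: filter_forall => i; have [d d0 H] := (continuous_epsP _ _).1 (cf i) e e0.
  by apply/nbhs_normP; exists d => // z zx; rewrite distrC; apply: H; rewrite distrC.
move=> /nbhs_normP[d /= d0 H]; exists d => // i u ux; rewrite distrC.
by apply: H; rewrite /= distrC.
Qed.

Section PointSpace.
Context {R : realType}.
Local Notation pt := 'rV[R]_4.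

Lemma rv_norm_le (x : pt) C : 0 <= C -> (forall i, `|x ord0 i| <= C) -> `|x| <= C.
Proof.
move=> C0 xC; rewrite /Num.Def.normr/= mx_normrE (bigmax_le _ C0)// => -[i j] _ /=.
by rewrite (ord1 i).
Qed.

Lemma coord_le (x : pt) i : `|x ord0 i| <= `|x|.
Proof.
rewrite [leRHS]/Num.Def.normr/= mx_normrE.
exact: (le_bigmax _ (fun ij : 'I_1 * 'I_4 => `|x ij.1 ij.2|) (ord0, i)).
Qed.

Lemma evec_norm (i : 'I_4) : `|evec R i| <= 1.
Proof.
apply: rv_norm_le => // j; rewrite /evec mxE eqxx /=.
by case: (j == i); rewrite ?normr1// normr0.
Qed.

Lemma cts_row (U : topologicalType) (c : 'I_4 -> U -> R) :
  (forall i, continuous (c i)) -> continuous (fun u => (\row_i c i u) : pt).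
Proof.
move=> cc u; apply/cvgrPdist_le => e e0.
have : \forall t \near u, forall i : 'I_4, `|c i u - c i t| <= e.
  apply: filter_forall => i; move: (cc i u) => /cvgrPdist_le; exact.
apply: filterS => t Ht; apply: rv_norm_le => [|i]; first exact: ltW.
by rewrite !mxE.
Qed.

Lemma cball_compact (r : R) : compact [set x : pt | `|x| <= r].
Proof.
apply: bounded_closed_compact.
- exists r; split; first exact: num_real.
  by move=> s rs x /= xr; exact: le_trans xr (ltW rs).
- have -> : [set x : pt | `|x| <= r] = (fun x : pt => `|x|) @^-1` [set y | y <= r] by [].
  apply: closed_comp; last exact: closed_le.
  by move=> x _; exact: norm_continuous.
Qed.

Lemma cts_bounded (U : topologicalType) (K : set U) (f : U -> R) :
  compact K -> continuous f -> exists2 C : R, 0 <= C & forall x, K x -> `|f x| <= C.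
Proof.
move=> cK cf; have [->|/set0P[x0 Kx0]] := eqVneq K set0; first by exists 0.
have [|||c Kc Hc] := @compact_EVT_max U R (fun x => `|f x|) K.
- by exists x0.
- exact: cK.
- by apply: continuous_subspaceT; exact: cts_norm.
exists `|f c| => // x Kx; apply: Hc; exact/mem_set.
Qed.

Lemma cball_bounded (f : pt -> R) r : continuous f ->
  exists2 C : R, 0 <= C & forall x, `|x| <= r -> `|f x| <= C.
Proof.
move=> cf; have [C C0 H] := cts_bounded (@cball_compact r) cf.
by exists C => // x xr; exact: H.
Qed.

Lemma line_derive (g : pt -> R) (dg : pt -> R) (v x : pt) :
  (forall y, is_derive y v g (dg y)) ->
  forall t : R, is_derive t 1 (fun t => g (x + t *: v)) (dg (x + t *: v)).
Proof.
move=> H t; apply: is_derive_eps => e e0.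
have [d d0 Hd] := is_derive_epsP (H (x + t *: v)) e0.
exists d => // h hd; have := Hd h hd.
by rewrite -(addrA x) -(scalerDl v t h) -[h *: 1]/(h * 1) mulr1.
Qed.

Lemma line_mvt (g : pt -> R) (dg : pt -> R) (v x : pt) (h : R) :
  (forall y, is_derive y v g (dg y)) ->
  exists2 k : R, `|k| <= `|h| & g (x + h *: v) - g x = h * dg (x + k *: v).
Proof.
move=> H.
have [k kh E] := @mvt_between R (fun t => g (x + t *: v)) (fun t => dg (x + t *: v)) 0 h
  (line_derive x H).
by exists k => //; move: E; rewrite !add0r scale0r addr0.
Qed.

(* moving from x to x + y one coordinate at a time *)
Lemma telescope_mvt (g : pt -> R) (dg : 'I_4 -> pt -> R) (x y : pt) :
  (forall i z, is_derive z (evec R i) g (dg i z)) ->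
  exists2 z : 'I_4 -> pt, forall i, `|z i - x| <= `|y| &
    g (x + y) - g x = \sum_i y ord0 i * dg i (z i).
Proof.
move=> dgP.
pose p (k : nat) : pt := \row_j (if (j < k)%N then y ord0 j else 0).
suff H k : (k <= 4)%N -> exists2 z : 'I_4 -> pt, forall i, `|z i - x| <= `|y| &
    g (x + p k) - g x = \sum_(i < 4 | (i < k)%N) y ord0 i * dg i (z i).
  have [z zx E] := H 4%N (leqnn _); exists z => //.
  have p4 : p 4%N = y by apply/rowP => j; rewrite mxE ltn_ord.
  rewrite -p4 {p4 H} E; apply: eq_big => [i|i _]; first by rewrite ltn_ord.
  by rewrite mxE ltn_ord.
elim: k => [_|k IH k4].
  exists (fun=> x) => [i|]; first by rewrite subrr normr0.
  have -> : p 0%N = 0 by apply/rowP => j; rewrite !mxE.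
  by rewrite addr0 subrr big1.
have [z zx E] := IH (ltnW k4).
pose ik := Ordinal k4.
have pS : p k.+1 = p k + y ord0 ik *: evec R ik.
  apply/rowP => j; rewrite !mxE /= ltnS leq_eqVlt -val_eqE /=.
  have [jk|jk] := eqVneq (val j) k.
    have -> : j = ik by apply: val_inj.
    by rewrite /= ltnn add0r mulr1.
  by rewrite mulr0 addr0.
have [l ly El] := line_mvt (x + p k) (y ord0 ik) (dgP ik).
exists (fun i => if i == ik then x + p k + l *: evec R ik else z i) => [i|].
  case: eqP => [_|_]; last exact: zx.
  have -> : x + p k + l *: evec R ik - x = p k + l *: evec R ik.
    by rewrite -(addrA x) [x + _]addrC addrK.
  apply: rv_norm_le => // j; rewrite !mxE eqxx /=.
  case: eqVneq => [->|jk].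
    by rewrite /= ltnn add0r mulr1 (le_trans ly) // coord_le.
  by rewrite mulr0 addr0; case: ifP => _; rewrite ?normr0// coord_le.
rewrite pS addrA -(subrKA (g (x + p k))) El E.
rewrite [RHS](bigD1 ik) /=; last by [].
rewrite eqxx; congr (_ + _).
apply: eq_big => [i|i ik'].
  by rewrite -val_eqE /= ltn_neqAle ltnS andbC.
by case: eqP => // ii; move: ik'; rewrite ii ltnn.
Qed.

(** Lets [operator_smooth] work with local bounds alone: continuity of an operator's output is never
    proved by hand, it follows from bounds on the partial derivatives. *)
Lemma bounded_partials_continuous (g : pt -> R) (dg : 'I_4 -> pt -> R) (x : pt) C :
  (forall i z, is_derive z (evec R i) g (dg i z)) ->
  (forall i z, `|z - x| <= 1 -> `|dg i z| <= C) ->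
  {for x, continuous g}.
Proof.
move=> dgP dgC; apply/continuous_epsP => e e0.
have C0 : 0 <= C.
  by apply: le_trans (dgC ord0 x _) => //; rewrite subrr normr0.
pose d := Num.min 1 (e / (4 * (C + 1))).
have C1 : 0 < C + 1 by lra.
have d0 : 0 < d by rewrite lt_min ltr01 divr_gt0// mulr_gt0.
exists d => // u /ltW xu.
have [z zx E] := telescope_mvt x (u - x) dgP.
move: E; rewrite [x + (u - x)]addrC subrK => ->.
have u1 : `|u - x| <= 1 by rewrite (le_trans xu)// ge_min lexx.
have u2 : `|u - x| <= e / (4 * (C + 1)) by rewrite (le_trans xu)// ge_min lexx orbT.
apply: le_trans (ler_norm_sum _ _ _) _.
apply: le_trans (_ : \sum_(i < 4) e / 4 <= _); last first.
  by rewrite sumr_const card_ord; lra.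
apply: ler_sum => i _; rewrite normrM.
apply: le_trans (_ : e / (4 * (C + 1)) * C <= _).
  apply: ler_pM => //; first exact: le_trans (coord_le _ _) u2.
  by apply: dgC; exact: le_trans (zx i) u1.
rewrite invfM mulrA -mulrA ler_piMr//; first by rewrite divr_ge0// ltW.
by rewrite mulrC ler_pdivrMr// mul1r lerDl.
Qed.

Lemma chain_rule (g : pt -> R) (dg : 'I_4 -> pt -> R) (c : 'I_4 -> R -> R)
    (dc : 'I_4 -> R) (t : R) :
  (forall i z, is_derive z (evec R i) g (dg i z)) ->
  (forall i, continuous (dg i)) ->
  (forall i, is_derive t 1 (c i) (dc i)) ->
  is_derive t 1 (fun s => g (\row_i c i s)) (\sum_i dc i * dg i (\row_i c i t)).
Proof.
move=> dgP cdg dcP; apply: is_derive_eps => e e0.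
set X := (\row_i c i t : pt).
pose A := 1 + \sum_i (`|dc i| + `|dg i X|).
have A1 : 1 <= A by rewrite lerDl sumr_ge0// => i _; rewrite addr_ge0.
have A0 : 0 < A by exact: lt_le_trans A1.
have le12 i : `|dc i| + `|dg i X| <= A.
  rewrite /A (bigD1 i)//=.
  have : 0 <= \sum_(j < 4 | j != i) (`|dc j| + `|dg j X|).
    by rewrite sumr_ge0// => j _; rewrite addr_ge0.
  lra.
have le1 i : `|dc i| <= A by apply: le_trans (le12 i); rewrite lerDl.
have le2 i : `|dg i X| <= A by apply: le_trans (le12 i); rewrite lerDr.
(* Each of the four coordinates produces three error products (error of c_i times error of dg_i, and
   each error times a main term bounded by A), hence 12 shares of e. *)
pose e1 := Num.min 1 (e / (12 * A)).
have e10 : 0 < e1 by rewrite lt_min ltr01 divr_gt0// mulr_gt0.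
have e1e : e1 * (12 * A) <= e.
  by rewrite -ler_pdivlMr ?mulr_gt0// ge_min lexx orbT.
have e11 : e1 <= 1 by rewrite ge_min lexx.
have [r r0 Hr] := continuous_eps_fin (fun i => cdg i X) e10.
have [d d0 Hd] : exists2 d : R, 0 < d & forall h i, `|h| < d ->
    `|c i (t + h) - c i t - h * dc i| <= e1 * `|h|.
  have : \forall h \near (0 : R), forall i, `|c i (t + h) - c i t - h * dc i| <= e1 * `|h|.
    apply: (@filter_forall _ _ (fun i h => `|c i (t + h) - c i t - h * dc i| <= e1 * `|h|) (nbhs (0 : R))) => i.
    have [d d0 H] := is_derive_epsP (dcP i) e10.
    exists d => // h /=; rewrite sub0r normrN => /H.
    by rewrite -[h *: 1]/(h * 1) mulr1.
  move=> [d /= d0 H]; exists d => // h i hd; apply: H.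
  by rewrite /= sub0r normrN.
exists (Num.min d (r / (A + 1))) => [|h].
  by rewrite lt_min d0 divr_gt0// ltr_wpDr.
rewrite lt_min => /andP[hd hr].
rewrite -[h *: 1]/(h * 1) mulr1.
set Y := (\row_i c i (t + h) : pt).
have [z zx] := telescope_mvt X (Y - X) dgP.
rewrite [X + (Y - X)]addrC subrK => E.
have YX i : `|(Y - X) ord0 i| <= (A + 1) * `|h|.
  rewrite !mxE.
  have -> : c i (t + h) - c i t = (c i (t + h) - c i t - h * dc i) + h * dc i by ring.
  apply: le_trans (ler_normD _ _) _; rewrite mulrDl mul1r addrC lerD//.
    by rewrite normrM mulrC ler_wpM2r.
  by apply: le_trans (Hd h i hd) _; rewrite ler_piMl.
have YXr : `|Y - X| < r.
  apply: le_lt_trans (_ : (A + 1) * `|h| < r).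
    by apply: rv_norm_le => //; rewrite mulr_ge0// addr_ge0// ltW.
  by rewrite mulrC -ltr_pdivlMr// ltr_wpDr.
rewrite E mulr_sumr -sumrB.
apply: le_trans (ler_norm_sum _ _ _) _.
apply: le_trans (_ : \sum_(i < 4) (e / 4 * `|h|) <= _); last first.
  by rewrite sumr_const card_ord; lra.
apply: ler_sum => i _.
have hz := Hr i (z i) (le_lt_trans (zx i) YXr).
have hc := Hd h i hd.
have -> : (Y - X) ord0 i * dg i (z i) - h * (dc i * dg i X) =
   (c i (t + h) - c i t - h * dc i) * (dg i (z i) - dg i X)
   + (c i (t + h) - c i t - h * dc i) * dg i X + h * (dc i * (dg i (z i) - dg i X)).
  by rewrite !mxE; ring.
have -> : e / 4 * `|h| = e / 12 * `|h| + e / 12 * `|h| + e / 12 * `|h| by field.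
have eA : e1 * A <= e / 12 by rewrite ler_pdivlMr// -mulrA [A * 12]mulrC.
have e12 : e1 <= e / 12.
  by apply: le_trans eA; rewrite ler_peMr// ltW.
apply: le_trans (ler_normD _ _) _; apply: lerD.
  apply: le_trans (ler_normD _ _) _; apply: lerD; rewrite normrM.
    apply: le_trans (_ : e1 * `|h| * 1 <= _).
      by apply: ler_pM => //; exact: le_trans hz e11.
    by rewrite mulr1 ler_wpM2r.
  apply: le_trans (_ : e1 * `|h| * A <= _); first exact: ler_pM.
  by rewrite mulrAC ler_wpM2r.
rewrite normrM normrM mulrC ler_wpM2r//.
by apply: le_trans eA; rewrite [e1 * A]mulrC; apply: ler_pM.
Qed.

End PointSpace.

(* Sealed copies of [dpartial] and [smooth]: unification must never compare two
   derivatives, or two smoothness statements, by unfolding limits. *)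
Lemma pd_seal : {D : forall R : realType, 'I_4 -> (pt R -> R) -> pt R -> R |
  forall R : realType, D R = @dpartial R}.
Proof. by exists (fun R => @dpartial R). Qed.

Definition pd (R : realType) (i : 'I_4) (f : pt R -> R) : pt R -> R :=
  sval pd_seal R i f.

Lemma smooth_seal : {P : forall R : realType, (pt R -> R) -> Prop |
  forall (R : realType) (f : pt R -> R), P R f <-> smooth f}.
Proof. by exists (fun R => @smooth R). Qed.

Definition Smooth (R : realType) (f : pt R -> R) : Prop := sval smooth_seal R f.

Definition pmulti (R : realType) (s : seq 'I_4) (f : pt R -> R) : pt R -> R :=
  foldr (@pd R) f s.

Definition dal (R : realType) (f : pt R -> R) : pt R -> R :=
  fun x => - pd 0 (pd 0 f) x + pd 1 (pd 1 f) x + pd 2 (pd 2 f) x + pd 3 (pd 3 f) x.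

Lemma pdE (R : realType) i (f : pt R -> R) : dpartial i f = pd i f.
Proof. by rewrite /pd (svalP pd_seal). Qed.

Lemma SmoothE (R : realType) (f : pt R -> R) : Smooth f <-> smooth f.
Proof. exact: (svalP smooth_seal). Qed.

Lemma pmultiE (R : realType) s (f : pt R -> R) : dmulti s f = pmulti s f.
Proof. by elim: s => //= i s ->; rewrite pdE. Qed.

Lemma dalE (R : realType) (f : pt R -> R) : box f = dal f.
Proof. by apply/funext => x; rewrite /box !pmultiE. Qed.

Section Smooth.
Context {R : realType}.
Local Notation pt := (pt R).
Implicit Types (f g : pt -> R) (x y : pt) (i j : 'I_4) (s t : seq 'I_4).

Lemma dmulti_cat s t f : dmulti (s ++ t) f = dmulti s (dmulti t f).
Proof. by elim: s => //= i s ->. Qed.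

Lemma smooth_pmulti t f : Smooth f -> Smooth (pmulti t f).
Proof.
move=> /SmoothE sf; apply/SmoothE => s.
by rewrite -(pmultiE t) -(dmulti_cat s t); exact: sf.
Qed.

Lemma smooth_pd i f : Smooth f -> Smooth (pd i f).
Proof. exact: (@smooth_pmulti [:: i]). Qed.

Lemma smooth_continuous f : Smooth f -> continuous f.
Proof. by move=> /SmoothE sf; case: (sf [::]). Qed.

Lemma smooth_derivable i f : Smooth f -> forall x, derivable f x (evec R i).
Proof. by move=> /SmoothE sf x; case: (sf [::]). Qed.

Lemma smooth_is_derive f : Smooth f ->
  forall i x, is_derive x (evec R i) f (pd i f x).
Proof. by move=> sf i x; apply: DeriveDef; [exact: smooth_derivable|rewrite -pdE]. Qed.

(** Coinduction: the iterated partial derivatives of a member are members again, so continuity and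
    derivability are checked once for the whole class. *)
Lemma smooth_class (P : (pt -> R) -> Prop) :
  (forall f, P f -> continuous f /\
    forall i, (forall x, derivable f x (evec R i)) /\ P (pd i f)) ->
  forall f, P f -> Smooth f.
Proof.
move=> H f Pf; apply/SmoothE => s.
have Ps : P (dmulti s f) by elim: s => //= i s /H[_ /(_ i)[]]; rewrite pdE.
by have [c d] := H _ Ps; split=> // i x; have [] := d i.
Qed.

Lemma pd_derive i f x : pd i f x = 'D_(evec R i) f x.
Proof. by rewrite -pdE. Qed.

Lemma pd_lin i f g (a b : R) :
  (forall x, derivable f x (evec R i)) -> (forall x, derivable g x (evec R i)) ->
  (forall x, is_derive x (evec R i) (fun x => a * f x + b * g x)
     (a * pd i f x + b * pd i g x)).
Proof.
move=> df dg x.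
have Df := derivableP (df x); have Dg := derivableP (dg x); rewrite !pd_derive.
exact: (is_deriveD (f := a \*: f) (g := b \*: g)).
Qed.

Lemma is_derive_unique (V : normedModType R) (h : V -> R) (x v : V) (a b : R) :
  is_derive x v h a -> is_derive x v h b -> a = b.
Proof. by move=> [_ <-] [_ <-]. Qed.

Lemma is_derive_ext (V : normedModType R) (h k : V -> R) (x v : V) (a : R) :
  (forall z : V, h z = k z) -> is_derive x v h a -> is_derive x v k a.
Proof. by move=> /funext ->. Qed.

Lemma smooth_lin f g (a b : R) : Smooth f -> Smooth g ->
  Smooth (fun x => a * f x + b * g x) /\
  forall i, pd i (fun x => a * f x + b * g x) =
            (fun x => a * pd i f x + b * pd i g x).
Proof.
have key f' g' : Smooth f' -> Smooth g' -> forall i,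
    (forall x, derivable (fun x => a * f' x + b * g' x) x (evec R i)) /\
    pd i (fun x => a * f' x + b * g' x) =
            (fun x => a * pd i f' x + b * pd i g' x).
  move=> sf sg i.
  have D := @pd_lin i f' g' a b (smooth_derivable sf) (smooth_derivable sg).
  split; first by move=> x; case: (D x).
  by apply/funext => x; rewrite pd_derive; case: (D x).
move=> sf sg; split; last by move=> i; exact: (key _ _ sf sg i).2.
apply: (@smooth_class (fun h => exists f g, [/\ Smooth f, Smooth g & h = (fun x => a * f x + b * g x)])).
  move=> _ [f' [g' [sf' sg' ->]]]; split.
    by apply: ctsD; apply: ctsM; (exact: cts_cst || exact: smooth_continuous).
  move=> i; have [h1 h2] := key _ _ sf' sg' i; split=> //.
  by rewrite h2; exists (pd i f'), (pd i g'); split; [exact: smooth_pd|exact: smooth_pd|].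
by exists f, g.
Qed.

Lemma smoothL f g (a b : R) : Smooth f -> Smooth g -> Smooth (fun x => a * f x + b * g x).
Proof. by move=> sf sg; have [] := smooth_lin a b sf sg. Qed.

Lemma pdL i f g (a b : R) : Smooth f -> Smooth g ->
  pd i (fun x => a * f x + b * g x) =
            (fun x => a * pd i f x + b * pd i g x).
Proof. by move=> sf sg; have [_] := smooth_lin a b sf sg. Qed.

Lemma pmultiL s f g (a b : R) : Smooth f -> Smooth g ->
  pmulti s (fun x => a * f x + b * g x) =
            (fun x => a * pmulti s f x + b * pmulti s g x).
Proof.
move=> sf sg; elim: s => //= i s ->.
by rewrite pdL//; exact: smooth_pmulti.
Qed.

Lemma smoothZ f (a : R) : Smooth f -> Smooth (fun x => a * f x).
Proof.
move=> sf; have := smoothL a 0 sf sf.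
by congr Smooth; apply/funext => x; rewrite mul0r addr0.
Qed.

Lemma smoothD f g : Smooth f -> Smooth g -> Smooth (fun x => f x + g x).
Proof.
move=> sf sg; have := smoothL 1 1 sf sg.
by congr Smooth; apply/funext => x; rewrite !mul1r.
Qed.

Lemma smooth0 : Smooth (fun _ : pt => 0 : R).
Proof.
apply: (@smooth_class (fun h => h = fun=> 0)) => // _ ->; split; first exact: cts_cst.
move=> i; split; first by move=> x; exact: derivable_cst.
by apply/funext => x; rewrite pd_derive derive_cst.
Qed.

Lemma smooth_dal f : Smooth f -> Smooth (dal f).
Proof.
move=> sf; have s2 i : Smooth (pd i (pd i f)) by do 2 apply: smooth_pd.
do 2 (apply: smoothD; last exact: s2); apply: smoothD; last exact: s2.
have := smoothZ (-1) (s2 0).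
by congr Smooth; apply/funext => x; rewrite mulN1r.
Qed.

Lemma smooth_chain f (c : 'I_4 -> R -> R) (dc : 'I_4 -> R) (r : R) :
  Smooth f -> (forall i, is_derive r 1 (c i) (dc i)) ->
  is_derive r 1 (fun u => f (\row_i c i u)) (\sum_i dc i * pd i f (\row_i c i r)).
Proof.
move=> sf dcP; apply: (chain_rule (dg := fun i => pd i f)) => // i.
  by move=> z; exact: smooth_is_derive.
exact/smooth_continuous/smooth_pd.
Qed.

Lemma cts_plane x (v w : pt) : continuous (fun z : R * R => x + z.1 *: v + z.2 *: w).
Proof.
move=> z; apply: cvgD; last by apply: cvgZl; exact: cvg_snd.
by apply: cvgD; [exact: cvg_cst|apply: cvgZl; exact: cvg_fst].
Qed.

(** Along direction j, f is the integral of [pd j f]. Differentiating this formula in direction i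
    under the integral sign gives pd i f (x + t e_j) - pd i f x as the integral over [0, t] of pd i
    (pd j f); dividing by t and letting t tend to 0 compares the two mixed derivatives. *)
Lemma pdC f i j : Smooth f -> pd i (pd j f) = pd j (pd i f).
Proof.
move=> sf; apply/funext => x; apply/eqP; rewrite -subr_eq0 -normr_eq0; rewrite eq_le normr_ge0 andbT; apply/ler_addgt0Pr => e e0; rewrite add0r.
pose psi (u : R) := pd i (pd j f) (x + u *: evec R j).
have cts_ij g : Smooth g -> continuous (fun z : R * R => g (x + z.1 *: evec R i + z.2 *: evec R j)).
  move=> sg; apply: cts_comp; [exact: smooth_continuous|exact: cts_plane].
have psiE : psi = (fun b : R => pd i (pd j f) (x + 0 *: evec R i + b *: evec R j)).
  by apply/funext => u; rewrite /psi scale0r addr0.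
have cpsi : continuous psi.
  rewrite psiE; exact: (@sect1_continuous _ _ _
    (fun a b : R => pd i (pd j f) (x + a *: evec R i + b *: evec R j)) 0
    (cts_ij _ (smooth_pd i (smooth_pd j sf)))).
have key (t : R) : 0 <= t ->
  pd i f (x + t *: evec R j) = pd i f x + Int 0 t psi.
  move=> t0.
  have E (a : R) : f (x + t *: evec R j + a *: evec R i) = f (x + a *: evec R i) +
      Int 0 t (fun u => pd j f (x + a *: evec R i + u *: evec R j)).
    have dF (u : R) : is_derive u 1 (fun u => f (x + a *: evec R i + u *: evec R j))
        (pd j f (x + a *: evec R i + u *: evec R j)).
      by apply: line_derive => y; exact: smooth_is_derive.
    rewrite (Int_FTC t0 _ dF).
      by rewrite scale0r addr0 [x + t *: _ + _]addrAC [RHS]addrC subrK.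
    apply: cts_comp; first exact/smooth_continuous/smooth_pd.
    by move=> u; apply: cvgD; [exact: cvg_cst|apply: cvgZl; exact: cvg_id].
  have D1 : is_derive (0 : R) 1 (fun a => f (x + t *: evec R j + a *: evec R i))
     (pd i f (x + t *: evec R j)).
    have := line_derive (x + t *: evec R j) (fun y => smooth_is_derive sf i y) 0.
    by rewrite scale0r addr0.
  have D2 : is_derive (0 : R) 1 (fun a => f (x + a *: evec R i)) (pd i f x).
    have := line_derive (x) (fun y => smooth_is_derive sf i y) 0.
    by rewrite scale0r addr0.
  have D3 : is_derive (0 : R) 1 (fun a =>
      Int 0 t (fun u => pd j f (x + a *: evec R i + u *: evec R j))) (Int 0 t psi).
    rewrite psiE.
    pose F := fun a u : R => pd j f (x + a *: evec R i + u *: evec R j).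
    pose dF := fun a u : R => pd i (pd j f) (x + a *: evec R i + u *: evec R j).
    apply: (@Int_derive R F dF 0 t 0 t0).
    - move=> a u; rewrite /F /dF.
      have -> : (fun a => pd j f (x + a *: evec R i + u *: evec R j)) =
         (fun a => pd j f (x + u *: evec R j + a *: evec R i)).
        by apply/funext => b; rewrite addrAC.
      rewrite [x + _ + _]addrAC.
      exact: (line_derive (x + u *: evec R j)
         (fun y => smooth_is_derive (smooth_pd j sf) i y)).
    - exact: (cts_ij _ (smooth_pd j sf)).
    - exact: (cts_ij _ (smooth_pd i (smooth_pd j sf))).
  have D4 := is_deriveD D2 D3.
  apply: is_derive_unique D1 _; apply: is_derive_ext D4 => a.
  by rewrite E.
have psi0 : psi 0 = pd i (pd j f) x by rewrite /psi scale0r addr0.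
clearbody psi.
have e20 : 0 < e / 2 by rewrite divr_gt0.
have [d1 d10 H1] := (continuous_epsP psi (0 : R)).1 (cpsi 0) _ e20.
have [d2 d20 H2] := is_derive_epsP (smooth_is_derive (smooth_pd i sf) j x) e20.
pose t := Num.min d1 d2 / 2.
have m0 : 0 < Num.min d1 d2 by rewrite lt_min d10.
have t0 : 0 < t by rewrite divr_gt0.
have t1 : t < d1.
  apply: lt_le_trans (_ : Num.min d1 d2 <= _); last by rewrite ge_min lexx.
  by rewrite /t; lra.
have t2 : t < d2.
  apply: lt_le_trans (_ : Num.min d1 d2 <= _); last by rewrite ge_min lexx orbT.
  by rewrite /t; lra.
have := H2 t; rewrite (gtr0_norm t0) => /(_ t2).
rewrite (key _ (ltW t0)) [_ + Int 0 t psi - _]addrAC subrr add0r => K1.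
have K2 : `|Int 0 t psi - t * psi 0| <= e / 2 * t.
  have c0 : continuous (fun _ : R => psi 0) by exact: cts_cst.
  have -> : t * psi 0 = Int 0 t (fun=> psi 0) by rewrite (Int_cst _ (ltW t0)) subr0 mulrC.
  rewrite -(IntB _ _ cpsi c0).
  have := @Int_bound R 0 t (fun u => psi u - psi 0) (e / 2) (ltW t0) (ctsB cpsi c0).
  rewrite subr0; apply=> u u0 ut; apply: H1; rewrite subr0 ger0_norm ?u0//.
  exact: le_lt_trans t1.
rewrite -psi0 -(ler_pM2r t0) -{1}(gtr0_norm t0) -normrM.
move: (pd j (pd i f) x) K1 K2 => D.
move: (psi 0) (Int 0 t psi) => p I K1 K2.
have -> : (p - D) * t = (I - t * D) - (I - t * p) by ring.
apply: le_trans (ler_normB _ _) _.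
rewrite [e]splitr mulrDl; exact: lerD.
Qed.

Lemma pdD i f g : Smooth f -> Smooth g ->
  pd i (fun x => f x + g x) = (fun x => pd i f x + pd i g x).
Proof.
move=> sf sg; have := pdL i 1 1 sf sg.
under eq_fun do rewrite !mul1r.
by move=> ->; apply/funext => x; rewrite !mul1r.
Qed.

Lemma sqr_norm2 (h : R) : h ^+ 2 = `|h| * `|h|.
Proof. by rewrite -normrM -expr2 ger0_norm ?sqr_ge0. Qed.

Lemma ball_lipschitz f i (r : R) : Smooth f ->
  exists2 C : R, 0 <= C & forall x h, `|x| <= r -> `|h| <= 1 ->
    `|f (x + h *: evec R i) - f x| <= C * `|h|.
Proof.
move=> sf.
have [C C0 HC] := cball_bounded (r + 1) (smooth_continuous (smooth_pd i sf)).
exists C => // x h xr h1.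
have [k kh ->] := line_mvt x h (fun y => smooth_is_derive sf i y).
rewrite normrM mulrC ler_wpM2r//; apply: HC.
apply: le_trans (ler_normD _ _) _; apply: lerD => //.
rewrite mx_normZ -[1]mul1r ler_pM//; [exact: le_trans kh h1|exact: evec_norm].
Qed.

Lemma ball_taylor f i (r : R) : Smooth f ->
  exists2 C : R, 0 <= C & forall x h, `|x| <= r -> `|h| <= 1 ->
    `|f (x + h *: evec R i) - f x - h * pd i f x| <= C * h ^+ 2.
Proof.
move=> sf.
have [C C0 HC] := ball_lipschitz i r (smooth_pd i sf).
exists C => // x h xr h1.
have [k kh ->] := line_mvt x h (fun y => smooth_is_derive sf i y).
rewrite -mulrBr normrM sqr_norm2 mulrCA ler_wpM2l//.
apply: le_trans (HC x k xr (le_trans kh h1)) _.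
exact: ler_wpM2l.
Qed.

(* The last two hypotheses (local bounds, and a second-order Taylor estimate for
   Op along each axis) avoid differentiating under the integral defining Op. *)
Lemma operator_smooth (Op : (pt -> R) -> pt -> R) (P : (pt -> R) -> Prop) :
  (forall f i, P f -> P (pd i f)) ->
  (forall f (r : R), P f -> exists C : R, forall x, `|x| <= r -> `|Op f x| <= C) ->
  (forall f i (r : R), P f -> exists C : R, forall x h, `|x| <= r -> `|h| <= 1 ->
     `|Op f (x + h *: evec R i) - Op f x - h * Op (pd i f) x| <= C * h ^+ 2) ->
  forall f, P f -> Smooth (Op f) /\ forall i, pd i (Op f) = Op (pd i f).
Proof.
move=> Pd Pb Pt.
have D f : P f -> forall i x, is_derive x (evec R i) (Op f) (Op (pd i f) x).
  move=> Pf i x; apply: is_derive_eps => e e0.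
  have [C HC] := Pt f i `|x| Pf.
  have C1 : 0 < `|C| + 1 by rewrite ltr_wpDl.
  exists (Num.min 1 (e / (`|C| + 1))); first by rewrite lt_min ltr01 divr_gt0.
  move=> h; rewrite lt_min => /andP[h1 he].
  apply: le_trans (HC x h (lexx _) (ltW h1)) _.
  rewrite sqr_norm2 mulrA ler_wpM2r//.
  move: he; rewrite ltr_pdivlMr// => /ltW; apply: le_trans.
  rewrite [C * _]mulrC ler_wpM2l//.
  by rewrite (le_trans (ler_norm _))// lerDl.
have E f : P f -> forall i, pd i (Op f) = Op (pd i f).
  by move=> Pf i; apply/funext => x; rewrite pd_derive; case: (D f Pf i x).
move=> f Pf; split; last exact: E.
apply: (@smooth_class (fun h => exists2 f, P f & h = Op f)); last by exists f.
move=> _ [g Pg ->]; split.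
  move=> x.
  have /choice[C HC] : forall i, exists C : R, forall z, `|z| <= `|x| + 1 -> `|Op (pd i g) z| <= C.
    by move=> i; exact/Pb/Pd.
  apply: (@bounded_partials_continuous _ (Op g) (fun i => Op (pd i g)) x (\sum_i `|C i|)).
    by move=> i z; exact: D.
  move=> i z zx; apply: le_trans (HC i z _) _.
    have -> : z = x + (z - x) by rewrite [x + (z - x)]addrC subrK.
    by apply: le_trans (ler_normD _ _) _; rewrite lerD2l.
  by rewrite (bigD1 i)//= (le_trans (ler_norm _))// lerDl sumr_ge0.
move=> i; split; first by move=> x; case: (D g Pg i x).
by rewrite E//; exists (pd i g) => //; exact: Pd.
Qed.

End Smooth.

(** * Spherical means and integrals over the backward cone *)

(* [is_derive] is a type class; this alias stays out of instance resolution. *)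
Definition Der (R : realType) (f : R -> R) (t a : R) : Prop := is_derive t 1 f a.

Section RealCalculus.
Context {R : realType}.
Implicit Types f g : R -> R.

Lemma derD f g (t a b : R) : Der f t a -> Der g t b -> Der (fun s => f s + g s) t (a + b).
Proof. exact: is_deriveD. Qed.

Lemma derB f g (t a b : R) : Der f t a -> Der g t b -> Der (fun s => f s - g s) t (a - b).
Proof. exact: is_deriveB. Qed.

Lemma derN f (t a : R) : Der f t a -> Der (fun s => - f s) t (- a).
Proof. exact: is_deriveN. Qed.

Lemma derM f g (t a b : R) : Der f t a -> Der g t b ->
  Der (fun s => f s * g s) t (a * g t + f t * b).
Proof.
move=> df dg; have := @is_deriveM _ _ f g t 1 a b df dg.
by rewrite /Der -![_ *: _]/(_ * _) addrC [g t * a]mulrC.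
Qed.

Lemma derZ f (k t a : R) : Der f t a -> Der (fun s => k * f s) t (k * a).
Proof. by move=> df; have := @is_deriveZ _ _ _ f k t 1 a df. Qed.

Lemma der_cst (k t : R) : Der (fun _ : R => k) t 0.
Proof. exact: is_derive_cst. Qed.

Lemma der_id (t : R) : Der (fun s : R => s) t 1.
Proof. exact: is_derive_id. Qed.

Lemma der_sin (t : R) : Der (fun s : R => sin s) t (cos t).
Proof. exact: is_derive_sin. Qed.

Lemma der_cos (t : R) : Der (fun s : R => cos s) t (- sin t).
Proof. exact: is_derive_cos. Qed.

Lemma der_eq f (t a b : R) : Der f t a -> a = b -> Der f t b.
Proof. by move=> df <-. Qed.

Lemma der_ext f g (t a : R) : (forall s, f s = g s) -> Der f t a -> Der g t a.
Proof. by move=> /funext ->. Qed.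

Lemma der_cts f (df : R -> R) : (forall t : R, Der f t (df t)) -> continuous f.
Proof.
by move=> H t; apply: differentiable_continuous; apply/derivable1_diffP; case: (H t).
Qed.

End RealCalculus.

Section Vec4.
Context {R : realType}.
Local Notation pt := (pt R).
Implicit Types (f : pt -> R) (x : pt).

Definition vec4 (a b c d : R) : pt := \row_(i < 4) nth 0 [:: a; b; c; d] i.

Definition at4 f x (a b c d : R) : R := f (x + vec4 a b c d).

Lemma cts_at4 (U : topologicalType) f x (a b c d : U -> R) : Smooth f ->
  continuous a -> continuous b -> continuous c -> continuous d ->
  continuous (fun u => at4 f x (a u) (b u) (c u) (d u)).
Proof.
move=> sf ca cb cc cd; rewrite /at4 /vec4.
apply: cts_comp; first exact: smooth_continuous.
move=> u; apply: cvgD; first exact: cvg_cst.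
apply: (@cts_row R U (fun i u => nth 0 [:: a u; b u; c u; d u] i)) => -[[|[|[|[|//]]]] ?] /=.
- exact: ca.
- exact: cb.
- exact: cc.
- exact: cd.
Qed.

Lemma der_at4 f x (a b c d : R -> R) (a' b' c' d' t : R) : Smooth f ->
  Der a t a' -> Der b t b' -> Der c t c' -> Der d t d' ->
  Der (fun s => at4 f x (a s) (b s) (c s) (d s)) t (a' * at4 (pd 0 f) x (a t) (b t) (c t) (d t) + b' * at4 (pd 1 f) x (a t) (b t) (c t) (d t)
    + c' * at4 (pd 2 f) x (a t) (b t) (c t) (d t) + d' * at4 (pd 3 f) x (a t) (b t) (c t) (d t)).
Proof.
move=> sf da db dc dd.
pose co (i : 'I_4) (s : R) := x ord0 i + nth 0 [:: a s; b s; c s; d s] i.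
have coE s : x + vec4 (a s) (b s) (c s) (d s) = \row_i co i s.
  by apply/rowP => i; rewrite !mxE.
rewrite /at4 coE.
apply: (@der_ext _ (fun s => f (\row_i co i s))); first by move=> s; rewrite coE.
have D (i : 'I_4) : Der (co i) t (nth 0 [:: a'; b'; c'; d'] i).
  rewrite -[X in Der _ _ X]add0r.
  apply: (@derD _ (fun=> x ord0 i) (fun s => nth 0 [:: a s; b s; c s; d s] i)); first exact: der_cst.
  by case: i => [[|[|[|[|//]]]] ?].
apply: der_eq (smooth_chain sf D) _.
rewrite !big_ord_recl big_ord0 addr0 !addrA.
have -> : lift ord0 ord0 = 1 :> 'I_4 by apply: val_inj.
have -> : lift ord0 (lift ord0 ord0) = 2 :> 'I_4 by apply: val_inj.
have -> : lift ord0 (lift ord0 (lift ord0 ord0)) = 3 :> 'I_4 by apply: val_inj.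
by have -> : ord0 = 0 :> 'I_4 by apply: val_inj.
Qed.

End Vec4.

Ltac cts := repeat (cbn beta; lazymatch goal with
  | |- (forall x, continuous_at x (fun z => @GRing.add _ (@?a z) (@GRing.opp _ (@?b z)))) => apply: (@ctsB _ _ a b)
  | |- (forall x, continuous_at x (fun z => @GRing.add _ (@?a z) (@?b z))) => apply: (@ctsD _ _ a b)
  | |- (forall x, continuous_at x (fun z => @GRing.mul _ (@?a z) (@?b z))) => apply: (@ctsM _ _ a b)
  | |- (forall x, continuous_at x (fun z => @GRing.opp _ (@?a z))) => apply: (@ctsN _ _ a)
  | |- (forall x, continuous_at x (fun z => sin (@?a z))) => apply: (@cts_comp _ _ _ sin a); first exact: continuous_sin
  | |- (forall x, continuous_at x (fun z => cos (@?a z))) => apply: (@cts_comp _ _ _ cos a); first exact: continuous_cos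
  | |- (forall x, continuous_at x (fun z => fst (@?a z))) => apply: (@cts_comp _ _ _ fst a); first exact: cts_fst
  | |- (forall x, continuous_at x (fun z => snd (@?a z))) => apply: (@cts_comp _ _ _ snd a); first exact: cts_snd
  | |- (forall x, continuous_at x (fun z => at4 ?f ?y (@?a z) (@?b z) (@?c z) (@?d z))) =>
      apply: (@cts_at4 _ _ f y a b c d); first by auto 10 using smooth_pd
  | |- (forall x, continuous_at x fst) => exact: cts_fst
  | |- (forall x, continuous_at x snd) => exact: cts_snd
  | |- (forall x, continuous_at x (fun z => z)) => exact: cts_id
  | |- (forall x, continuous_at x (fun z => ?c)) => exact: cts_cst
  end).

Ltac der1 := cbn beta; lazymatch goal with
  | |- Der (fun z => z) _ _ => exact: der_id
  | |- Der (fun z => @GRing.add _ (@?a z) (@GRing.opp _ (@?b z))) _ _ => apply: (@derB _ a b)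
  | |- Der (fun z => @GRing.add _ (@?a z) (@?b z)) _ _ => apply: (@derD _ a b)
  | |- Der (fun z => @GRing.mul _ (@?a z) (@?b z)) _ _ => apply: (@derM _ a b)
  | |- Der (fun z => @GRing.opp _ (@?a z)) _ _ => apply: (@derN _ a)
  | |- Der (fun z => sin z) _ _ => exact: der_sin
  | |- Der (fun z => cos z) _ _ => exact: der_cos
  | |- Der (fun z => at4 ?f ?y (@?a z) (@?b z) (@?c z) (@?d z)) _ _ =>
      apply: (@der_at4 _ f y a b c d); first by auto 10 using smooth_pd
  | |- Der (fun z => ?c) _ _ => exact: der_cst
  end.
Ltac der := apply: der_eq; [repeat der1|cbn beta].

Section SphericalMeans.
Context {R : realType}.
Local Notation pt := (pt R).
Implicit Types (f : pt -> R) (x : pt) (tau r th ph : R).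

Definition S2 (g : R -> R -> R) : R :=
  Int 0 pi (fun th => Int 0 (pi *+ 2) (fun ph => sin th * g th ph)).

Let pi0 : (0 : R) <= pi := pi_ge0 R.
Let pi20 : (0 : R) <= pi *+ 2. Proof. by rewrite mulrn_wge0// pi_ge0. Qed.

Definition cts2 (g : R -> R -> R) := continuous (fun z : R * R => g z.1 z.2).
Definition cts3 (g : R -> R -> R -> R) := continuous (fun z : R * R * R => g z.1.1 z.1.2 z.2).

Lemma S2_inner_cts (g : R -> R -> R) : cts2 g ->
  forall th, continuous (fun ph => sin th * g th ph).
Proof.
move=> cg th; apply: ctsM; first exact: cts_cst.
exact: (@sect1_continuous _ _ _ g th cg).
Qed.

Lemma S2_outer_cts (g : R -> R -> R) : cts2 g ->
  continuous (fun th => Int 0 (pi *+ 2) (fun ph => sin th * g th ph)).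
Proof.
move=> cg; apply: (Int_continuous (f := fun th ph => sin th * g th ph)) => //.
by apply: ctsM; [cts|exact: cg].
Qed.

Lemma eq_S2 (g h : R -> R -> R) : (forall th ph, g th ph = h th ph) -> S2 g = S2 h.
Proof. by move=> gh; apply: eq_Int => th _ _; apply: eq_Int => ph _ _; rewrite gh. Qed.

Lemma S2D (g h : R -> R -> R) : cts2 g -> cts2 h ->
  S2 (fun th ph => g th ph + h th ph) = S2 g + S2 h.
Proof.
move=> cg ch; rewrite /S2 -IntD; [|exact: S2_outer_cts|exact: S2_outer_cts].
apply: eq_Int => th _ _; rewrite -IntD; [|exact: S2_inner_cts|exact: S2_inner_cts].
by apply: eq_Int => ph _ _; rewrite mulrDr.
Qed.

Lemma S2Z (k : R) (g : R -> R -> R) : cts2 g ->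
  S2 (fun th ph => k * g th ph) = k * S2 g.
Proof.
move=> cg; rewrite /S2 -IntZ; last exact: S2_outer_cts.
apply: eq_Int => th _ _; rewrite -IntZ; last exact: S2_inner_cts.
by apply: eq_Int => ph _ _; rewrite mulrCA.
Qed.

Lemma S2_bound (g : R -> R -> R) (C : R) : 0 <= C -> cts2 g ->
  (forall th ph, `|g th ph| <= C) -> `|S2 g| <= C * (pi *+ 2) * pi.
Proof.
move=> C0 cg gC; rewrite /S2 -[X in _ * X]subr0; apply: Int_bound => //.
  exact: S2_outer_cts.
move=> th _ _; rewrite -[X in _ * X]subr0; apply: Int_bound => //.
  exact: S2_inner_cts.
move=> ph _ _; rewrite normrM -[C]mul1r ler_pM//.
by rewrite ler_norml sin_geN1 sin_le1.
Qed.

Lemma S2_cst (k : R) : S2 (fun _ _ => k) = 4 * pi * k.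
Proof.
rewrite /S2 (eq_Int (g := fun th => sin th * (k * (pi *+ 2)))); last first.
  by move=> th _ _; rewrite Int_cst// subr0 mulrA.
have D (t : R) : Der (fun t => - cos t * (k * (pi *+ 2))) t (sin t * (k * (pi *+ 2))).
  by der; ring.
rewrite (Int_FTC pi0 _ D); last by cts.
by rewrite cospi cos0; ring.
Qed.

Lemma S2_derive (g dg : R -> R -> R -> R) (t : R) :
  (forall t th ph, Der (fun t => g t th ph) t (dg t th ph)) ->
  cts3 g -> cts3 dg ->
  Der (fun t => S2 (g t)) t (S2 (dg t)).
Proof.
move=> D cg cdg.
have cs (h : R -> R -> R -> R) : cts3 h -> forall th, continuous (fun z : R * R => sin th * h z.1 th z.2).
  move=> ch th; apply: ctsM; first exact: cts_cst.
  apply: (@cts_comp _ _ _ (fun z : R * R * R => h z.1.1 z.1.2 z.2) (fun z : R * R => (z.1, th, z.2))) => //.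
  by apply: cts_pair; [apply: cts_pair; [exact: cts_fst|exact: cts_cst]|exact: cts_snd].
have co (h : R -> R -> R -> R) : cts3 h -> continuous (fun z : R * R => Int 0 (pi *+ 2) (fun ph => sin z.2 * h z.1 z.2 ph)).
  move=> ch; apply: (@Int_continuous R _ (fun (z : R * R) ph => sin z.2 * h z.1 z.2 ph)) => //.
  by apply: ctsM; [cts|exact: ch].
apply: (@Int_derive R (fun t th => Int 0 (pi *+ 2) (fun ph => sin th * g t th ph))
  (fun t th => Int 0 (pi *+ 2) (fun ph => sin th * dg t th ph))) => //; [|exact: co|exact: co].
move=> s th.
apply: (@Int_derive R (fun t ph => sin th * g t th ph) (fun t ph => sin th * dg t th ph)) => //.
- by move=> u ph; apply: derZ.
- exact: cs.
- exact: cs.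
Qed.

Lemma S2_continuous (U : topologicalType) (g : U -> R -> R -> R) :
  continuous (fun z : U * R * R => g z.1.1 z.1.2 z.2) ->
  continuous (fun u => S2 (g u)).
Proof.
move=> cg; apply: (@Int_continuous R U (fun u th => Int 0 (pi *+ 2) (fun ph => sin th * g u th ph))) => //.
apply: (@Int_continuous R _ (fun (z : U * R) ph => sin z.2 * g z.1 z.2 ph)) => //.
by apply: ctsM; [cts|exact: cg].
Qed.

(* value of f at the point of the sphere of radius r, with polar angle th and
   azimuth ph, around the spatial part of x, at time tau before that of x *)
Definition sph f x tau r th ph : R :=
  at4 f x (- tau) (r * (sin th * cos ph)) (r * (sin th * sin ph)) (r * cos th).

(** The radial derivative d/dr of [sph f], in Cartesian components; [nab2] is the second radial
    derivative. *)
Definition nab f x tau r th ph : R :=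
  sin th * cos ph * sph (pd 1 f) x tau r th ph
  + sin th * sin ph * sph (pd 2 f) x tau r th ph + cos th * sph (pd 3 f) x tau r th ph.

Definition nab2 f x tau r th ph : R :=
  sin th * cos ph * nab (pd 1 f) x tau r th ph
  + sin th * sin ph * nab (pd 2 f) x tau r th ph + cos th * nab (pd 3 f) x tau r th ph.

Definition lap f : pt -> R :=
  fun y => pd 1 (pd 1 f) y + pd 2 (pd 2 f) y + pd 3 (pd 3 f) y.

(* Up to sign, the two integrands differ by the divergence d_th U + d_ph V in the
   angles, with U and V as in the proof. *)
Lemma sphere_laplacian f x tau r : Smooth f ->
  S2 (fun th ph => 2 * nab f x tau r th ph + r * nab2 f x tau r th ph) =
  r * S2 (sph (lap f) x tau r).
Proof.
move=> sf.
(* U is sin th / r times the th-derivative of [sph f], and V is its ph-derivative divided by r sin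
   th, both with the divisions carried out. Thus dU + dV is sin th / r times the spherical
   Laplacian, and nothing is singular at r = 0 or at the poles. *)
pose U th ph := sin th * (cos th * cos ph * sph (pd 1 f) x tau r th ph
   + cos th * sin ph * sph (pd 2 f) x tau r th ph - sin th * sph (pd 3 f) x tau r th ph).
pose V th ph := cos ph * sph (pd 2 f) x tau r th ph - sin ph * sph (pd 1 f) x tau r th ph.
pose e1 i th ph := r * (cos th * cos ph * sph (pd i (pd 1 f)) x tau r th ph
   + cos th * sin ph * sph (pd i (pd 2 f)) x tau r th ph - sin th * sph (pd i (pd 3 f)) x tau r th ph).
pose e2 i th ph := r * sin th * (cos ph * sph (pd i (pd 2 f)) x tau r th ph
   - sin ph * sph (pd i (pd 1 f)) x tau r th ph).
pose dU th ph := cos th * (cos th * cos ph * sph (pd 1 f) x tau r th ph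
   + cos th * sin ph * sph (pd 2 f) x tau r th ph - sin th * sph (pd 3 f) x tau r th ph)
   + sin th * (- sin th * cos ph * sph (pd 1 f) x tau r th ph
   - sin th * sin ph * sph (pd 2 f) x tau r th ph - cos th * sph (pd 3 f) x tau r th ph
   + cos th * cos ph * e1 1 th ph + cos th * sin ph * e1 2 th ph - sin th * e1 3 th ph).
pose dV th ph := - sin ph * sph (pd 2 f) x tau r th ph - cos ph * sph (pd 1 f) x tau r th ph
   + cos ph * e2 2 th ph - sin ph * e2 1 th ph.
have C12 : pd 2 (pd 1 f) = pd 1 (pd 2 f) by exact: pdC.
have C13 : pd 3 (pd 1 f) = pd 1 (pd 3 f) by exact: pdC.
have C23 : pd 3 (pd 2 f) = pd 2 (pd 3 f) by exact: pdC.
have DU th ph : Der (fun th => U th ph) th (dU th ph).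
  rewrite /U /dU /e1 /sph; der; rewrite C12 C13 C23; ring.
have DV th ph : Der (fun ph => V th ph) ph (dV th ph).
  rewrite /V /dV /e2 /sph; der; rewrite C12; ring.
have cU : cts2 U by rewrite /cts2 /U /sph; cts.
have cdU : cts2 dU by rewrite /cts2 /dU /e1 /sph; cts.
have cV : cts2 V by rewrite /cts2 /V /sph; cts.
have cdV : cts2 dV by rewrite /cts2 /dV /e2 /sph; cts.
(* V has period 2 pi in ph, and U vanishes at both poles through its factor sin th; so neither total
   derivative contributes. *)
have IV th : Int 0 (pi *+ 2) (dV th) = 0.
  rewrite (Int_FTC pi20 _ (DV th)); last exact: (@sect1_continuous _ _ _ dV th cdV).
  by rewrite /V /sph !sin2pi !cos2pi !sin0 !cos0 subrr.
have IU : Int 0 pi (fun th => Int 0 (pi *+ 2) (dU th)) = 0.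
  have D (th : R) : Der (fun th => Int 0 (pi *+ 2) (U th)) th (Int 0 (pi *+ 2) (dU th)).
    by apply: Int_derive => //; move=> t s; exact: DU.
  rewrite (Int_FTC pi0 _ D); last exact: Int_continuous.
  by rewrite !Int0 ?subrr// => ph _ _; rewrite /U ?sinpi ?sin0 mul0r.
have slap : Smooth (lap f).
  by apply: smoothD; [apply: smoothD|]; do 2 apply: smooth_pd.
have clap : cts2 (sph (lap f) x tau r).
  by rewrite /cts2 /sph; apply: cts_at4 => //; cts.
rewrite -(S2Z r clap).
have E th ph : sin th * (2 * nab f x tau r th ph + r * nab2 f x tau r th ph) =
    sin th * (r * sph (lap f) x tau r th ph) - dU th ph - dV th ph.
  have -> : sph (lap f) x tau r th ph = sph (pd 1 (pd 1 f)) x tau r th ph +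
    sph (pd 2 (pd 2 f)) x tau r th ph + sph (pd 3 (pd 3 f)) x tau r th ph by [].
  rewrite /dU /dV /nab2 /nab /e1 /e2 C12 C13 C23.
  ring: (cos2sin2 th) (cos2sin2 ph).
have c1 th : continuous (fun ph => sin th * (r * sph (lap f) x tau r th ph)).
  by apply: (@S2_inner_cts (fun th ph => r * sph (lap f) x tau r th ph)); apply: ctsM; [cts|].
have cdUt th : continuous (dU th) by exact: (@sect1_continuous _ _ _ dU th cdU).
have cdVt th : continuous (dV th) by exact: (@sect1_continuous _ _ _ dV th cdV).
rewrite /S2 (eq_Int (g := fun th => Int 0 (pi *+ 2) (fun ph => sin th * (r * sph (lap f) x tau r th ph))
    - Int 0 (pi *+ 2) (dU th))); last first.
  move=> th _ _; apply: etrans (subr0 _); rewrite -[X in _ = _ - X](IV th).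
  rewrite -(IntB _ _ (c1 th) (cdUt th)) -(IntB _ _ (ctsB (c1 th) (cdUt th)) (cdVt th)).
  by apply: eq_Int => ph _ _; rewrite E.
rewrite IntB; first by rewrite IU subr0.
  by apply: (@S2_outer_cts (fun th ph => r * sph (lap f) x tau r th ph)); apply: ctsM; [cts|].
exact: Int_continuous.
Qed.

(* d/dr of r times the spherical mean of radius r at time tau before x, in the null
   coordinates p = tau + r, q = tau - r (r may be negative), up to the factor 4 pi *)
Definition Hq f x p q : R :=
  S2 (fun th ph => sph f x ((p + q) / 2) ((p - q) / 2) th ph
                 + (p - q) / 2 * nab f x ((p + q) / 2) ((p - q) / 2) th ph).

(** Up to 4 pi, r times the spherical mean; its r-derivative at fixed time is [Hq]. It shows up in
    the first null derivatives of [Hq] and is gone again from the mixed one. *)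
Definition hq f x p q : R := (p - q) / 2 * S2 (sph f x ((p + q) / 2) ((p - q) / 2)).

Lemma smooth_lap f : Smooth f -> Smooth (lap f).
Proof. by move=> sf; apply: smoothD; [apply: smoothD|]; do 2 apply: smooth_pd. Qed.

Lemma cts_sph f x p q : Smooth f -> cts2 (sph f x p q).
Proof. by move=> sf; rewrite /cts2 /sph; cts. Qed.

Lemma cts_nab f x p q : Smooth f -> cts2 (nab f x p q).
Proof. by move=> sf; rewrite /cts2 /nab /sph; cts. Qed.

Lemma cts_nab2 f x p q : Smooth f -> cts2 (nab2 f x p q).
Proof. by move=> sf; rewrite /cts2 /nab2 /nab /sph; cts. Qed.

Lemma cts_Hint f x p q (r : R) : Smooth f ->
  cts2 (fun th ph => sph f x p q th ph + r * nab f x p q th ph).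
Proof.
move=> sf; apply: ctsD; first exact: cts_sph.
by apply: ctsM; [cts|exact: cts_nab].
Qed.

Lemma Hq_cts f x : Smooth f -> cts2 (Hq f x).
Proof.
move=> sf; apply: (@S2_continuous _ (fun (u : R * R) th ph =>
   sph f x ((u.1 + u.2) / 2) ((u.1 - u.2) / 2) th ph
   + (u.1 - u.2) / 2 * nab f x ((u.1 + u.2) / 2) ((u.1 - u.2) / 2) th ph)).
by rewrite /nab /sph; cts.
Qed.

Lemma hq_cts f x : Smooth f -> cts2 (hq f x).
Proof.
move=> sf; apply: ctsM; first by cts.
apply: (@S2_continuous _ (fun (u : R * R) => sph f x ((u.1 + u.2) / 2) ((u.1 - u.2) / 2))).
by rewrite /sph; cts.
Qed.

Lemma HqL f g x p q (a b : R) : Smooth f -> Smooth g ->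
  Hq (fun y => a * f y + b * g y) x p q = a * Hq f x p q + b * Hq g x p q.
Proof.
move=> sf sg; rewrite /Hq -!S2Z -?S2D; try exact: cts_Hint.
- by apply: eq_S2 => th ph; rewrite /nab !pdL//= /sph /at4; ring.
- by apply: ctsM; [cts|exact: cts_Hint].
- by apply: ctsM; [cts|exact: cts_Hint].
Qed.

Lemma Hq0 f x : Hq f x 0 0 = 4 * pi * f x.
Proof.
rewrite /Hq -S2_cst; apply: eq_S2 => th ph.
rewrite addr0 subr0 !mul0r addr0 /sph /at4 !mul0r oppr0.
congr f; apply/rowP => i; rewrite !mxE.
by case: i => [[|[|[|[|//]]]] ?]; rewrite /= addr0.
Qed.

(** Both null derivatives of [Hq] at once: s = 1 for d_p and s = -1 for d_q, being half of d_tau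
    plus or minus d_r. The second radial derivative of r times [sph] is converted by
    [sphere_laplacian]. *)
Lemma S2_dH f x p q (s : R) : Smooth f ->
  S2 (fun th ph => 2^-1 * (- (sph (pd 0 f) x ((p + q) / 2) ((p - q) / 2) th ph
         + (p - q) / 2 * nab (pd 0 f) x ((p + q) / 2) ((p - q) / 2) th ph)
     + s * (2 * nab f x ((p + q) / 2) ((p - q) / 2) th ph
        + (p - q) / 2 * nab2 f x ((p + q) / 2) ((p - q) / 2) th ph))) =
  2^-1 * (- Hq (pd 0 f) x p q + s * hq (lap f) x p q).
Proof.
move=> sf.
have s0 := smooth_pd 0 sf.
have c1 : cts2 (fun th ph => sph (pd 0 f) x ((p + q) / 2) ((p - q) / 2) th ph
         + (p - q) / 2 * nab (pd 0 f) x ((p + q) / 2) ((p - q) / 2) th ph) by exact: cts_Hint.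
have c2 : cts2 (fun th ph => 2 * nab f x ((p + q) / 2) ((p - q) / 2) th ph
        + (p - q) / 2 * nab2 f x ((p + q) / 2) ((p - q) / 2) th ph).
  apply: ctsD; apply: ctsM; try cts; [exact: cts_nab|exact: cts_nab2].
have c1' : cts2 (fun th ph => -1 * (sph (pd 0 f) x ((p + q) / 2) ((p - q) / 2) th ph
         + (p - q) / 2 * nab (pd 0 f) x ((p + q) / 2) ((p - q) / 2) th ph)).
  by apply: ctsM; [cts|exact: c1].
have c2' : cts2 (fun th ph => s * (2 * nab f x ((p + q) / 2) ((p - q) / 2) th ph
        + (p - q) / 2 * nab2 f x ((p + q) / 2) ((p - q) / 2) th ph)).
  by apply: ctsM; [cts|exact: c2].
rewrite /hq -(sphere_laplacian _ _ _ sf) -(S2Z s c2) -[- Hq _ _ _ _]mulN1r /Hq -(S2Z (-1) c1).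
rewrite -(S2D c1' c2') -(S2Z _ (ctsD c1' c2')).
by apply: eq_S2 => th ph; rewrite mulN1r.
Qed.

Lemma Hq_derp f x p q : Smooth f ->
  Der (fun p => Hq f x p q) p (2^-1 * (- Hq (pd 0 f) x p q + hq (lap f) x p q)).
Proof.
move=> sf; rewrite -[hq _ _ _ _]mul1r -S2_dH//.
pose dg p th ph := 2^-1 * (- (sph (pd 0 f) x ((p + q) / 2) ((p - q) / 2) th ph
         + (p - q) / 2 * nab (pd 0 f) x ((p + q) / 2) ((p - q) / 2) th ph)
     + 1 * (2 * nab f x ((p + q) / 2) ((p - q) / 2) th ph
        + (p - q) / 2 * nab2 f x ((p + q) / 2) ((p - q) / 2) th ph)).
apply: (@S2_derive (fun p th ph => sph f x ((p + q) / 2) ((p - q) / 2) th ph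
                 + (p - q) / 2 * nab f x ((p + q) / 2) ((p - q) / 2) th ph) dg).
- move=> t th ph; rewrite /dg /nab2 /nab /sph; der.
  rewrite [pd 0 (pd 1 f)]pdC// [pd 0 (pd 2 f)]pdC// [pd 0 (pd 3 f)]pdC//.
  by field.
- by rewrite /cts3 /nab /sph; cts.
- by rewrite /cts3 /dg /nab2 /nab /sph; cts.
Qed.

Lemma Hq_derq f x p q : Smooth f ->
  Der (fun q => Hq f x p q) q (2^-1 * (- Hq (pd 0 f) x p q - hq (lap f) x p q)).
Proof.
move=> sf; rewrite -[hq _ _ _ _]mul1r -mulNr -S2_dH//.
pose dg q th ph := 2^-1 * (- (sph (pd 0 f) x ((p + q) / 2) ((p - q) / 2) th ph
         + (p - q) / 2 * nab (pd 0 f) x ((p + q) / 2) ((p - q) / 2) th ph)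
     + - 1 * (2 * nab f x ((p + q) / 2) ((p - q) / 2) th ph
        + (p - q) / 2 * nab2 f x ((p + q) / 2) ((p - q) / 2) th ph)).
apply: (@S2_derive (fun q th ph => sph f x ((p + q) / 2) ((p - q) / 2) th ph
                 + (p - q) / 2 * nab f x ((p + q) / 2) ((p - q) / 2) th ph) dg).
- move=> t th ph; rewrite /dg /nab2 /nab /sph; der.
  rewrite [pd 0 (pd 1 f)]pdC// [pd 0 (pd 2 f)]pdC// [pd 0 (pd 3 f)]pdC//.
  by field.
- by rewrite /cts3 /nab /sph; cts.
- by rewrite /cts3 /dg /nab2 /nab /sph; cts.
Qed.

Lemma hq_derq f x p q : Smooth f ->
  Der (fun q => hq f x p q) q (2^-1 * (- Hq f x p q - hq (pd 0 f) x p q)).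
Proof.
move=> sf.
have s0 := smooth_pd 0 sf.
have D : Der (fun q => S2 (sph f x ((p + q) / 2) ((p - q) / 2))) q
   (S2 (fun th ph => (- 2^-1) * (sph (pd 0 f) x ((p + q) / 2) ((p - q) / 2) th ph + nab f x ((p + q) / 2) ((p - q) / 2) th ph))).
  apply: (@S2_derive (fun q => sph f x ((p + q) / 2) ((p - q) / 2))
     (fun q th ph => (- 2^-1) * (sph (pd 0 f) x ((p + q) / 2) ((p - q) / 2) th ph + nab f x ((p + q) / 2) ((p - q) / 2) th ph))).
  - by move=> t th ph; rewrite /nab /sph; der; field.
  - by rewrite /cts3 /sph; cts.
  - by rewrite /cts3 /nab /sph; cts.
have D2 : Der (fun q => (p - q) / 2) q (- 2^-1) by der; field.
apply: der_eq (derM D2 D) _.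
have c0 := @cts_sph f x ((p + q) / 2) ((p - q) / 2) sf.
have c1 := @cts_sph _ x ((p + q) / 2) ((p - q) / 2) s0.
have c2 := @cts_nab f x ((p + q) / 2) ((p - q) / 2) sf.
have c2' : cts2 (fun th ph => (p - q) / 2 * nab f x ((p + q) / 2) ((p - q) / 2) th ph).
  by apply: ctsM; [cts|exact: c2].
rewrite (S2Z _ (ctsD c1 c2)) (S2D c1 c2) /Hq /hq (S2D c0 c2') (S2Z _ c2).
by move: (S2 _) (S2 _) (S2 _) => A B C; field.
Qed.

(** Kirchhoff's reduction: r times the spherical mean, hence also its r-derivative [Hq], obeys the
    wave equation in one space dimension, and d_p d_q is a quarter of d_tau^2 - d_r^2. *)
Lemma Hq_pq f x p q : Smooth f ->
  Der (fun q => 2^-1 * (- Hq (pd 0 f) x p q + hq (lap f) x p q)) q (- 4^-1 * Hq (dal f) x p q).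
Proof.
move=> sf.
have s0 := smooth_pd 0 sf; have sl := smooth_lap sf; have s00 := smooth_pd 0 s0.
have D1 := Hq_derq x p q s0; have D2 := hq_derq x p q sl.
have lapC : pd 0 (lap f) = lap (pd 0 f).
  rewrite /lap !pdD; try (by do 2 apply: smooth_pd); last first.
    by apply: smoothD; do 2 apply: smooth_pd.
  have C j : pd 0 (pd j (pd j f)) = pd j (pd j (pd 0 f)).
    by rewrite pdC ?[pd 0 (pd j f)]pdC//; exact: smooth_pd.
  by rewrite !C.
have dalE2 : dal f = (fun y => (-1) * pd 0 (pd 0 f) y + 1 * lap f y).
  by apply/funext => y; rewrite /dal /lap mulN1r mul1r !addrA.
apply: der_eq (derZ 2^-1 (derD (derN D1) D2)) _.
rewrite lapC dalE2 (HqL x p q _ _ s00 sl).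
by move: (Hq (pd 0 (pd 0 f)) x p q) (Hq (lap f) x p q) (hq (lap (pd 0 f)) x p q) => A B C; field.
Qed.

End SphericalMeans.

Lemma cts_addr (R : realType) (V : normedModType R) (v : V) : continuous (fun y : V => y + v).
Proof. by move=> y; apply: cvgD; [exact: cvg_id|exact: cvg_cst]. Qed.

Section Shift.
Context {R : realType}.
Local Notation pt := (pt R).
Implicit Types (f : pt -> R) (x v : pt).

Lemma derive_shift_pt f v i y :
  is_derive (y + v) (evec R i) f (pd i f (y + v)) ->
  is_derive y (evec R i) (fun z => f (z + v)) (pd i f (y + v)).
Proof.
move=> H; apply: is_derive_eps => e e0.
have [d d0 Hd] := is_derive_epsP H e0.
exists d => // h hd; rewrite [y + _ + v]addrAC; exact: Hd.
Qed.

Lemma smooth_shift f v : Smooth f ->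
  Smooth (fun y => f (y + v)) /\ forall i, pd i (fun y => f (y + v)) = (fun y => pd i f (y + v)).
Proof.
have key g : Smooth g -> forall i y, is_derive y (evec R i) (fun z => g (z + v)) (pd i g (y + v)).
  by move=> sg i y; apply: derive_shift_pt; exact: smooth_is_derive.
have E g : Smooth g -> forall i, pd i (fun y => g (y + v)) = (fun y => pd i g (y + v)).
  by move=> sg i; apply/funext => y; rewrite pd_derive; case: (key g sg i y).
move=> sf; split; last exact: E.
apply: (@smooth_class _ (fun h => exists2 g, Smooth g & h = fun y => g (y + v))); last by exists f.
move=> _ [g sg ->]; split.
  apply: cts_comp; first exact: smooth_continuous.
  exact: cts_addr.
move=> i; split; first by move=> y; case: (key g sg i y).
by rewrite E//; exists (pd i g) => //; exact: smooth_pd.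
Qed.

End Shift.

Section ConeOperator.
Context {R : realType}.
Local Notation pt := (pt R).
Implicit Types (f g : pt -> R) (x : pt) (k l : R -> R) (p q P : R).

(* Convolution with d_r (k(tau^2 - r^2) 1_(r < tau)) / (4 pi r), truncated to p, q <= P;
   the r-derivative is moved onto f, so that no distribution appears.  Both signs of r
   are integrated over, whence 16 pi. *)
Definition TP k P f x : R :=
  - (16 * pi)^-1 * Int 0 P (fun p => Int 0 P (fun q => k (p * q) * Hq f x p q)).

Lemma TP_cts2 k f x : continuous k -> Smooth f ->
  cts2 (fun p q => k (p * q) * Hq f x p q).
Proof.
move=> ck sf; apply: ctsM; last exact: Hq_cts.
by apply: cts_comp => //; cts.
Qed.

Lemma cts2_sect (g : R -> R -> R) p : cts2 g -> continuous (g p).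
Proof. exact: (@sect1_continuous _ _ _ g p). Qed.

Lemma cts2_Int (g : R -> R -> R) P : 0 <= P -> cts2 g ->
  continuous (fun p => Int 0 P (g p)).
Proof. by move=> P0 cg; apply: Int_continuous. Qed.

Lemma Int2L (g h : R -> R -> R) (a b : R) P : 0 <= P -> cts2 g -> cts2 h ->
  Int 0 P (fun p => Int 0 P (fun q => a * g p q + b * h p q)) =
  a * Int 0 P (fun p => Int 0 P (g p)) + b * Int 0 P (fun p => Int 0 P (h p)).
Proof.
move=> P0 cg ch.
have cgs p : continuous (g p) by exact: cts2_sect.
have chs p : continuous (h p) by exact: cts2_sect.
have cG := cts2_Int P0 cg; have cH := cts2_Int P0 ch.
have caG : continuous (fun p => a * Int 0 P (g p)) by apply: ctsM; [cts|].
have cbH : continuous (fun p => b * Int 0 P (h p)) by apply: ctsM; [cts|].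
rewrite -(IntZ _ _ _ cG) -(IntZ _ _ _ cH) -(IntD _ _ caG cbH).
apply: eq_Int => p _ _.
have c1 : continuous (fun q => a * g p q) by apply: ctsM; [cts|].
have c2 : continuous (fun q => b * h p q) by apply: ctsM; [cts|].
by rewrite (IntD _ _ c1 c2) (IntZ _ _ _ (cgs p)) (IntZ _ _ _ (chs p)).
Qed.

Lemma TPL k P f g x (a b : R) : continuous k -> 0 <= P -> Smooth f -> Smooth g ->
  TP k P (fun y => a * f y + b * g y) x = a * TP k P f x + b * TP k P g x.
Proof.
move=> ck P0 sf sg; rewrite /TP.
have E : Int 0 P (fun p => Int 0 P (fun q => k (p * q) * Hq (fun y => a * f y + b * g y) x p q)) =
  Int 0 P (fun p => Int 0 P (fun q => a * (k (p * q) * Hq f x p q) + b * (k (p * q) * Hq g x p q))).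
  apply: eq_Int => p _ _; apply: eq_Int => q _ _; rewrite (HqL x p q a b sf sg).
  by move: (Hq f x p q) (Hq g x p q) => A B; ring.
have E2 := @Int2L (fun p q => k (p * q) * Hq f x p q) (fun p q => k (p * q) * Hq g x p q)
  a b P P0 (@TP_cts2 k f x ck sf) (@TP_cts2 k g x ck sg).
have dist (c A B : R) : c * (a * A + b * B) = a * (c * A) + b * (c * B) by ring.
exact: etrans (congr1 (fun z => - (16 * pi)^-1 * z) (etrans E E2)) (dist _ _ _).
Qed.

Lemma TPkL k l P f x (a b : R) : continuous k -> continuous l -> 0 <= P -> Smooth f ->
  TP (fun s => a * k s + b * l s) P f x = a * TP k P f x + b * TP l P f x.
Proof.
move=> ck cl P0 sf; rewrite /TP.
have E : Int 0 P (fun p => Int 0 P (fun q => (a * k (p * q) + b * l (p * q)) * Hq f x p q)) =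
  Int 0 P (fun p => Int 0 P (fun q => a * (k (p * q) * Hq f x p q) + b * (l (p * q) * Hq f x p q))).
  apply: eq_Int => p _ _; apply: eq_Int => q _ _.
  by move: (Hq f x p q) => A; ring.
have E2 := @Int2L (fun p q => k (p * q) * Hq f x p q) (fun p q => l (p * q) * Hq f x p q)
  a b P P0 (@TP_cts2 k f x ck sf) (@TP_cts2 l f x cl sf).
have dist (c A B : R) : c * (a * A + b * B) = a * (c * A) + b * (c * B) by ring.
exact: etrans (congr1 (fun z => - (16 * pi)^-1 * z) (etrans E E2)) (dist _ _ _).
Qed.

(* Two integrations by parts, in q and then in p, since
   d_p d_q Hq f = - Hq (dal f) / 4 and Hq f x 0 0 = 4 pi f(x). *)
Lemma TP_dal l l1 l2 P f x : 0 <= P -> Smooth f ->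
  (forall s : R, Der l s (l1 s)) -> (forall s : R, Der l1 s (l2 s)) -> continuous l2 ->
  (forall p q, 0 <= p -> 0 <= q -> P <= p + q ->
     Hq f x p q = 0 /\ - Hq (pd 0 f) x p q + hq (lap f) x p q = 0) ->
  TP l P (dal f) x = l 0 * f x + TP (fun s => -4 * (l1 s + s * l2 s)) P f x.
Proof.
move=> P0 sf dl dl1 cl2 van.
have cl : continuous l by exact: der_cts dl.
have cl1 : continuous l1 by exact: der_cts dl1.
have s0 := smooth_pd 0 sf; have sl := smooth_lap sf; have sd := smooth_dal sf.
pose H p q := Hq f x p q.
pose dH p q := 2^-1 * (- Hq (pd 0 f) x p q + hq (lap f) x p q).
have cH : cts2 H by exact: Hq_cts.
have cdH : cts2 dH.
  by apply: ctsM; [cts|]; apply: ctsD; [apply: ctsN; exact: Hq_cts|exact: hq_cts].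
have cpq (k : R -> R) : continuous k -> cts2 (fun p q => k (p * q)).
  by move=> ck; apply: cts_comp => //; cts.
have DH p q : Der (fun p => H p q) p (dH p q) by exact: Hq_derp.
pose A p q := l (p * q) * Hq (dal f) x p q.
pose B p q := p * l1 (p * q) * dH p q.
pose C p q := (l1 (p * q) + p * q * l2 (p * q)) * H p q.
have cA : cts2 A by exact: TP_cts2.
have cl1p : cts2 (fun p q => p * l1 (p * q)) by apply: ctsM; [cts|exact: (cpq l1 cl1)].
have cB : cts2 B by exact: ctsM cl1p cdH.
have cC : cts2 C.
  apply: ctsM; last exact: cH.
  by apply: ctsD; [exact: (cpq l1 cl1)|apply: ctsM; [cts|exact: (cpq l2 cl2)]].
have dpq (k dk : R -> R) p q : (forall s, Der k s (dk s)) -> Der (fun q => k (p * q)) q (p * dk (p * q)).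
  move=> dk'; have D : Der (fun q => p * q) q p by der; ring.
  by rewrite mulrC; exact: (@is_derive1_comp _ k (fun q => p * q) q _ _ (dk' (p * q)) D).
have In p : 0 <= p -> Int 0 P (A p) = 4 * (l 0 * dH p 0 + Int 0 P (B p)).
  move=> p0.
  have D q : Der (fun q => l (p * q) * dH p q) q (B p q - 4^-1 * A p q).
    apply: der_eq (derM (dpq l l1 p q dl) (Hq_pq x p q sf)) _.
    rewrite /B /A /dH.
    by move: (Hq (dal f) x p q) (Hq (pd 0 f) x p q) (hq (lap f) x p q) => a b c; field.
  have cAp : continuous (A p) by exact: cts2_sect.
  have cBp : continuous (B p) by exact: cts2_sect.
  have cA4 : continuous (fun q => 4^-1 * A p q) by apply: ctsM; [cts|].
  have := Int_FTC P0 (ctsB cBp cA4) D.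
  rewrite (IntB _ _ cBp cA4) (IntZ _ _ _ cAp) mulr0.
  have -> : dH p P = 0 by rewrite /dH (van p P p0 P0 _).2 ?mulr0// lerDr.
  by rewrite mulr0; move: (Int _ _ _) (Int _ _ _) => a b E; lra.
have cdH0 : continuous (fun p => dH p 0).
  apply: (@cts_comp _ _ _ (fun z : R * R => dH z.1 z.2) (fun p => (p, 0))); first exact: cdH.
  by apply: cts_pair; [exact: cts_id|exact: cts_cst].
(* The boundary term of the integration in q lives on the light cone q = 0 and is itself a
   derivative along it; what remains is the value at the vertex, the origin of the term l 0 * f
   x. *)
have Out1 : Int 0 P (fun p => dH p 0) = - (4 * pi * f x).
  have D0 (p : R) : is_derive p 1 (fun p => H p 0) (dH p 0) by exact: DH.
  rewrite (Int_FTC P0 cdH0 D0).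
  by rewrite /H (van P 0 P0 (lexx _) _).1 ?addr0// Hq0 sub0r.
have Out2 : Int 0 P (fun p => Int 0 P (B p)) = - Int 0 P (fun p => Int 0 P (C p)).
  have D p : Der (fun p => Int 0 P (fun q => p * l1 (p * q) * H p q)) p
      (Int 0 P (fun q => C p q + B p q)).
    apply: (@Int_derive R (fun p q => p * l1 (p * q) * H p q) (fun p q => C p q + B p q) 0 P p P0).
    - move=> t q; have D1 : Der (fun p => l1 (p * q)) t (q * l2 (t * q)).
        have := dpq l1 l2 q t dl1; rewrite [q * t]mulrC.
        by apply: der_ext => p'; rewrite [q * p']mulrC.
      apply: der_eq (derM (derM (der_id t) D1) (DH t q)) _.
      by rewrite /C /B; move: (H t q) (dH t q) (l1 _) (l2 _) => a b c d; ring.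
    - exact: ctsM cl1p cH.
    - exact: ctsD cC cB.
  have cCB : cts2 (fun p q => C p q + B p q) by exact: ctsD cC cB.
  have Z1 : Int 0 P (fun q => P * l1 (P * q) * H P q) = 0.
    apply: Int0 => q q0 _; have [|HP _] := van P q P0 q0; first by rewrite lerDl.
    by rewrite /H HP mulr0.
  (* The factor p, produced by differentiating l (p q) in q, removes the boundary term at p = 0. *)
  have Z0 : Int 0 P (fun q => 0 * l1 (0 * q) * H 0 q) = 0.
    by apply: Int0 => q _ _; rewrite !mul0r.
  have := Int_FTC P0 (cts2_Int P0 cCB) D.
  rewrite Z1 Z0 subrr.
  have cIC := cts2_Int P0 cC; have cIB := cts2_Int P0 cB.
  have -> : Int 0 P (fun p => Int 0 P (fun q => C p q + B p q)) =
      Int 0 P (fun p => Int 0 P (C p) + Int 0 P (B p)).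
    apply: eq_Int => p _ _.
    exact: (IntD _ _ (cts2_sect (p := p) cC) (cts2_sect (p := p) cB)).
  rewrite (IntD _ _ cIC cIB).
  by move: (Int 0 P (fun p => Int 0 P (C p))) (Int 0 P (fun p => Int 0 P (B p))) => a b E; lra.
have cIB := cts2_Int P0 cB.
have cl0 : continuous (fun p => l 0 * dH p 0) by apply: ctsM; [cts|].
have E1 : Int 0 P (fun p => Int 0 P (A p)) =
    Int 0 P (fun p => 4 * (l 0 * dH p 0 + Int 0 P (B p))).
  by apply: eq_Int => p p0 _; exact: In.
have E2 : Int 0 P (fun p => Int 0 P (fun q => -4 * (l1 (p * q) + p * q * l2 (p * q)) * H p q)) =
    Int 0 P (fun p => -4 * Int 0 P (C p)).
  apply: eq_Int => p _ _; rewrite -(IntZ _ _ _ (cts2_sect (p := p) cC)).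
  by apply: eq_Int => q _ _; rewrite /C; move: (H p q) => h; ring.
rewrite /TP -/A E1 -/H E2.
rewrite (IntZ _ _ _ (ctsD cl0 cIB)) (IntD _ _ cl0 cIB) (IntZ _ _ _ cdH0) Out1 Out2.
rewrite (IntZ _ _ _ (cts2_Int P0 cC)).
have pn0 : pi != 0 :> R by apply: lt0r_neq0; exact: pi_gt0.
move: (Int 0 P (fun p => Int 0 P (C p))) => a.
by move: (pi : R) pn0 => c c0; field.
Qed.

Lemma norm_vec4 (a b c d r : R) : 0 <= r -> `|a| <= r -> `|b| <= r -> `|c| <= r -> `|d| <= r ->
  `|vec4 a b c d| <= r.
Proof.
move=> r0 ha hb hc hd; apply: rv_norm_le => // i; rewrite mxE.
by case: i => [[|[|[|[|//]]]] ?].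
Qed.

Lemma norm_sphere_point x tau r th ph P : `|tau| <= P -> `|r| <= P ->
  `|x + vec4 (- tau) (r * (sin th * cos ph)) (r * (sin th * sin ph)) (r * cos th)| <= `|x| + P.
Proof.
move=> hp hr; apply: le_trans (ler_normD _ _) _; rewrite lerD2l.
have s1 (t : R) : `|sin t| <= 1 by rewrite ler_norml sin_geN1 sin_le1.
have c1 (t : R) : `|cos t| <= 1 by rewrite ler_norml cos_geN1 cos_le1.
have P0 : 0 <= P by exact: le_trans hp.
apply: norm_vec4 => //; first by rewrite normrN.
- rewrite normrM -[P]mulr1 ler_pM// normrM -[1]mulr1 ler_pM//.
- rewrite normrM -[P]mulr1 ler_pM// normrM -[1]mulr1 ler_pM//.
- by rewrite normrM -[P]mulr1 ler_pM.
Qed.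

Lemma Hq_bound f x p q P (C : R) : Smooth f -> 0 <= C -> 0 <= p -> p <= P -> 0 <= q -> q <= P ->
  (forall y, `|y| <= `|x| + P -> `|f y| <= C) ->
  (forall i y, `|y| <= `|x| + P -> `|pd i f y| <= C) ->
  `|Hq f x p q| <= (1 + 3 * P) * C * (pi *+ 2) * pi.
Proof.
move=> sf C0 p0 pP q0 qP fC dfC.
have P0 : 0 <= P by exact: le_trans pP.
have tP : `|(p + q) / 2| <= P by rewrite ger0_norm; lra.
have rP : `|(p - q) / 2| <= P by rewrite ler_norml; apply/andP; split; lra.
have s1 (t : R) : `|sin t| <= 1 by rewrite ler_norml sin_geN1 sin_le1.
have c1 (t : R) : `|cos t| <= 1 by rewrite ler_norml cos_geN1 cos_le1.
apply: S2_bound; first by rewrite mulr_ge0// addr_ge0// mulr_ge0.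
  exact: cts_Hint.
move=> th ph; have -> : (1 + 3 * P) * C = C + P * (3 * C) by ring.
apply: le_trans (ler_normD _ _) _; apply: lerD.
  by apply: fC; exact: norm_sphere_point.
rewrite normrM; apply: ler_pM => //.
rewrite /nab (_ : 3 * C = 1 * 1 * C + 1 * 1 * C + 1 * C); last by ring.
have pC i : `|sph (pd i f) x ((p + q) / 2) ((p - q) / 2) th ph| <= C.
  by apply: dfC; exact: norm_sphere_point.
apply: le_trans (ler_normD _ _) _; apply: lerD; last by rewrite normrM ler_pM.
by apply: le_trans (ler_normD _ _) _; apply: lerD; rewrite normrM ler_pM// normrM ler_pM.
Qed.

(** 1 + 3 P bounds value plus radius times three gradient components, 2 pi * pi bounds the area of
    the angular domain, and P * P is the area of the square of null coordinates. *)
Definition cstP P : R := (16 * pi)^-1 * ((1 + 3 * P) * (pi *+ 2) * pi * P * P).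

Lemma cstP_ge0 P : 0 <= P -> 0 <= cstP P.
Proof.
move=> P0; have := pi_ge0 R => pi0.
have i0 : 0 <= (16 * pi : R)^-1 by rewrite invr_ge0 mulr_ge0.
have p2 : 0 <= pi *+ 2 :> R by rewrite mulrn_wge0.
have P3 : 0 <= 1 + 3 * P by rewrite addr_ge0// mulr_ge0.
exact: mulr_ge0 i0 (mulr_ge0 (mulr_ge0 (mulr_ge0 (mulr_ge0 P3 p2) pi0) P0) P0).
Qed.

Lemma TP_bound k f x P (C K : R) : continuous k -> Smooth f -> 0 <= C -> 0 <= P ->
  (forall s, 0 <= s -> s <= P ^+ 2 -> `|k s| <= K) ->
  (forall y, `|y| <= `|x| + P -> `|f y| <= C) ->
  (forall i y, `|y| <= `|x| + P -> `|pd i f y| <= C) ->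
  `|TP k P f x| <= cstP P * K * C.
Proof.
move=> ck sf C0 P0 kK fC dfC.
have K0 : 0 <= K by apply: le_trans (kK 0 (lexx _) _); rewrite ?sqr_ge0.
have i0 : 0 <= (16 * pi : R)^-1 by rewrite invr_ge0 mulr_ge0// pi_ge0.
rewrite /TP normrM normrN (ger0_norm i0) /cstP -(mulrA _ K C) -(mulrA _ _ (K * C)).
rewrite ler_wpM2l//.
have c2 := @TP_cts2 k f x ck sf.
apply: le_trans (@Int_bound R 0 P (fun p => Int 0 P (fun q => k (p * q) * Hq f x p q))
  (K * ((1 + 3 * P) * C * (pi *+ 2) * pi) * P) P0 (cts2_Int P0 c2) _) _; last first.
  by rewrite subr0 le_eqVlt; apply/orP; left; apply/eqP; ring.
move=> p p0 pP.
have := @Int_bound R 0 P (fun q => k (p * q) * Hq f x p q)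
  (K * ((1 + 3 * P) * C * (pi *+ 2) * pi)) P0 (cts2_sect (p := p) c2).
rewrite subr0; apply=> q q0 qP.
rewrite normrM ler_pM//; first by apply: kK; [exact: mulr_ge0|rewrite expr2 ler_pM].
exact: Hq_bound qP fC dfC.
Qed.

Lemma TP_shift k P f x v : Smooth f -> TP k P (fun y => f (y + v)) x = TP k P f (x + v).
Proof.
move=> sf; have [_ dE] := smooth_shift v sf.
rewrite /TP; congr (_ * _); apply: eq_Int => p _ _; apply: eq_Int => q _ _.
congr (_ * _); apply: eq_S2 => th ph.
by rewrite /nab !dE /sph /at4 [x + v + _]addrAC.
Qed.

(** [TP] is linear and commutes with translations, so the Taylor remainder of the output is [TP] of
    the Taylor remainder of f, to which [TP_bound] applies. That bound involves first partials, so
    the remainders of all [pd j f] are estimated as well. *)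
Lemma TP_taylor f i (rad P : R) : Smooth f -> 0 <= P ->
  exists2 C : R, 0 <= C & forall k (K : R), continuous k ->
    (forall s, 0 <= s -> s <= P ^+ 2 -> `|k s| <= K) ->
    forall x h, `|x| <= rad -> `|h| <= 1 ->
    `|TP k P f (x + h *: evec R i) - TP k P f x - h * TP k P (pd i f) x| <= C * K * h ^+ 2.
Proof.
move=> sf P0.
have [C0 C00 HC0] := ball_taylor i (rad + P) sf.
have /choice[C1 HC1] : forall j, exists C : R, 0 <= C /\ forall y h, `|y| <= rad + P -> `|h| <= 1 ->
    `|pd j f (y + h *: evec R i) - pd j f y - h * pd i (pd j f) y| <= C * h ^+ 2.
  by move=> j; have [C ? ?] := ball_taylor i (rad + P) (smooth_pd j sf); exists C.
pose C := C0 + \sum_j C1 j.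
have S0 : 0 <= \sum_j C1 j by apply: sumr_ge0 => j _; case: (HC1 j).
have C_ge0 : 0 <= C by rewrite addr_ge0.
exists (cstP P * C) => [|k K ck kK x h xr h1]; first by rewrite mulr_ge0// cstP_ge0.
pose fs := fun y => f (y + h *: evec R i).
have [sfs dfs] : Smooth fs /\ forall j, pd j fs = (fun y => pd j f (y + h *: evec R i)).
  exact: smooth_shift.
have s1 := smoothL 1 (-1) sfs sf.
have si := smooth_pd i sf.
pose g := fun y => 1 * (1 * fs y + -1 * f y) + - h * pd i f y.
have sg : Smooth g by exact: smoothL.
have -> : TP k P f (x + h *: evec R i) - TP k P f x - h * TP k P (pd i f) x = TP k P g x.
  rewrite /g (TPL x _ _ ck P0 s1 si) (TPL x _ _ ck P0 sfs sf) (TP_shift k P x _ sf).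
  by move: (TP k P f _) (TP k P f x) (TP k P (pd i f) x) => A B D; ring.
have -> : cstP P * C * K * h ^+ 2 = cstP P * K * (C * h ^+ 2) by ring.
have xP y : `|y| <= `|x| + P -> `|y| <= rad + P.
  by move=> yx; apply: le_trans yx _; rewrite lerD2r.
apply: TP_bound => //; first by rewrite mulr_ge0// sqr_ge0.
  move=> y /xP yr.
  have -> : g y = f (y + h *: evec R i) - f y - h * pd i f y.
    by rewrite /g /fs; move: (f _) (f y) (pd i f y) => A B D; ring.
  by apply: le_trans (HC0 y h yr h1) _; rewrite ler_wpM2r ?sqr_ge0// lerDl.
move=> j y /xP yr.
have -> : pd j g y = pd j f (y + h *: evec R i) - pd j f y - h * pd i (pd j f) y.
  rewrite /g (pdL _ _ _ s1 si) (pdL _ _ _ sfs sf) dfs (pdC i j sf).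
  by move: (pd j f _) (pd j f y) (pd j (pd i f) y) => A B D; ring.
apply: le_trans ((HC1 j).2 y h yr h1) _; rewrite ler_wpM2r ?sqr_ge0//.
rewrite /C (bigD1 j)//= addrCA lerDl addr_ge0// sumr_ge0// => l _.
by case: (HC1 l).
Qed.

End ConeOperator.

(** * Causal structure and past-compact supports *)

Lemma closed_le_cts (R : realType) (U : topologicalType) (f g : U -> R) :
  continuous f -> continuous g -> closed [set u | f u <= g u].
Proof.
move=> cf cg.
have -> : [set u | f u <= g u] = (fun u => f u - g u) @^-1` [set y | y <= 0].
  by apply/seteqP; split=> u /=; rewrite subr_le0.
apply: closed_comp; last exact: closed_le.
by move=> u _; exact: ctsB.
Qed.

Lemma cts_sqr (R : realType) (U : topologicalType) (f : U -> R) :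
  continuous f -> continuous (fun u => f u ^+ 2).
Proof. by move=> cf; exact: (ctsM cf cf). Qed.

Section Causal.
Context {R : realType}.
Local Notation pt := (pt R).
Implicit Types (x y p : pt) (A K : set pt).

Lemma coord_cts (i : 'I_4) : continuous (fun x : pt => x ord0 i).
Proof. exact: coord_continuous. Qed.

Lemma Jminus_refl x : Jminus x x.
Proof. by rewrite /Jminus /= !subrr expr2 mul0r !addr0 lexx. Qed.

(* transitivity of the causal order *)
Lemma lorentz_triangle (a1 a2 a3 b1 b2 b3 s t : R) : 0 <= s -> 0 <= t ->
  a1 ^+ 2 + a2 ^+ 2 + a3 ^+ 2 <= s ^+ 2 -> b1 ^+ 2 + b2 ^+ 2 + b3 ^+ 2 <= t ^+ 2 ->
  (a1 + b1) ^+ 2 + (a2 + b2) ^+ 2 + (a3 + b3) ^+ 2 <= (s + t) ^+ 2.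
Proof.
move=> s0 t0 ha hb.
have cs : (a1 * b1 + a2 * b2 + a3 * b3) ^+ 2 <=
    (a1 ^+ 2 + a2 ^+ 2 + a3 ^+ 2) * (b1 ^+ 2 + b2 ^+ 2 + b3 ^+ 2).
  rewrite -subr_ge0.
  have -> : (a1 ^+ 2 + a2 ^+ 2 + a3 ^+ 2) * (b1 ^+ 2 + b2 ^+ 2 + b3 ^+ 2) -
    (a1 * b1 + a2 * b2 + a3 * b3) ^+ 2 =
    (a1 * b2 - a2 * b1) ^+ 2 + (a1 * b3 - a3 * b1) ^+ 2 + (a2 * b3 - a3 * b2) ^+ 2 by ring.
  by rewrite !addr_ge0 ?sqr_ge0.
have h : a1 * b1 + a2 * b2 + a3 * b3 <= s * t.
  have st0 : 0 <= s * t by exact: mulr_ge0.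
  apply: le_trans (ler_norm _) _.
  rewrite -(@ler_pXn2r _ 2)// ?nnegrE// real_normK ?num_real// (le_trans cs)// exprMn.
  by apply: ler_pM => //; rewrite !addr_ge0 ?sqr_ge0.
have -> : (a1 + b1) ^+ 2 + (a2 + b2) ^+ 2 + (a3 + b3) ^+ 2 =
  (a1 ^+ 2 + a2 ^+ 2 + a3 ^+ 2) + (b1 ^+ 2 + b2 ^+ 2 + b3 ^+ 2)
  + 2 * (a1 * b1 + a2 * b2 + a3 * b3) by ring.
have -> : (s + t) ^+ 2 = s ^+ 2 + t ^+ 2 + 2 * (s * t) by ring.
by rewrite !lerD// ler_pM2l.
Qed.

Lemma Jminus_trans p x y : Jminus p x -> Jminus x y -> Jminus p y.
Proof.
rewrite /Jminus /= => -[h1 h2] [h3 h4]; split; first exact: le_trans h3 h1.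
have -> : tcoord p - tcoord y = (tcoord x - tcoord y) + (tcoord p - tcoord x) by ring.
have E i : crd y i - crd p i = (crd y i - crd x i) + (crd x i - crd p i) by ring.
by rewrite !E; apply: lorentz_triangle => //; rewrite subr_ge0.
Qed.

(** Past-compact and closed under passing to the causal future. An operator that only looks into the
    backward cone cannot create values outside such a set, so one K serves for all iterates. *)
Definition Reg K := past_compact K /\ (forall x y, K y -> Jminus x y -> K x).

Definition future A : set pt := [set x | exists2 y, A y & Jminus x y].

Lemma future_sub A : A `<=` future A.
Proof. by move=> x Ax; exists x => //; exact: Jminus_refl. Qed.

Definition origin_at (t : R) : pt := vec4 t 0 0 0.

(** The norm is the sup norm: the time gap is at least 3 r - r = 2 r, the squared spatial distance
    at most 3 r^2. So a whole ball lies in one backward cone and past-compactness becomes uniform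
    over it. *)
Lemma ball_sub_Jminus (r : R) x : 0 <= r -> `|x| <= r -> Jminus (origin_at (3 * r)) x.
Proof.
move=> r0 xr.
have xi i : `|crd x i| <= r by apply: le_trans xr; exact: coord_le.
have sq i : crd x i ^+ 2 <= r ^+ 2.
  by rewrite -[crd x i ^+ 2]real_normK ?num_real// ler_pXn2r ?nnegrE.
rewrite /Jminus /= /tcoord /origin_at.
have -> : crd (vec4 (3 * r) 0 0 0) 0 = 3 * r by rewrite /crd mxE.
have -> : crd (vec4 (3 * r) 0 0 0) 1 = 0 :> R by rewrite /crd mxE.
have -> : crd (vec4 (3 * r) 0 0 0) 2 = 0 :> R by rewrite /crd mxE.
have -> : crd (vec4 (3 * r) 0 0 0) 3 = 0 :> R by rewrite /crd mxE.
have := xi 0; rewrite ler_norml => /andP[h1 h2].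
split; first by lra.
rewrite !subr0.
have h : (2 * r) ^+ 2 <= (3 * r - crd x 0) ^+ 2.
  by rewrite ler_pXn2r// ?nnegrE; lra.
have r2 : 0 <= r ^+ 2 by exact: sqr_ge0.
apply: le_trans h.
have -> : (2 * r) ^+ 2 = 4 * r ^+ 2 by ring.
have := sq 1; have := sq 2; have := sq 3; lra.
Qed.

Lemma closed_past p : closed [set z : pt | Jminus p z].
Proof.
rewrite /Jminus; apply: closedI.
  by apply: closed_le_cts; [exact: coord_cts|exact: cts_cst].
have c i : continuous (fun x : pt => crd x i) by exact: coord_cts.
have cx i : continuous (fun x : pt => (crd x i - crd p i) ^+ 2).
  by have /cts_sqr := ctsB (c i) (@cts_cst R _ (crd p i)).
apply: (closed_le_cts (ctsD (ctsD (cx 1) (cx 2)) (cx 3))).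
by have /cts_sqr := ctsB (@cts_cst R _ (tcoord p)) (c 0).
Qed.

Lemma closed_cone : closed [set z : pt * pt | Jminus z.2 z.1].
Proof.
have c1 i : continuous (fun z : pt * pt => crd z.1 i).
  by apply: (@cts_comp _ _ _ (fun x : pt => crd x i) fst); [exact: coord_cts|exact: cts_fst].
have c2 i : continuous (fun z : pt * pt => crd z.2 i).
  by apply: (@cts_comp _ _ _ (fun x : pt => crd x i) snd); [exact: coord_cts|exact: cts_snd].
have cx i : continuous (fun z : pt * pt => (crd z.1 i - crd z.2 i) ^+ 2).
  by have /cts_sqr := ctsB (c1 i) (c2 i).
apply: closedI; first exact: (closed_le_cts (c1 0) (c2 0)).
apply: (closed_le_cts (ctsD (ctsD (cx 1) (cx 2)) (cx 3))).
by have /cts_sqr := ctsB (c2 0) (c1 0).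
Qed.

Lemma past_bounded p (t0 : R) : exists r : R, forall x,
  Jminus p x -> t0 <= tcoord x -> `|x| <= r.
Proof.
pose D := `|tcoord p| + `|t0|.
exists (`|p| + D) => x [h1 h2] h3.
have D0 : 0 <= D by rewrite addr_ge0.
have tD : tcoord p - tcoord x <= D.
  apply: le_trans (_ : tcoord p - t0 <= _); first by rewrite lerD2l lerN2.
  by apply: le_trans (ler_norm _) _; exact: ler_normB.
have t_ge0 : 0 <= tcoord p - tcoord x by rewrite subr_ge0.
have -> : x = p + (x - p) by rewrite [p + (x - p)]addrC subrK.
apply: le_trans (ler_normD _ _) _; rewrite lerD2l.
apply: rv_norm_le => // i; rewrite !mxE.
suff : (crd x i - crd p i) ^+ 2 <= (tcoord p - tcoord x) ^+ 2.
  rewrite -[(crd x i - crd p i) ^+ 2]real_normK ?num_real// ler_pXn2r ?nnegrE// => h.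
  exact: le_trans h tD.
have s i' : 0 <= (crd x i' - crd p i') ^+ 2 by exact: sqr_ge0.
have := s 1; have := s 2; have := s 3.
case: i => [[|[|[|[|//]]]] hi].
- move=> _ _ _; have -> : Ordinal hi = 0 by exact: val_inj.
  by rewrite -/(tcoord x) -/(tcoord p) -sqrrN opprB.
- have -> : Ordinal hi = 1 by exact: val_inj.
  by move: h2 => /=; lra.
- have -> : Ordinal hi = 2 by exact: val_inj.
  by move: h2 => /=; lra.
- have -> : Ordinal hi = 3 by exact: val_inj.
  by move: h2 => /=; lra.
Qed.

Lemma past_compact_time A p : past_compact A ->
  exists C : R, forall y, A y -> Jminus p y -> `|tcoord y| <= C.
Proof.
move=> /(_ p) cA.
have ct : continuous (fun x : pt => tcoord x) by exact: coord_cts.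
have [C _ H] := cts_bounded cA ct.
by exists C => y Ay Jy; apply: H; split.
Qed.

(** Points of the future of A before p, paired with a witness in A, form a closed set of causally
    related pairs inside the product of the compact set A before p with a ball; the projection of a
    compact set is compact. The ball exists because time is bounded below on A before p. *)
Lemma future_Reg A : past_compact A -> Reg (future A).
Proof.
move=> pcA; split; last first.
  by move=> x y [z Az Jz] Jy; exists z => //; exact: Jminus_trans Jy Jz.
move=> p.
have [C HC] := past_compact_time p pcA.
have [r Hr] := past_bounded p (- C).
have c1 := compact_setX (pcA p) (@cball_compact R r).
have c2 : compact ((A `&` Jminus p) `*` [set x : pt | `|x| <= r] `&`
   ([set z : pt * pt | Jminus z.2 z.1] `&` snd @^-1` [set z : pt | Jminus p z])).
  apply: compact_closedI => //; apply: closedI; first exact: closed_cone.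
  by apply: closed_comp; [move=> z _; exact: cts_snd|exact: closed_past].
have -> : future A `&` Jminus p = snd @` ((A `&` Jminus p) `*` [set x : pt | `|x| <= r] `&`
   ([set z : pt * pt | Jminus z.2 z.1] `&` snd @^-1` [set z : pt | Jminus p z])).
  apply/seteqP; split=> [x [[y Ay Jy] Jx]|x [[y z] /= [[[Ay Jpy] _] [Jzy Jpz]] <-]].
    exists (y, x) => //; have Jpy := Jminus_trans Jx Jy; split; split=> //=.
    apply: Hr => //; have := HC y Ay Jpy; rewrite ler_norml => /andP[hC _].
    by apply: le_trans hC _; case: Jy.
  by split=> //; exists y.
apply: continuous_compact => //.
by apply: continuous_subspaceT; exact: cts_snd.
Qed.

End Causal.

Lemma Int_trunc (R : realType) (g : R -> R) (P0 P : R) : P0 <= P ->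
  (forall x, P0 <= x -> g x = 0) -> Int 0 P g = Int 0 P0 g.
Proof.
move=> P0P g0; rewrite !IntE Rintegral_mkcond [RHS]Rintegral_mkcond.
apply: eq_Rintegral => x _; rewrite !patchE !mem_setE !in_itv/=.
case: (leP 0 x) => //= x0; case: (leP x P0) => xP0.
  by rewrite (le_trans xP0 P0P).
by case: ifP => // _; rewrite g0// ltW.
Qed.

Lemma near_ball (R : realType) (V : normedModType R) (x : V) (d : R) : 0 < d ->
  nbhs x [set y | `|y - x| < d].
Proof. by move=> d0; apply/nbhs_normP; exists d => // y /=; rewrite distrC. Qed.

Lemma nbhs_ballR (R : realType) (V : normedModType R) (x : V) (A : set V) : nbhs x A ->
  exists2 d : R, 0 < d & forall y, `|y - x| < d -> A y.
Proof.
by move=> /nbhs_normP[d d0 H]; exists d => // y yx; apply: H; rewrite /= distrC.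
Qed.

Section PastCompactFunctions.
Context {R : realType}.
Local Notation pt := (pt R).
Implicit Types (f g : pt -> R) (x y : pt) (K : set pt) (k l : R -> R) (p q P : R).

Lemma Reg_closed K : Reg K -> closed K.
Proof.
move=> [pcK fK] x clx.
(* Two units later than x: the ball of radius 1/2 around x is then inside the backward cone of p, so
   closedness of the compact set K before p decides the matter near x. *)
pose p := x + vec4 2 0 0 0.
have cl : closed (K `&` Jminus p).
  by apply: compact_closed; [exact: norm_hausdorff|exact: pcK].
suff : (K `&` Jminus p) x by case.
apply: cl => B Bx.
have ball_x : nbhs x [set y : pt | `|y - x| < 2^-1].
  by apply: near_ball; rewrite invr_gt0.
have [y [Ky [By yx]]] := clx _ (filterI Bx ball_x).
exists y; split=> //; split=> //.
have hi i : `|crd y i - crd x i| <= 2^-1.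
  apply: le_trans (ltW yx); have := coord_le (y - x) i; by rewrite !mxE.
have c0 : crd p 0 = crd x 0 + 2 by rewrite /crd !mxE.
have c1 : crd p 1 = crd x 1 by rewrite /crd !mxE addr0.
have c2 : crd p 2 = crd x 2 by rewrite /crd !mxE addr0.
have c3 : crd p 3 = crd x 3 by rewrite /crd !mxE addr0.
have sq i : (crd y i - crd x i) ^+ 2 <= 2^-1 ^+ 2.
  rewrite -[(crd y i - crd x i) ^+ 2]real_normK ?num_real//.
  by rewrite ler_pXn2r// nnegrE invr_ge0.
rewrite /Jminus /= /tcoord c0 c1 c2 c3.
have := hi 0; rewrite ler_norml => /andP[h1 h2]; split; first by lra.
have h : 1 ^+ 2 <= (crd x 0 + 2 - crd y 0) ^+ 2.
  by rewrite ler_pXn2r// ?nnegrE; lra.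
apply: le_trans h.
have := sq 1; have := sq 2; have := sq 3.
by rewrite exprVn expr1n; lra.
Qed.

(** Vanishing is asked pointwise outside K, which is convenient for linear combinations and limits;
    for [Reg K] the set is closed, so the support is in K all the same ([PC_supp]). *)
Definition PC K f := Smooth f /\ forall x, ~ K x -> f x = 0.

Lemma PC_smooth K f : PC K f -> Smooth f.
Proof. by case. Qed.

Lemma PC_L K f g (a b : R) : PC K f -> PC K g -> PC K (fun x => a * f x + b * g x).
Proof.
move=> [sf f0] [sg g0]; split; first exact: smoothL.
by move=> x Kx; rewrite f0// g0// !mulr0 addr0.
Qed.

Lemma PC_pd K f i : Reg K -> PC K f -> PC K (pd i f).
Proof.
move=> /Reg_closed clK [sf f0]; split; first exact: smooth_pd.
move=> x Kx; rewrite pd_derive.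
have : nbhs x (~` K) by apply: open_nbhs_nbhs; split=> //; exact: closed_openC.
move=> /nbhs_ballR[d d0 Hd].
have D : is_derive x (evec R i) f 0.
  apply: is_derive_eps => e e0; exists d => // h hd.
  have z y : `|y - x| < d -> f y = 0 by move=> yd; apply: f0; exact: Hd.
  rewrite !z; first by rewrite mulr0 !subr0 normr0 mulr_ge0// ltW.
    by rewrite subrr normr0.
  rewrite [x + _]addrC addrK mx_normZ; apply: le_lt_trans hd.
  by rewrite ler_piMr// evec_norm.
by case: D.
Qed.

Lemma PC_dal K f : Reg K -> PC K f -> PC K (dal f).
Proof.
move=> rK Pf; split; first exact/smooth_dal/(PC_smooth Pf).
move=> x Kx; have P2 i : pd i (pd i f) x = 0.
  by have [_] := PC_pd i rK (PC_pd i rK Pf); exact.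
by rewrite /dal !P2; ring.
Qed.

Lemma PC_lap K f : Reg K -> PC K f -> PC K (lap f).
Proof.
move=> rK Pf; split; first exact/smooth_lap/(PC_smooth Pf).
move=> x Kx; have P2 i : pd i (pd i f) x = 0.
  by have [_] := PC_pd i rK (PC_pd i rK Pf); exact.
by rewrite /lap !P2; ring.
Qed.

Lemma PC_sub K K' f : K `<=` K' -> PC K f -> PC K' f.
Proof. by move=> KK' [sf f0]; split=> // x K'x; apply: f0 => /KK'. Qed.

Definition spt x tau r th ph : pt :=
  x + vec4 (- tau) (r * (sin th * cos ph)) (r * (sin th * sin ph)) (r * cos th).

(** The squared interval to the vertex is tau^2 - r^2 = p q, which is nonnegative. *)
Lemma spt_past x p q th ph : 0 <= p -> 0 <= q ->
  Jminus x (spt x ((p + q) / 2) ((p - q) / 2) th ph).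
Proof.
move=> p0 q0; rewrite /Jminus /= /tcoord /spt.
set v := vec4 _ _ _ _.
have E i : crd (x + v) i = crd x i + crd v i by rewrite /crd !mxE.
rewrite !E.
have -> : crd v 0 = - ((p + q) / 2) by rewrite /crd !mxE.
have -> : crd v 1 = (p - q) / 2 * (sin th * cos ph) by rewrite /crd !mxE.
have -> : crd v 2 = (p - q) / 2 * (sin th * sin ph) by rewrite /crd !mxE.
have -> : crd v 3 = (p - q) / 2 * cos th by rewrite /crd !mxE.
split; first by lra.
set r := (p - q) / 2.
have -> : (crd x 1 + r * (sin th * cos ph) - crd x 1) ^+ 2
  + (crd x 2 + r * (sin th * sin ph) - crd x 2) ^+ 2
  + (crd x 3 + r * cos th - crd x 3) ^+ 2 = r ^+ 2.
  ring: (cos2sin2 th) (cos2sin2 ph).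
have -> : (crd x 0 - (crd x 0 + - ((p + q) / 2))) ^+ 2 = r ^+ 2 + p * q by rewrite /r; field.
by rewrite lerDl mulr_ge0.
Qed.

Lemma Hq_eq0 K f x p q : Reg K -> PC K f ->
  (forall th ph, ~ K (spt x ((p + q) / 2) ((p - q) / 2) th ph)) ->
  Hq f x p q = 0 /\ hq f x p q = 0.
Proof.
move=> rK Pf nK.
have s0 g : PC K g -> forall th ph, sph g x ((p + q) / 2) ((p - q) / 2) th ph = 0.
  by move=> [_ g0] th ph; apply: g0; exact: nK.
have S0 (h : R -> R -> R) : (forall th ph, h th ph = 0) -> S2 h = 0.
  move=> h0; rewrite (eq_S2 (h := fun _ _ => 0)); last exact: h0.
  by rewrite S2_cst mulr0.
split; last by rewrite /hq S0 ?mulr0//; exact: s0.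
apply: S0 => th ph.
have n0 : nab f x ((p + q) / 2) ((p - q) / 2) th ph = 0.
  rewrite /nab (s0 _ (PC_pd 1 rK Pf)) (s0 _ (PC_pd 2 rK Pf)) (s0 _ (PC_pd 3 rK Pf)).
  by rewrite !mulr0 !addr0.
by rewrite n0 (s0 _ Pf) mulr0 addr0.
Qed.

(** The point lies (p + q) / 2 before x. Within the backward cone of a point later than the whole
    ball, times on K are at least -C, so far enough back K has been left; the constant makes the
    time gap at least |C| + rad + 1. *)
Lemma Reg_radius K (rad : R) : Reg K -> 0 <= rad -> exists2 P0 : R, 0 <= P0 &
  forall x p q, `|x| <= rad -> 0 <= p -> 0 <= q -> P0 <= p + q ->
  forall th ph, ~ K (spt x ((p + q) / 2) ((p - q) / 2) th ph).
Proof.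
move=> [pcK fK] r0.
have [C HC] := past_compact_time (origin_at (3 * rad)) pcK.
exists (2 * (`|C| + rad + 1)); first by rewrite mulr_ge0// !addr_ge0.
move=> x p q xr p0 q0 pq th ph Ky.
have J1 := ball_sub_Jminus r0 xr.
have J2 := spt_past x th ph p0 q0.
have := HC _ Ky (Jminus_trans J1 J2).
rewrite /tcoord /spt.
have -> : crd (x + vec4 (- ((p + q) / 2)) ((p - q) / 2 * (sin th * cos ph))
  ((p - q) / 2 * (sin th * sin ph)) ((p - q) / 2 * cos th)) 0 = crd x 0 - (p + q) / 2.
  by rewrite /crd !mxE.
rewrite ler_norml => /andP[h1 _].
have := coord_le x 0; rewrite -/(crd x 0) => h2.
have := ler_norm (crd x 0); have := ler_norm C; lra.
Qed.

(* For f supported in a regular set the truncations are eventually constant. *)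
Definition T k f x : R := lim ((fun n : nat => TP k n%:R f x) @ \oo).

Lemma TP_indep K k f x P0 P : Reg K -> PC K f -> continuous k -> 0 <= P0 -> P0 <= P ->
  (forall p q, 0 <= p -> 0 <= q -> P0 <= p + q ->
  forall th ph, ~ K (spt x ((p + q) / 2) ((p - q) / 2) th ph)) ->
  TP k P f x = TP k P0 f x.
Proof.
move=> rK Pf ck P00 P0P van; rewrite /TP.
have z p q : 0 <= p -> 0 <= q -> P0 <= p + q -> k (p * q) * Hq f x p q = 0.
  by move=> p0 q0 pq; rewrite (Hq_eq0 rK Pf (van p q p0 q0 pq)).1 mulr0.
have P_0 : 0 <= P by exact: le_trans P0P.
congr (_ * _).
have -> : Int 0 P (fun p => Int 0 P (fun q => k (p * q) * Hq f x p q)) =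
    Int 0 P0 (fun p => Int 0 P (fun q => k (p * q) * Hq f x p q)).
  apply: Int_trunc => // p Pp; apply: Int0 => q q0 _; apply: z => //.
    exact: le_trans Pp.
  by rewrite (le_trans Pp)// lerDl.
apply: eq_Int => p p0 _; apply: Int_trunc => // q Pq; apply: z => //.
  exact: le_trans Pq.
by rewrite (le_trans Pq)// lerDr.
Qed.

(** P0 depends on K and on the ball alone, so several functions, kernels or base points can be
    compared at one common truncation. *)
Lemma T_eq K (rad : R) : Reg K -> 0 <= rad -> exists2 P0 : R, 0 <= P0 &
  forall k f x, PC K f -> continuous k -> `|x| <= rad ->
  T k f x = TP k P0 f x /\
     (forall p q, 0 <= p -> 0 <= q -> P0 <= p + q ->
       Hq f x p q = 0 /\ hq f x p q = 0).
Proof.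
move=> rK r0; have [P0 P00 H] := Reg_radius rK r0.
exists P0 => // k f x Pf ck xr; split; last first.
  by move=> p q p0 q0 pq; apply: (Hq_eq0 rK Pf); exact: H.
apply: cvg_lim => //; apply: cvg_near_cst.
exists (Num.truncn P0).+1 => // n /= Pn.
apply: (TP_indep rK Pf ck P00); last by move=> p q; exact: H.
apply: ltW; apply: lt_le_trans (truncnS_gt P0) _.
by rewrite ler_nat.
Qed.

Lemma T_PC K k f : Reg K -> continuous k -> PC K f ->
  PC K (T k f) /\ forall i, pd i (T k f) = T k (pd i f).
Proof.
move=> rK ck Pf.
have [s dE] : Smooth (T k f) /\ forall i, pd i (T k f) = T k (pd i f).
  apply: (@operator_smooth R (T k) (PC K)) Pf.
  - by move=> g i; exact: PC_pd.
  - move=> g rad Pg; have r0 : 0 <= `|rad| by [].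
    have [P0 P00 H] := T_eq rK r0.
    have sg := PC_smooth Pg.
    have [C0 C00 hC0] := cball_bounded (`|rad| + P0) (smooth_continuous sg).
    have /choice[C1 HC1] : forall i, exists C : R, 0 <= C /\ forall y, `|y| <= `|rad| + P0 -> `|pd i g y| <= C.
      move=> i; have [C ? ?] := cball_bounded (`|rad| + P0) (smooth_continuous (smooth_pd i sg)).
      by exists C.
    have [Kk _ hK] := cts_bounded (@segment_compact R 0 (P0 ^+ 2)) ck.
    exists (cstP P0 * Kk * (C0 + \sum_i C1 i)) => x xr.
    have xr' : `|x| <= `|rad| by apply: le_trans xr (ler_norm _).
    have [-> _] := H k g x Pg ck xr'.
    have sC : 0 <= \sum_i C1 i by apply: sumr_ge0 => i _; case: (HC1 i).
    apply: TP_bound => //.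
    + exact: addr_ge0.
    + by move=> s s0 sP; apply: hK; rewrite /= in_itv/= s0.
    + move=> y yr; apply: le_trans (hC0 y _) _; last by rewrite lerDl.
      by apply: le_trans yr _; rewrite lerD2r.
    + move=> i y yr; apply: le_trans ((HC1 i).2 y _) _.
        by apply: le_trans yr _; rewrite lerD2r.
      rewrite (bigD1 i)//= addrCA lerDl addr_ge0// sumr_ge0// => j _.
      by case: (HC1 j).
  (* The radius grows by 1 because x + h e_i may leave the original ball. *)
  - move=> g i rad Pg; have r0 : 0 <= `|rad| + 1 by rewrite addr_ge0.
    have [P0 P00 H] := T_eq rK r0.
    have [C C0 HC] := TP_taylor i `|rad| (PC_smooth Pg) P00.
    have [Kk _ hK] := cts_bounded (@segment_compact R 0 (P0 ^+ 2)) ck.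
    exists (C * Kk) => x h xr h1.
    have xr' : `|x| <= `|rad| by apply: le_trans xr (ler_norm _).
    have xr1 : `|x| <= `|rad| + 1 by apply: le_trans xr' _; rewrite lerDl.
    have [-> _] := H k g x Pg ck xr1.
    have [-> _] := H k (pd i g) x (PC_pd i rK Pg) ck xr1.
    have xr2 : `|x + h *: evec R i| <= `|rad| + 1.
      apply: le_trans (ler_normD _ _) _; apply: lerD => //.
      by rewrite mx_normZ -[1]mul1r ler_pM// evec_norm.
    have [-> _] := H k g (x + h *: evec R i) Pg ck xr2.
    by apply: HC => // s s0 sP; apply: hK; rewrite /= in_itv/= s0.
split=> //; split=> // x nKx.
have [P0 P00 H] := T_eq rK (normr_ge0 x).
have [-> _] := H k f x Pf ck (lexx _).
rewrite /TP Int0 ?mulr0// => p p0 _; apply: Int0 => q q0 _.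
have [|-> _] := Hq_eq0 (x := x) (p := p) (q := q) rK Pf; last by rewrite mulr0.
move=> th ph Ky; apply: nKx; apply: rK.2 Ky _; exact: spt_past.
Qed.

Lemma T_dal K l l1 l2 f x : Reg K -> PC K f ->
  (forall s : R, Der l s (l1 s)) -> (forall s : R, Der l1 s (l2 s)) -> continuous l2 ->
  T l (dal f) x = l 0 * f x + T (fun s => -4 * (l1 s + s * l2 s)) f x.
Proof.
move=> rK Pf dl dl1 cl2.
have cl : continuous l by exact: der_cts dl.
have cl1 : continuous l1 by exact: der_cts dl1.
have [P0 P00 H] := T_eq rK (normr_ge0 x).
have ck : continuous (fun s => -4 * (l1 s + s * l2 s)).
  by apply: ctsM; [cts|apply: ctsD => //; apply: ctsM; [cts|]].
have [-> van] := H l (dal f) x (PC_dal rK Pf) cl (lexx _).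
have [-> _] := H _ f x Pf ck (lexx _).
apply: TP_dal => //; first exact: PC_smooth Pf.
move=> p q p0 q0 pq.
have [_ v1] := H l f x Pf cl (lexx _).
have [_ v2] := H l (pd 0 f) x (PC_pd 0 rK Pf) cl (lexx _).
have [_ v3] := H l (lap f) x (PC_lap rK Pf) cl (lexx _).
by rewrite (v1 p q p0 q0 pq).1 (v2 p q p0 q0 pq).1 (v3 p q p0 q0 pq).2 oppr0 addr0.
Qed.

Lemma T_L K k f g (a b : R) x : Reg K -> continuous k -> PC K f -> PC K g ->
  T k (fun y => a * f y + b * g y) x = a * T k f x + b * T k g x.
Proof.
move=> rK ck Pf Pg; have [P0 P00 H] := T_eq rK (normr_ge0 x).
have [-> _] := H k _ x (PC_L a b Pf Pg) ck (lexx _).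
have [-> _] := H k f x Pf ck (lexx _).
have [-> _] := H k g x Pg ck (lexx _).
by apply: TPL => //; [case: Pf|case: Pg].
Qed.

Lemma T_kL K k l f (a b : R) x : Reg K -> continuous k -> continuous l -> PC K f ->
  T (fun s => a * k s + b * l s) f x = a * T k f x + b * T l f x.
Proof.
move=> rK ck cl Pf; have [P0 P00 H] := T_eq rK (normr_ge0 x).
have ckl : continuous (fun s => a * k s + b * l s).
  by apply: ctsD; apply: ctsM; try cts.
have [-> _] := H _ f x Pf ckl (lexx _).
have [-> _] := H k f x Pf ck (lexx _).
have [-> _] := H l f x Pf cl (lexx _).
by apply: TPkL => //; case: Pf.
Qed.

(** The constants are chosen before the kernel: kernels for arbitrarily many masses of any size are
    measured by their sup on the same interval. *)
Lemma T_bound K f (rad : R) : Reg K -> PC K f -> exists C P0 : R, [/\ 0 <= C, 0 <= P0 &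
  forall k (Kk : R), continuous k -> (forall s, 0 <= s -> s <= P0 -> `|k s| <= Kk) ->
  forall x, `|x| <= rad -> `|T k f x| <= C * Kk].
Proof.
move=> rK Pf.
have [P0 P00 H] := T_eq rK (normr_ge0 rad).
have sf := PC_smooth Pf.
have [C0 C00 hC0] := cball_bounded (`|rad| + P0) (smooth_continuous sf).
have /choice[C1 HC1] : forall i, exists C : R, 0 <= C /\ forall y, `|y| <= `|rad| + P0 -> `|pd i f y| <= C.
  move=> i; have [C ? ?] := cball_bounded (`|rad| + P0) (smooth_continuous (smooth_pd i sf)).
  by exists C.
have sC : 0 <= \sum_i C1 i by apply: sumr_ge0 => i _; case: (HC1 i).
exists (cstP P0 * (C0 + \sum_i C1 i)), (P0 ^+ 2); split.
- by rewrite mulr_ge0 ?cstP_ge0// addr_ge0.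
- exact: sqr_ge0.
move=> k Kk ck hk x xr.
have xr' : `|x| <= `|rad| by apply: le_trans xr (ler_norm _).
have [-> _] := H k f x Pf ck xr'.
rewrite mulrAC; apply: TP_bound => //.
- exact: addr_ge0.
- move=> y yr; apply: le_trans (hC0 y _) _; last by rewrite lerDl.
  by apply: le_trans yr _; rewrite lerD2r.
- move=> i y yr; apply: le_trans ((HC1 i).2 y _) _.
    by apply: le_trans yr _; rewrite lerD2r.
  rewrite (bigD1 i)//= addrCA lerDl addr_ge0// sumr_ge0// => j _.
  by case: (HC1 j).
Qed.

Lemma T_param_continuous K (k : R -> R -> R) f x : Reg K -> PC K f -> cts2 k ->
  continuous (fun M => T (k M) f x).
Proof.
move=> rK Pf ck; have [P0 P00 H] := T_eq rK (normr_ge0 x).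
have -> : (fun M => T (k M) f x) = (fun M => TP (k M) P0 f x).
  by apply/funext => M; have [-> _] := H (k M) f x Pf (cts2_sect ck) (lexx _).
rewrite /TP; apply: ctsM; first exact: cts_cst.
apply: (@Int_continuous R R (fun M p => Int 0 P0 (fun q => k M (p * q) * Hq f x p q)) 0 P0 P00).
apply: (@Int_continuous R (R * R)%type (fun z q => k z.1 (z.2 * q) * Hq f x z.2 q) 0 P0 P00).
apply: ctsM.
  apply: (@cts_comp _ _ _ (fun z : R * R => k z.1 z.2) (fun z : R * R * R => (z.1.1, z.1.2 * z.2))) => //.
  by apply: cts_pair; cts.
apply: (@cts_comp _ _ _ (fun z : R * R => Hq f x z.1 z.2) (fun z : R * R * R => (z.1.2, z.2))).
  exact/Hq_cts/(PC_smooth Pf).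
by apply: cts_pair; cts.
Qed.

End PastCompactFunctions.

(** * Kernels of products of retarded Green operators *)

Section Entire.
Context {R : realType}.
Implicit Types (a b : nat -> R) (s x : R).

(** Exponential growth of the series, in a form stable under term-by-term differentiation (C becomes
    C^2) and under the recursion [lcoef]. *)
Definition ent a := exists2 C : R, 1 <= C & forall n, `|a n| <= C ^+ n.+1 / n`!%:R.

Definition ker a s : R := limn (pseries a s).

Lemma ent_cvg a x : ent a -> cvgn (pseries a x).
Proof.
move=> [C C1 aC]; have C0 : 0 <= C by exact: le_trans C1.
apply: normed_cvg.
apply: (@series_le_cvg _ _ (C \o* exp_coeff (C * `|x|))).
- by move=> n /=.
- by move=> n /=; rewrite mulr_ge0// exp_coeff_ge0// mulr_ge0.
- move=> n /=; rewrite normrM normrX.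
  apply: le_trans (ler_wpM2r _ (aC n)) _; first exact: exprn_ge0.
  rewrite /exp_coeff /= exprMn exprSr.
  by rewrite le_eqVlt; apply/orP; left; apply/eqP; ring.
- have -> : (C \o* exp_coeff (C * `|x|)) = C *: exp_coeff (C * `|x|).
    by apply/funext => n /=; rewrite mulrC.
  by apply: is_cvg_seriesZ; exact: is_cvg_series_exp_coeff.
Qed.

Lemma ent_diffs a : ent a -> ent (pseries_diffs a).
Proof.
move=> [C C1 aC]; have C0 : 0 <= C by exact: le_trans C1.
exists (C ^+ 2) => [|n]; first by rewrite exprn_ege1.
rewrite /pseries_diffs normrM ger0_norm//.
apply: le_trans (ler_wpM2l _ (aC n.+1)) _ => //.
have -> : n.+1%:R * (C ^+ n.+2 / n.+1`!%:R) = C ^+ n.+2 / n`!%:R.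
  have f0 : n`!%:R != 0 :> R by rewrite pnatr_eq0 -lt0n fact_gt0.
  have n0 : n.+1%:R != 0 :> R by rewrite pnatr_eq0.
  rewrite factS natrM; move: (n.+1%:R : R) (n`!%:R : R) (C ^+ n.+2) n0 f0 => p q r p0 q0.
  by field; apply/andP.
rewrite ler_wpM2r ?invr_ge0// -exprM ler_weXn2l//.
by rewrite mul2n -addnn addSn addnS !ltnS leq_addl.
Qed.

Lemma ker_der a x : ent a -> Der (ker a) x (ker (pseries_diffs a) x).
Proof.
move=> ea; apply: (@pseries_snd_diffs R a (`|x| + 1)).
- exact: ent_cvg.
- exact/ent_cvg/ent_diffs.
- exact/ent_cvg/ent_diffs/ent_diffs.
- by rewrite [ltRHS]ger0_norm ?addr_ge0// ltrDl.
Qed.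

Lemma ker_cts a : ent a -> continuous (ker a).
Proof. by move=> ea; apply: (@der_cts R _ (ker (pseries_diffs a))) => t; exact: ker_der. Qed.

Lemma ker0 a : ker a 0 = a 0%N.
Proof.
rewrite /ker; apply: cvg_lim => //; apply: cvg_near_cst.
exists 1%N => // -[//|n] _ /=.
rewrite /pseries /series /= big_nat_recl//= expr0 mulr1 big1 ?addr0// => i _.
by rewrite expr0n mulr0.
Qed.

Lemma ker_lin a b (r t : R) x : ent a -> ent b ->
  ker (fun n => r * a n + t * b n) x = r * ker a x + t * ker b x.
Proof.
move=> ea eb; rewrite /ker; apply: cvg_lim => //.
have -> : pseries (fun n => r * a n + t * b n) x =
  (fun n => r * pseries a x n + t * pseries b x n).
  apply/funext => n; rewrite /pseries /series /= !mulr_sumr -big_split/=.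
  by apply: eq_bigr => i _; ring.
by apply: cvgD; apply: cvgM; try exact: cvg_cst; exact: ent_cvg.
Qed.

Lemma ker_shift a s : ent a -> 
  ker (fun n => if n is n'.+1 then a n' else 0) s = s * ker a s.
Proof.
move=> ea; rewrite /ker; apply: cvg_lim => //.
rewrite -cvg_shiftS /=.
have -> : (fun n => pseries (fun n => if n is n'.+1 then a n' else 0) s n.+1) =
  (fun n => s * pseries a s n).
  apply/funext => n; rewrite /pseries /series /= big_nat_recl//= mul0r add0r mulr_sumr.
  by apply: eq_bigr => i _; rewrite exprS; ring.
by apply: cvgM; [exact: cvg_cst|exact: ent_cvg].
Qed.

(** Frobenius recursion for -4 (s l')' = M l + e at the singular point s = 0: the coefficient of s^n
    in (s l')' is (n + 1)^2 a_(n+1), so the regular solution is fixed by l(0) = l0. *)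
Fixpoint lcoef (M l0 : R) (e : nat -> R) (n : nat) : R :=
  if n is n'.+1 then - (M * lcoef M l0 e n' + e n') / (4 * n'.+1%:R ^+ 2) else l0.

Lemma lcoef_ent (M l0 : R) (e : nat -> R) : `|l0| <= 1 -> ent e -> ent (lcoef M l0 e).
Proof.
move=> l01 [D D1 eD].
pose C := D + `|M|.
have C1 : 1 <= C by rewrite /C; have := normr_ge0 M; lra.
have CD : D <= C by rewrite lerDl.
have CM : `|M| <= C by rewrite /C; lra.
have C0 : 0 <= C by exact: le_trans C1.
have D0 : 0 <= D by exact: le_trans D1.
exists C => //; elim=> [|n IH] /=.
  by rewrite expr1 divr1 (le_trans l01).
have n0 : 0 < n.+1%:R :> R by rewrite ltr0n.
have n1 : 1 <= n.+1%:R :> R by rewrite ler1n.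
rewrite normrM normrN normfV [X in _ / X]ger0_norm; last by rewrite mulr_ge0// sqr_ge0.
set q := C ^+ n.+1 / n`!%:R.
have q0 : 0 <= q by rewrite divr_ge0// exprn_ge0.
have h1 : `|M * lcoef M l0 e n + e n| <= 2 * (C * q).
  have -> : 2 * (C * q) = C * q + C * q by ring.
  apply: le_trans (ler_normD _ _) _; apply: lerD.
    by rewrite normrM ler_pM.
  apply: le_trans (eD n) _; apply: le_trans (_ : q <= _).
    by rewrite /q ler_wpM2r ?invr_ge0// lerXn2r// nnegrE.
  by rewrite ler_peMl.
apply: le_trans (ler_wpM2r _ h1) _; first by rewrite invr_ge0 mulr_ge0// sqr_ge0.
have -> : C ^+ n.+2 / n.+1`!%:R = C * q / n.+1%:R.
  by rewrite /q factS natrM invfM exprS; ring.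
rewrite ler_pdivrMr; last by rewrite mulr_gt0// exprn_gt0.
have -> : C * q / n.+1%:R * (4 * n.+1%:R ^+ 2) = C * q * (4 * n.+1%:R).
  by field; rewrite gt_eqF.
rewrite mulrC; apply: ler_wpM2l; first exact: mulr_ge0.
move: n1; move: (n.+1%:R : R) => r r1; lra.
Qed.

Lemma lcoef_ode (M l0 : R) (e : nat -> R) s : `|l0| <= 1 -> ent e ->
  let a := lcoef M l0 e in
  -4 * (ker (pseries_diffs a) s + s * ker (pseries_diffs (pseries_diffs a)) s) =
  M * ker a s + ker e s.
Proof.
move=> l01 ee a.
have ea : ent a by exact: lcoef_ent.
have ea1 := ent_diffs ea; have ea2 := ent_diffs ea1.
have aS n : a n.+1 = - (M * a n + e n) / (4 * n.+1%:R ^+ 2) by [].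
rewrite -(ker_shift _ ea2) -[M * _ + _]addr0.
have -> : M * ker a s + ker e s + 0 = M * ker a s + 1 * ker e s by rewrite mul1r addr0.
rewrite -(ker_lin M 1 s ea ee).
have es : ent (fun n => if n is n'.+1 then pseries_diffs (pseries_diffs a) n' else 0).
  have [C C1 HC] := ea1.
  have C0 : 0 <= C by exact: le_trans C1.
  have [C' C'1 HC'] := ent_diffs ea1.
  have C'0 : 0 <= C' by exact: le_trans C'1.
  (* The shift replaces n! by (n + 1)!; the doubled constant absorbs this through n + 1 <= 2^(n +
     2). *)
  exists ((2 * C') ) => [|[|n]]; first by lra.
    by rewrite normr0 divr_ge0// exprn_ge0// mulr_ge0.
  apply: le_trans (HC' n) _.
  rewrite factS natrM invfM mulrA ler_wpM2r ?invr_ge0//.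
  rewrite ler_pdivlMr ?ltr0n// exprMn mulrC.
  apply: ler_pM => //; first exact: exprn_ge0.
    have : (n.+1 <= 2 ^ n.+2)%N by rewrite (leq_trans (ltnW (ltn_expl n.+1 (isT : 1 < 2)%N)))// leq_exp2l.
    by rewrite -(ler_nat R) natrX.
  by rewrite ler_weXn2l.
have -> : -4 * (ker (pseries_diffs a) s + ker (fun n => if n is n'.+1 then pseries_diffs (pseries_diffs a) n' else 0) s)
  = -4 * ker (pseries_diffs a) s + -4 * ker (fun n => if n is n'.+1 then pseries_diffs (pseries_diffs a) n' else 0) s by ring.
rewrite -(ker_lin (-4) (-4) s ea1 es).
congr (ker _ s); apply/funext => -[|n]; rewrite /pseries_diffs /=.
  by rewrite (aS 0%N); field.
have n0 : n.+2%:R != 0 :> R by rewrite pnatr_eq0.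
have -> : n.+1%:R = n.+2%:R - 1 :> R by rewrite -[n.+2%:R]natr1 addrK.
by rewrite (aS n.+1); move: (n.+2%:R : R) n0 (a n.+1) (e n.+1) => r r0 u v; field.
Qed.

(* Kernel of the product of the retarded Green operators with masses Ms: the power
   series solution of -4 (s l')' = M l + e, where e is the kernel for the tail of
   Ms, with l(0) = 1 for a single mass (the Bessel kernel) and l(0) = 0 otherwise. *)
Fixpoint ecoef (Ms : seq R) : nat -> R :=
  if Ms is M :: Ms' then lcoef M (nilp Ms')%:R (ecoef Ms') else fun=> 0.

Definition E (Ms : seq R) : R -> R := ker (ecoef Ms).

Lemma ecoef_ent Ms : ent (ecoef Ms).
Proof.
elim: Ms => [|M Ms IH] /=.
  by exists 1 => // n; rewrite normr0 divr_ge0// exprn_ge0.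
by apply: lcoef_ent => //; case: (nilp Ms); rewrite /= ?normr1 ?normr0.
Qed.

Lemma E_cts Ms : continuous (E Ms).
Proof. exact/ker_cts/ecoef_ent. Qed.

Lemma E_nil s : E [::] s = 0.
Proof.
rewrite /E /ker; apply: cvg_lim => //; apply: cvg_near_cst; exists 0%N => // n _.
by rewrite /pseries /series /= big1// => i _; rewrite mul0r.
Qed.

Definition E1 (Ms : seq R) : R -> R := ker (pseries_diffs (ecoef Ms)).
Definition E2 (Ms : seq R) : R -> R := ker (pseries_diffs (pseries_diffs (ecoef Ms))).

Lemma E_der Ms s : Der (E Ms) s (E1 Ms s).
Proof. exact/ker_der/ecoef_ent. Qed.

Lemma E1_der Ms s : Der (E1 Ms) s (E2 Ms s).
Proof. exact/ker_der/ent_diffs/ecoef_ent. Qed.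

Lemma E2_cts Ms : continuous (E2 Ms).
Proof. exact/ker_cts/ent_diffs/ent_diffs/ecoef_ent. Qed.

Lemma E_ode M Ms s : -4 * (E1 (M :: Ms) s + s * E2 (M :: Ms) s) = M * E (M :: Ms) s + E Ms s.
Proof.
apply: lcoef_ode; last exact: ecoef_ent.
by case: (nilp Ms); rewrite /= ?normr1 ?normr0.
Qed.

Lemma E_at0 M Ms : E (M :: Ms) 0 = (nilp Ms)%:R.
Proof. by rewrite /E ker0. Qed.

(** Mass and point enter only through the product M s, which yields joint continuity in both without
    further estimates. *)
Lemma E_scale M s : E [:: M] s = E [:: 1] (M * s).
Proof.
rewrite /E /ker; congr (limn _); apply/funext => n; rewrite /pseries /series /=.
apply: eq_bigr => i _.
have -> : lcoef M true%:R (fun=> 0) i = M ^+ i * lcoef 1 true%:R (fun=> 0) i.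
  elim: i => [|i IH] /=; first by rewrite mul1r.
  by rewrite IH [M ^+ i.+1]exprS !addr0; move: (_^-1) => q; ring.
by rewrite exprMn; ring.
Qed.

Lemma E_cts2 : cts2 (fun M s => E [:: M] s).
Proof.
have -> : (fun M s => E [:: M] s) = (fun M s => E [:: 1] (M * s)).
  by apply/funext => M; apply/funext => s; rewrite E_scale.
by apply: (@cts_comp _ _ _ (E [:: 1]) (fun z : R * R => z.1 * z.2)); [exact: E_cts|cts].
Qed.

Lemma der_nondecr (f df : R -> R) s : (forall t : R, Der f t (df t)) -> 0 <= s ->
  (forall t, 0 < t -> t < s -> 0 <= df t) -> f 0 <= f s.
Proof.
move=> D s0 d0; have [->//|s_neq0] := eqVneq s 0.
have s_gt0 : 0 < s by rewrite lt_neqAle eq_sym s_neq0.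
have D' x : x \in `]0, s[ -> is_derive x 1 f (df x) by move=> _; exact: D.
have [|c] := MVT s_gt0 D'; first by apply: continuous_subspaceT; exact: der_cts D.
rewrite in_itv/= => /andP[c0 cs] E0; rewrite -subr_ge0 E0 subr0.
by rewrite mulr_ge0// d0.
Qed.

Lemma der_exprn n (t : R) : Der (fun s => s ^+ n.+1) t (n.+1%:R * t ^+ n).
Proof.
elim: n => [|n IH].
  by rewrite expr0 mulr1; apply: (der_ext _ (der_id t)) => u; rewrite expr1.
have := derM (der_id t) IH; rewrite mul1r.
have -> : t ^+ n.+1 + t * (n.+1%:R * t ^+ n) = n.+2%:R * t ^+ n.+1.
  by rewrite -[n.+2%:R]natr1 exprS; ring.
by move=> H; apply: (der_ext _ H) => u; rewrite [RHS]exprS.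
Qed.

Lemma der_expR (c t : R) : Der (fun s => expR (c * s)) t (c * expR (c * t)).
Proof.
have D : Der (fun s => c * s) t c by der; ring.
rewrite mulrC; exact: (@is_derive1_comp _ expR (fun s => c * s) t _ _ (is_derive_expR _) D).
Qed.

(* Energy s l'^2 + (M + B) l^2 / 4 with a Groenwall factor; the point is that the
   constants are uniform for M >= 4 - B. *)
Lemma energy (l l1 l2 k : R -> R) (M B kap sig : R) (j : nat) :
  0 <= B -> 4 <= M + B -> 0 <= sig ->
  (forall s, Der l s (l1 s)) -> (forall s, Der l1 s (l2 s)) ->
  (forall s, -4 * (l1 s + s * l2 s) = M * l s + k s) ->
  (forall s, 0 <= s -> s <= sig -> `|k s| <= kap * s ^+ j) ->
  let lam := B ^+ 2 / 8 in
  forall s, 0 <= s -> s <= sig ->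
  s * l1 s ^+ 2 + (M + B) / 4 * l s ^+ 2 <=
   expR (lam * s) * ((M + B) / 4 * l 0 ^+ 2 + kap ^+ 2 * s ^+ (2 * j).+1 / 8).
Proof.
move=> B0 MB sig0 dl dl1 ode kb lam s s0 ssig.
pose En t := t * (l1 t * l1 t) + (M + B) / 4 * (l t * l t).
(* The ODE eliminates l2, and the terms M l l1 cancel against those from the potential energy. Only
   B survives, so the growth rate does not see M. *)
pose dEn t := - (l1 t * l1 t) - k t * l1 t / 2 + B / 2 * (l t * l1 t).
have DEn t : Der En t (dEn t).
  have dl' := dl t; have dl1' := dl1 t.
  rewrite /En; apply: der_eq.
    apply: derD; first exact: (derM (der_id t) (derM dl1' dl1')).
    exact: (derM (der_cst _ t) (derM dl' dl')).
  rewrite /dEn; have ode_t := ode t.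
  have -> : k t = -4 * (l1 t + t * l2 t) - M * l t by rewrite ode_t; ring.
  by field.
(* The source bound minus the energy discounted at rate lam. Its monotonicity is the integrated
   Groenwall inequality; the source bound is generous by the factor 2 j + 1. *)
pose z t := kap ^+ 2 * t ^+ (2 * j).+1 / 8 - expR (- lam * t) * En t.
pose dz t := kap ^+ 2 * ((2 * j).+1%:R * t ^+ (2 * j)) / 8
   - (- lam * expR (- lam * t) * En t + expR (- lam * t) * dEn t).
have Dz t : Der z t (dz t).
  apply: derB; last exact: (derM (der_expR _ t) (DEn t)).
  have -> : kap ^+ 2 * ((2 * j).+1%:R * t ^+ (2 * j)) / 8 =
     kap ^+ 2 / 8 * ((2 * j).+1%:R * t ^+ (2 * j)) by ring.
  apply: der_ext (derZ (kap ^+ 2 / 8) (der_exprn (2 * j) t)) => u; ring.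
have /(_ _)/= mono := der_nondecr Dz s0.
have {}mono : z 0 <= z s.
  apply: mono => t t0 ts.
  have tsig : t <= sig by exact: le_trans (ltW ts) ssig.
  have kt := kb t (ltW t0) tsig.
  have kt2 : k t ^+ 2 <= kap ^+ 2 * t ^+ (2 * j).
    have -> : kap ^+ 2 * t ^+ (2 * j) = (kap * t ^+ j) ^+ 2 by rewrite exprMn -exprM mulnC.
    rewrite -[k t ^+ 2]real_normK ?num_real// ler_pXn2r// ?nnegrE//.
    exact: le_trans kt.
  have en1 : l t ^+ 2 <= En t.
    rewrite /En -!expr2.
    have h1 : 0 <= t * l1 t ^+ 2 by rewrite mulr_ge0 ?sqr_ge0// ltW.
    have h2 : 1 * l t ^+ 2 <= (M + B) / 4 * l t ^+ 2.
      by rewrite ler_wpM2r ?sqr_ge0//; lra.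
    by move: h1 h2; rewrite mul1r; lra.
  (* Half of - l1^2 is spent on each product. Completing the two squares leaves k^2 / 8 and B^2 l^2
     / 8, whence lam; and l^2 <= [En] because (M + B) / 4 >= 1. *)
  have d1 : dEn t <= k t ^+ 2 / 8 + lam * En t.
    have : 0 <= (l1 t + k t / 2) ^+ 2 by exact: sqr_ge0.
    have : 0 <= (l1 t - B * l t / 2) ^+ 2 by exact: sqr_ge0.
    have h : lam * l t ^+ 2 <= lam * En t.
      by rewrite ler_wpM2l// /lam divr_ge0// sqr_ge0.
    move=> h1 h2; rewrite /dEn.
    have E3 : k t ^+ 2 / 8 + lam * l t ^+ 2 - (- (l1 t * l1 t) - k t * l1 t / 2 + B / 2 * (l t * l1 t))
       = (l1 t + k t / 2) ^+ 2 / 2 + (l1 t - B * l t / 2) ^+ 2 / 2.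
      by rewrite /lam; field.
    lra.
  have ex1 : expR (- lam * t) <= 1.
    rewrite -expR0 ler_expR mulNr oppr_le0 mulr_ge0 ?(ltW t0)//.
    by rewrite /lam divr_ge0// sqr_ge0.
  have ex0 : 0 <= expR (- lam * t) by exact: expR_ge0.
  have h3 : expR (- lam * t) * (dEn t - lam * En t) <= k t ^+ 2 / 8.
    apply: le_trans (_ : expR (- lam * t) * (k t ^+ 2 / 8) <= _).
      by apply: ler_wpM2l => //; lra.
    by rewrite ler_piMl// divr_ge0// sqr_ge0.
  rewrite /dz.
  have h4 : t ^+ (2 * j) <= (2 * j).+1%:R * t ^+ (2 * j).
    by rewrite ler_peMl ?ler1n// exprn_ge0// ltW.
  have h5 : kap ^+ 2 * t ^+ (2 * j) <= kap ^+ 2 * ((2 * j).+1%:R * t ^+ (2 * j)).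
    by rewrite ler_wpM2l ?sqr_ge0.
  have -> : - lam * expR (- lam * t) * En t + expR (- lam * t) * dEn t =
     expR (- lam * t) * (dEn t - lam * En t) by ring.
  lra.
have z0 : z 0 = - ((M + B) / 4 * l 0 ^+ 2).
  by rewrite /z /En !mulr0 expR0 expr0n /= mulr0 mul0r mul0r; ring.
move: mono; rewrite z0 /z => mono.
have mono' : expR (- lam * s) * En s <= (M + B) / 4 * l 0 ^+ 2 + kap ^+ 2 * s ^+ (2 * j).+1 / 8.
  lra.
rewrite -[leLHS]/(En s).
have -> : En s = expR (lam * s) * (expR (- lam * s) * En s).
  by rewrite mulrA -expRD -mulrDl subrr mul0r expR0 mul1r.
by apply: ler_wpM2l => //; exact: expR_ge0.
Qed.

End Entire.

(** * Factorial decay of the kernels, uniform in the masses *)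

Section KernelBound.
Context {R : realType}.
Variables (B sig : R).
Hypotheses (B0 : 0 <= B) (sig0 : 0 <= sig).

(** Square root of the Groenwall factor at [sig], since the energy controls squares. *)
Let L := expR (B ^+ 2 / 16 * sig).

Let L0 : 0 <= L. Proof. exact: expR_ge0. Qed.

Let LL s : 0 <= s -> s <= sig -> expR (B ^+ 2 / 8 * s) <= L ^+ 2.
Proof.
move=> s0 ss; rewrite /L [expR _ ^+ 2]expr2 -expRD ler_expR.
have -> : B ^+ 2 / 16 * sig + B ^+ 2 / 16 * sig = B ^+ 2 / 8 * sig by field.
by rewrite ler_wpM2l// divr_ge0// sqr_ge0.
Qed.

(** Without a source the potential part of the energy suffices: its coefficient (M + B) / 4, large
    as it may be, stands on both sides and cancels. *)
Lemma E_bound1 M s : 4 <= M + B -> 0 <= s -> s <= sig -> `|E [:: M] s| <= L.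
Proof.
move=> MB s0 ss.
have k0 t : 0 <= t -> t <= sig -> `|E [::] t| <= 0 * t ^+ 0 :> R.
  by move=> _ _; rewrite E_nil normr0 mul0r.
have := @energy R (E [:: M]) (E1 [:: M]) (E2 [:: M]) (E [::]) M B 0 sig 0 B0 MB sig0
  (E_der [:: M]) (E1_der [:: M]) (E_ode M [::]) k0 s s0 ss.
have -> : E [:: M] 0 = 1 by rewrite E_at0.
rewrite expr1n mulr1 expr0n /= mul0r mul0r addr0 => h.
have c0 : 0 < (M + B) / 4 by lra.
have h2 : (M + B) / 4 * E [:: M] s ^+ 2 <= (M + B) / 4 * L ^+ 2.
  apply: le_trans (_ : expR (B ^+ 2 / 8 * s) * ((M + B) / 4) <= _).
    by apply: le_trans h; rewrite lerDr mulr_ge0// sqr_ge0.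
  by rewrite mulrC ler_pM2l//; exact: LL.
move: h2; rewrite ler_pM2l// => h2.
by rewrite -(@ler_pXn2r _ 2)// ?nnegrE// real_normK ?num_real.
Qed.

(** Here l(0) = 0, so the source alone drives the energy. The kinetic part s l'^2 against s^(2j+1)
    bounds l' by L A s^j, and integration from 0 gains s / (j + 1): iterated, this is the
    factorial. *)
Lemma E_boundS M Ms (A : R) (j : nat) : 4 <= M + B -> ~~ nilp Ms -> 0 <= A ->
  (forall s, 0 <= s -> s <= sig -> `|E Ms s| <= A * s ^+ j) ->
  forall s, 0 <= s -> s <= sig -> `|E (M :: Ms) s| <= L * A * s ^+ j.+1 / j.+1%:R.
Proof.
move=> MB nMs A0 kb.
have l0 : E (M :: Ms) 0 = 0 by rewrite E_at0 (negbTE nMs).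
have d1 t : 0 < t -> t <= sig -> `|E1 (M :: Ms) t| <= L * A * t ^+ j.
  move=> t0 ts.
  have := energy B0 MB sig0 (E_der (M :: Ms)) (E1_der (M :: Ms)) (E_ode M Ms) kb (ltW t0) ts.
  rewrite l0 expr0n /= mulr0 add0r => h.
  have h2 : t * E1 (M :: Ms) t ^+ 2 <= t * (L * A * t ^+ j) ^+ 2.
    apply: le_trans (_ : t * E1 (M :: Ms) t ^+ 2 + (M + B) / 4 * E (M :: Ms) t ^+ 2 <= _).
      by rewrite lerDl mulr_ge0 ?sqr_ge0//; lra.
    apply: le_trans h _.
    have -> : t * (L * A * t ^+ j) ^+ 2 = L ^+ 2 * (A ^+ 2 * (t * t ^+ (2 * j))).
      by rewrite !exprMn -exprM [(j * 2)%N]mulnC; ring.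
    apply: ler_pM; first exact: expR_ge0.
    + by rewrite divr_ge0// mulr_ge0 ?sqr_ge0// exprn_ge0// ltW.
    + exact: LL (ltW t0) ts.
    + rewrite [t ^+ (2 * j).+1]exprS.
      have u0 : 0 <= t * t ^+ (2 * j) by rewrite mulr_ge0 ?exprn_ge0// ltW.
      have := mulr_ge0 (sqr_ge0 A) u0.
      by move: (A ^+ 2 * (t * t ^+ (2 * j))) => v v0; lra.
  move: h2; rewrite ler_pM2l// => h2.
  rewrite -(@ler_pXn2r _ 2)// ?nnegrE//; last by rewrite !mulr_ge0// exprn_ge0// ltW.
  by rewrite real_normK ?num_real.
move=> s s0 ss.
pose m t := L * A / j.+1%:R * t ^+ j.+1.
have dm t : Der m t (L * A * t ^+ j).
  apply: der_eq (derZ (L * A / j.+1%:R) (der_exprn j t)) _.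
  have n0 : j.+1%:R != 0 :> R by rewrite pnatr_eq0.
  by move: (j.+1%:R : R) n0 => r r0; field.
have m0 : m 0 = 0 by rewrite /m expr0n /= mulr0.
have -> : L * A * s ^+ j.+1 / j.+1%:R = m s by rewrite /m; ring.
rewrite ler_norml; apply/andP; split.
  have p t : 0 < t -> t < s -> 0 <= L * A * t ^+ j + E1 (M :: Ms) t.
    move=> t0 ts; have := d1 t t0 (le_trans (ltW ts) ss).
    by rewrite ler_norml => /andP[h _]; lra.
  have := der_nondecr (f := fun t => m t + E (M :: Ms) t)
    (fun t => derD (dm t) (E_der (M :: Ms) t)) s0 p.
  by rewrite m0 l0; lra.
have p t : 0 < t -> t < s -> 0 <= L * A * t ^+ j - E1 (M :: Ms) t.
  move=> t0 ts; have := d1 t t0 (le_trans (ltW ts) ss).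
  by rewrite ler_norml => /andP[_ h]; lra.
have := der_nondecr (f := fun t => m t - E (M :: Ms) t)
    (fun t => derB (dm t) (E_der (M :: Ms) t)) s0 p.
by rewrite m0 l0; lra.
Qed.

Lemma E_bound Ms : ~~ nilp Ms -> (forall M, M \in Ms -> 4 <= M + B) ->
  forall s, 0 <= s -> s <= sig ->
  `|E Ms s| <= L ^+ size Ms / (size Ms).-1`!%:R * s ^+ (size Ms).-1.
Proof.
elim: Ms => // M [|M' Ms] IH _ HB s s0 ss.
  by rewrite /= expr1 divr1 expr0 mulr1; apply: E_bound1 => //; apply: HB; rewrite mem_head.
have HB' : forall N, N \in M' :: Ms -> 4 <= N + B.
  by move=> N NMs; apply: HB; rewrite in_cons NMs orbT.
have {}IH := IH isT HB'.
have MB : 4 <= M + B by apply: HB; rewrite mem_head.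
have A0 : 0 <= L ^+ size (M' :: Ms) / (size (M' :: Ms)).-1`!%:R.
  by rewrite divr_ge0// exprn_ge0.
have h := @E_boundS M (M' :: Ms) _ _ MB isT A0 IH s s0 ss.
apply: le_trans h _; rewrite le_eqVlt; apply/orP; left; apply/eqP.
rewrite /= [L ^+ (size Ms).+2]exprS factS natrM invfM.
by move: (_^-1) (_^-1) => u v; ring.
Qed.

End KernelBound.

(** * Retarded Green operators *)

Section Green.
Context {R : realType}.
Local Notation pt := (pt R).
Implicit Types (f g u v : pt -> R) (x y : pt) (K : set pt) (M : R) (Ms : seq R).

(** K is the causal future of the support. A lower bound for time on the support persists on its
    future, and this is how the half-space t >= -eps is inherited by the solution. *)
Lemma Cpc_PC f : Cpc f -> exists2 K, Reg K & PC K f /\ (forall t0 : R,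
  supp f `<=` [set x | t0 <= tcoord x] -> K `<=` [set x | t0 <= tcoord x]).
Proof.
move=> [/SmoothE sf [K0 [pK sK]]].
have pcs : past_compact (supp f).
  move=> p; have -> : supp f `&` Jminus p = supp f `&` (K0 `&` Jminus p).
    by apply/seteqP; split=> x [h1 h2]; [split=> //; split=> //; exact: sK|case: h2].
  by rewrite setIC; apply: compact_closedI; [exact: pK|exact: closed_closure].
exists (future (supp f)); first exact: future_Reg.
split; first split=> // x nx.
  apply/eqP; apply: contrapT => /negP fx; apply: nx; apply: future_sub.
  exact: subset_closure.
by move=> t0 st x [y /st /= ty [yx _]]; exact: le_trans yx.
Qed.

Lemma PC_supp K f : Reg K -> PC K f -> supp f `<=` K.
Proof.
move=> rK [_ f0]; rewrite /supp closureE => x; apply; split; first exact: Reg_closed.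
by move=> y /= fy; apply: contrapT => /f0 fy0; move: fy; rewrite fy0 eqxx.
Qed.

Lemma PC_Cpc K f : Reg K -> PC K f -> Cpc f.
Proof.
move=> rK Pf; split; first by apply/SmoothE; case: Pf.
by exists K; split; [case: rK|exact: PC_supp].
Qed.

Lemma Reg_setU K K' : Reg K -> Reg K' -> Reg (K `|` K').
Proof.
move=> [p f] [p' f']; split.
  by move=> q; rewrite setIUl; apply: compactU.
by move=> x y [Ky|Ky] J; [left; exact: f Ky J|right; exact: f' Ky J].
Qed.

Variable K : set pt.
Hypothesis rK : Reg K.

Lemma dal_T k f : continuous k -> PC K f -> dal (T k f) = T k (dal f).
Proof.
move=> ck Pf.
have p2 i : pd i (pd i (T k f)) = T k (pd i (pd i f)).
  have [_ ->] := T_PC rK ck Pf.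
  by have [_ ->] := T_PC rK ck (PC_pd i rK Pf).
have P2 i : PC K (pd i (pd i f)) by exact: PC_pd rK (PC_pd i rK Pf).
apply/funext => x; rewrite /dal !p2.
have P01 := PC_L (-1) 1 (P2 0) (P2 1).
have P012 := PC_L 1 1 P01 (P2 2).
have -> : (fun y => - pd 0 (pd 0 f) y + pd 1 (pd 1 f) y + pd 2 (pd 2 f) y + pd 3 (pd 3 f) y) =
  (fun y => 1 * (1 * (-1 * pd 0 (pd 0 f) y + 1 * pd 1 (pd 1 f) y) + 1 * pd 2 (pd 2 f) y) + 1 * pd 3 (pd 3 f) y).
  by apply/funext => y; rewrite !mul1r mulN1r.
rewrite (T_L 1 1 x rK ck P012 (P2 3)) (T_L 1 1 x rK ck P01 (P2 2)) (T_L (-1) 1 x rK ck (P2 0) (P2 1)).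
by rewrite !mul1r mulN1r.
Qed.

(** The ODE of the kernel read as an operator identity: [box] - M strips the first mass off the
    list. For a single mass the value l(0) = 1 leaves f itself. *)
Lemma T_step M Ms f x : PC K f ->
  T (E (M :: Ms)) (dal f) x - M * T (E (M :: Ms)) f x = (nilp Ms)%:R * f x + T (E Ms) f x.
Proof.
move=> Pf.
rewrite (T_dal x rK Pf (E_der (M :: Ms)) (E1_der (M :: Ms)) (@E2_cts _ (M :: Ms))) E_at0.
have -> : (fun s => -4 * (E1 (M :: Ms) s + s * E2 (M :: Ms) s)) =
  (fun s => M * E (M :: Ms) s + 1 * E Ms s).
  by apply/funext => s; rewrite E_ode mul1r.
rewrite (T_kL M 1 x rK (@E_cts _ (M :: Ms)) (@E_cts _ Ms) Pf) mul1r.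
by move: (T _ _ _) (T _ _ _) => a b; ring.
Qed.

Lemma T_nil f x : PC K f -> T (E [::]) f x = 0.
Proof.
move=> Pf.
have E0 : E [::] = (fun s : R => 0 * E [::] s + 0 * E [::] s).
  by apply/funext => s; rewrite E_nil !mul0r addr0.
by rewrite E0 (T_kL 0 0 x rK (@E_cts _ [::]) (@E_cts _ [::]) Pf) !mul0r addr0.
Qed.

Definition G M f : pt -> R := T (E [:: M]) f.

Lemma G_PC M f : PC K f -> PC K (G M f).
Proof. by move=> Pf; have [] := T_PC rK (@E_cts _ [:: M]) Pf. Qed.

Lemma pd_G M f i : PC K f -> pd i (G M f) = G M (pd i f).
Proof. by move=> Pf; have [_] := T_PC rK (@E_cts _ [:: M]) Pf. Qed.

Lemma dal_G M f : PC K f -> dal (G M f) = G M (dal f).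
Proof. by move=> Pf; exact: dal_T (@E_cts _ _) Pf. Qed.

Lemma G_L M f g (a b : R) : PC K f -> PC K g ->
  G M (fun y => a * f y + b * g y) = (fun y => a * G M f y + b * G M g y).
Proof. by move=> Pf Pg; apply/funext => x; rewrite /G (T_L a b x rK (@E_cts _ [:: M]) Pf Pg). Qed.

Lemma G_sol M f x : PC K f -> dal (G M f) x = M * G M f x + f x.
Proof.
move=> Pf; rewrite dal_G//; apply/eqP; rewrite addrC -subr_eq; apply/eqP.
by rewrite T_step// mul1r T_nil// addr0.
Qed.

(** [T_step] makes [G M] a left inverse of [box] - M as well: inserting f = [dal] v - M v into [G M]
    f gives back v. Uniqueness of retarded solutions thus needs no energy argument on spacetime. *)
Lemma G_unique M v f : PC K v -> PC K f -> (forall x, dal v x = M * v x + f x) -> v = G M f.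
Proof.
move=> Pv Pf H; apply/funext => x.
have -> : f = (fun x => 1 * dal v x + - M * v x) by apply/funext => y; rewrite H; ring.
rewrite (G_L _ _ _ (PC_dal rK Pv) Pv) mul1r mulNr T_step//.
by rewrite T_nil// mul1r addr0.
Qed.

(** By uniqueness, since both sides solve the equation for the first mass with the same source.
    Collapsing the product into one integral makes every later bound cost first derivatives of f
    only once. *)
Lemma T_list Ms f : PC K f -> ~~ nilp Ms -> foldr G f Ms = T (E Ms) f.
Proof.
move=> Pf; elim: Ms => // M [//|M' Ms] IH _.
rewrite [foldr _ _ _]/(G M (foldr G f (M' :: Ms))) IH//; apply/esym.
have PT Ms' : PC K (T (E Ms') f) by have [] := T_PC rK (@E_cts _ Ms') Pf.
apply: G_unique => // x; rewrite (dal_T (@E_cts _ _) Pf).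
have := T_step M (M' :: Ms) x Pf; rewrite mul0r add0r => <-.
by rewrite addrC subrK.
Qed.

Lemma G_cts_mass f x : PC K f -> continuous (fun M => G M f x).
Proof. by move=> Pf; exact: (T_param_continuous rK Pf (@E_cts2 R)). Qed.

Lemma G_list_bound f (B rad : R) : PC K f -> 0 <= B -> exists C L : R,
  [/\ 0 <= C, 1 <= L &
  forall Ms x, (forall M, M \in Ms -> 4 <= M + B) -> `|x| <= rad ->
    `|foldr G f Ms x| <= C * (L ^+ size Ms / (size Ms).-1`!%:R)].
Proof.
move=> Pf B0.
have [C [P0 [C0 P00 HC]]] := T_bound rad rK Pf.
have [C' C'0 HC'] := cball_bounded rad (smooth_continuous (PC_smooth Pf)).
pose L0 := expR (B ^+ 2 / 16 * P0).
have L01 : 1 <= L0.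
  by rewrite /L0 -expR0 ler_expR mulr_ge0// divr_ge0// sqr_ge0.
pose m := Num.max 1 P0.
have m1 : 1 <= m by rewrite le_max lexx.
have mP : P0 <= m by rewrite le_max lexx orbT.
have L0_ge0 : 0 <= L0 by exact: le_trans L01.
have m_ge0 : 0 <= m by exact: le_trans m1.
(* C' covers the empty list, where the bound is that of f itself; m >= 1 absorbs the powers of s. *)
exists (C + C'), (L0 * m); split; first exact: addr_ge0.
  by rewrite -[1]mulr1 ler_pM.
move=> [|M Ms] x HM xr.
  by rewrite /= expr0 divr1 mulr1 (le_trans (HC' x xr))// lerDr.
rewrite (T_list Pf)//.
apply: le_trans (_ : C * ((L0 * m) ^+ size (M :: Ms) / (size (M :: Ms)).-1`!%:R) <= _); last first.
  rewrite ler_wpM2r ?lerDl// divr_ge0// exprn_ge0// mulr_ge0//.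
apply: HC => //; first exact: E_cts.
move=> s s0 sP.
have := E_bound B0 P00 (isT : ~~ nilp (M :: Ms)) HM s0 sP.
move=> h; apply: le_trans h _.
rewrite -/L0 mulrAC ler_wpM2r ?invr_ge0// exprMn ler_wpM2l ?exprn_ge0//=.
apply: le_trans (_ : m ^+ (size Ms) <= _).
  by rewrite lerXn2r ?nnegrE// (le_trans sP).
by rewrite ler_weXn2l.
Qed.

End Green.

(** Shows that the choice in [Gret] is not the default: [G M] f is a solution, and a competitor
    supported in another set is compared with it on the union of the two sets. *)
Lemma Gret_G (R : realType) (M : R) (K : set (pt R)) f : Reg K -> PC K f -> Gret M f = G M f.
Proof.
move=> rK Pf; rewrite /Gret.
have Pu : PC K (G M f) by exact: G_PC.
have sol : KGsol M f (G M f).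
  split; first exact: PC_Cpc Pu.
  by apply/funext => x; rewrite dalE (G_sol rK)// addrC addKr.
have uniq v : KGsol M f v -> v = G M f.
  move=> [/Cpc_PC[K' rK' [Pv _]] Hv].
  have rKK := Reg_setU rK rK'.
  apply: (@G_unique _ _ rKK).
  - by apply: PC_sub Pv; exact: subsetUr.
  - by apply: PC_sub Pf; exact: subsetUl.
  - by move=> x; rewrite -Hv dalE addrC subrK.
by case: xgetP => [u _ [su _]|/(_ (G M f)) []]; [exact: uniq|].
Qed.

(** * Integrals over masses against an integrable weight *)

Section WeightedIntegral.
Context {R : realType}.
Implicit Types (nu g h : R -> R) (a : R).

Lemma wint_seal : {I : (R -> R) -> R -> (R -> R) -> R |
  I = fun nu a g => (\int[@lebesgue_measure R]_(M in from a) (nu M * g M))%R}.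
Proof. by eexists. Qed.

Definition wint nu a g : R := sval wint_seal nu a g.

Lemma wintE nu a g :
  wint nu a g = (\int[@lebesgue_measure R]_(M in from a) (nu M * g M))%R.
Proof. by rewrite /wint (svalP wint_seal). Qed.

Lemma fromE a : from a = `[a, +oo[%classic.
Proof. by apply/seteqP; split=> x /=; rewrite in_itv/= andbT. Qed.

Lemma measurable_from a : measurable (from a : set (measurableTypeR R)).
Proof. by rewrite fromE; exact: measurable_itv. Qed.

Variables (nu : R -> R) (a : R).
Hypothesis inu : (@lebesgue_measure R).-integrable (from a) (EFin \o nu).

Let mD := measurable_from a.

Definition adm g := continuous g /\ exists C : R, forall M, a <= M -> `|g M| <= C.

Lemma wint_integrable g : adm g ->
  (@lebesgue_measure R).-integrable (from a) (EFin \o (fun M => nu M * g M)).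
Proof.
move=> [cg [C gC]].
have mg : measurable_fun (from a) g.
  by apply: measurable_funTS; exact: measurable_realfun.continuous_measurable_fun.
have := integrableMl mD inu mg.
apply; exists C; split; first exact: num_real.
by move=> x Cx M /= aM; exact: le_trans (gC M aM) (ltW Cx).
Qed.

Lemma adm_cst (r : R) : adm (fun=> r).
Proof. by split; [exact: cts_cst|exists `|r|]. Qed.

Lemma adm_lin g h (r t : R) : adm g -> adm h -> adm (fun M => r * g M + t * h M).
Proof.
move=> [cg [C gC]] [ch [C' hC]]; split.
  by apply: ctsD; apply: ctsM => //; exact: cts_cst.
exists (`|r| * C + `|t| * C') => M aM.
by apply: le_trans (ler_normD _ _) _; apply: lerD; rewrite normrM ler_wpM2l// (gC,hC).
Qed.

Lemma wint_lin g h (r t : R) : adm g -> adm h ->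
  wint nu a (fun M => r * g M + t * h M) = r * wint nu a g + t * wint nu a h.
Proof.
move=> ag ah; rewrite !wintE.
have ig := wint_integrable ag; have ih := wint_integrable ah.
rewrite -RintegralZl// -RintegralZl// -RintegralD//.
- by apply: eq_Rintegral => M _; ring.
- by have := integrableZl mD r ig; apply: eq_integrable => // M _ /=.
- by have := integrableZl mD t ih; apply: eq_integrable => // M _ /=.
Qed.

Lemma eq_wint g h : (forall M, a <= M -> g M = h M) -> wint nu a g = wint nu a h.
Proof. by move=> gh; rewrite !wintE; apply: eq_Rintegral => M; rewrite inE/= => /gh ->. Qed.

Definition wmass : R := (\int[@lebesgue_measure R]_(M in from a) `|nu M|)%R.

Lemma wmass_ge0 : 0 <= wmass.
Proof. by apply: Rintegral_ge0 => M _. Qed.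

Lemma wint_bound g (C : R) : adm g -> (forall M, a <= M -> `|g M| <= C) ->
  `|wint nu a g| <= wmass * C.
Proof.
move=> ag gC; rewrite wintE /wmass.
have ig := wint_integrable ag.
have in' : (@lebesgue_measure R).-integrable (from a) (EFin \o (fun M => `|nu M|)).
  by have := integrable_abse inu; apply: eq_integrable.
rewrite -RintegralZr//.
apply: le_trans (le_normr_Rintegral mD ig) _.
apply: le_Rintegral => //.
- by have := integrable_abse ig; apply: eq_integrable.
- by have := integrableZr mD C in'; apply: eq_integrable.
- by move=> M aM; rewrite normrM ler_wpM2l// gC.
Qed.

End WeightedIntegral.

(** * Operators that commute with all Green operators *)

Section Operators.
Context {R : realType}.
Local Notation pt := (pt R).
Implicit Types (f g u v : pt -> R) (x y : pt) (M : R) (Ms : seq R).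

Lemma taylor2_le u i x (h D : R) : Smooth u -> `|h| <= 1 ->
  (forall y, `|y| <= `|x| + 1 -> `|pd i (pd i u) y| <= D) ->
  `|u (x + h *: evec R i) - u x - h * pd i u x| <= D * h ^+ 2.
Proof.
move=> su h1 HD.
have [k kh ->] := line_mvt x h (fun y => smooth_is_derive su i y).
have [k' k'k E] := line_mvt x k (fun y => smooth_is_derive (smooth_pd i su) i y).
rewrite -mulrBr E sqr_norm2 !normrM.
have dk : `|pd i (pd i u) (x + k' *: evec R i)| <= D.
  apply: HD; apply: le_trans (ler_normD _ _) _; rewrite lerD2l mx_normZ -[1]mul1r.
  by rewrite ler_pM ?evec_norm// (le_trans k'k)// (le_trans kh).
have -> : D * (`|h| * `|h|) = `|h| * (`|h| * D) by ring.
by apply: ler_pM => //; exact: ler_pM.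
Qed.

Variable K : set pt.
Hypothesis rK : Reg K.

(** What [Adm_GC] needs in order to commute an operator with every [G M]. The class contains the
    Green operators and their mass integrals and is closed under composition and linear combination,
    so all commutation relations come for free. *)
Definition Adm (Op : (pt -> R) -> pt -> R) : Prop :=
  [/\ forall f, PC K f -> PC K (Op f),
      forall f i, PC K f -> pd i (Op f) = Op (pd i f) &
      forall f g (a b : R), PC K f -> PC K g ->
        Op (fun y => a * f y + b * g y) = (fun y => a * Op f y + b * Op g y)].

Lemma Adm_G M : Adm (G M).
Proof.
split; [by move=> f; exact: G_PC|by move=> f i Pf; rewrite (pd_G rK)|].
by move=> f g a b; exact: (G_L rK).
Qed.

Lemma Adm_id : Adm (fun f => f).
Proof. by split. Qed.

Lemma Adm_comp O1 O2 : Adm O1 -> Adm O2 -> Adm (fun f => O1 (O2 f)).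
Proof.
move=> [p1 d1 l1] [p2 d2 l2]; split.
- by move=> f Pf; exact/p1/p2.
- by move=> f i Pf; rewrite d1 ?d2//; exact: p2.
- by move=> f g a b Pf Pg; rewrite l2// l1//; exact: p2.
Qed.

Lemma Adm_lin O1 O2 (a b : R) : Adm O1 -> Adm O2 ->
  Adm (fun f x => a * O1 f x + b * O2 f x).
Proof.
move=> [p1 d1 l1] [p2 d2 l2]; split.
- by move=> f Pf; apply: PC_L; [exact: p1|exact: p2].
- move=> f i Pf; rewrite -(d1 _ _ Pf) -(d2 _ _ Pf) pdL//.
    exact: PC_smooth (p1 _ Pf).
  exact: PC_smooth (p2 _ Pf).
- move=> f g c d Pf Pg; apply/funext => x; rewrite l1// l2//.
  by move: (O1 f x) (O1 g x) (O2 f x) (O2 g x) => *; ring.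
Qed.

Lemma Adm_iter n O : Adm O -> Adm (iter n O).
Proof.
move=> aO; elim: n => [|n IH]; first exact: Adm_id.
exact: (Adm_comp aO IH).
Qed.

Lemma PC0 : PC K (fun=> 0).
Proof. by split=> //; exact: smooth0. Qed.

Lemma Adm0 O : Adm O -> O (fun=> 0) = fun=> 0.
Proof.
move=> [_ _ l]; have := l _ _ 0 0 PC0 PC0.
have -> : (fun y : pt => 0 * (0 : R) + 0 * 0) = fun=> 0.
  by apply/funext => y; rewrite !mul0r addr0.
by move=> ->; apply/funext => y; rewrite !mul0r addr0.
Qed.

Lemma Adm_zero : Adm (fun f x => 0).
Proof.
split.
- by move=> f _; exact: PC0.
- move=> f i _; apply/funext => x; rewrite pd_derive.
  by have := derive_cst (0 : R) x (evec R i).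
- by move=> f g a b _ _; apply/funext => x; rewrite !mulr0 addr0.
Qed.

Lemma Adm_sum n (c : 'I_n -> R) (O : 'I_n -> (pt -> R) -> pt -> R) :
  (forall i, Adm (O i)) -> Adm (fun f x => \sum_i c i * O i f x).
Proof.
elim: n c O => [|n IH] c O aO.
  have -> : (fun f x => \sum_(i < 0) c i * O i f x) = (fun f (x : pt) => 0).
    by apply/funext => f; apply/funext => x; rewrite big_ord0.
  exact: Adm_zero.
have -> : (fun f x => \sum_(i < n.+1) c i * O i f x) =
  (fun f x => 1 * (\sum_(i < n) c (widen_ord (leqnSn n) i) * O (widen_ord (leqnSn n) i) f x)
     + c ord_max * O ord_max f x).
  by apply/funext => f; apply/funext => x; rewrite big_ord_recr mul1r.
apply: (@Adm_lin (fun f x => \sum_(i < n) c (widen_ord (leqnSn n) i) * O (widen_ord (leqnSn n) i) f x)) => //.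
exact: (IH (fun i => c (widen_ord (leqnSn n) i)) (fun i => O (widen_ord (leqnSn n) i))).
Qed.

Lemma Adm_dal O f : Adm O -> PC K f -> dal (O f) = O (dal f).
Proof.
move=> [p d l] Pf.
have P2 i : PC K (pd i (pd i f)) by exact: PC_pd rK (PC_pd i rK Pf).
have p2 i : pd i (pd i (O f)) = O (pd i (pd i f)).
  by rewrite d// d//; exact: PC_pd.
apply/funext => x; rewrite /dal !p2.
have P01 := PC_L (-1) 1 (P2 0) (P2 1).
have P012 := PC_L 1 1 P01 (P2 2).
have -> : (fun y => - pd 0 (pd 0 f) y + pd 1 (pd 1 f) y + pd 2 (pd 2 f) y + pd 3 (pd 3 f) y) =
  (fun y => 1 * (1 * (-1 * pd 0 (pd 0 f) y + 1 * pd 1 (pd 1 f) y) + 1 * pd 2 (pd 2 f) y) + 1 * pd 3 (pd 3 f) y).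
  by apply/funext => y; rewrite !mul1r mulN1r.
rewrite (l _ _ 1 1 P012 (P2 3)) (l _ _ 1 1 P01 (P2 2)) (l _ _ (-1) 1 (P2 0) (P2 1)).
by rewrite !mul1r mulN1r.
Qed.

(* By uniqueness of retarded solutions. *)
Lemma Adm_GC O M f : Adm O -> PC K f -> G M (O f) = O (G M f).
Proof.
move=> aO Pf; have [p d l] := aO; have PG := G_PC rK M Pf.
apply/esym; apply: (G_unique rK); [exact: p|exact: p|].
move=> x; rewrite (Adm_dal aO PG).
have -> : dal (G M f) = (fun x => M * G M f x + 1 * f x).
  by apply/funext => y; rewrite (G_sol rK)// mul1r.
by rewrite l// mul1r.
Qed.

Lemma foldr_PC Ms f : PC K f -> PC K (foldr G f Ms).
Proof. by move=> Pf; elim: Ms => //= M Ms; exact: G_PC. Qed.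

Variables (nu : R -> R) (a B : R).
Hypothesis inu : (@lebesgue_measure R).-integrable (from a) (EFin \o nu).
Hypothesis B0 : 0 <= B.
Hypothesis aB : 4 <= a + B.

Let MB M : a <= M -> 4 <= M + B. Proof. by move=> aM; rewrite (le_trans aB)// lerD2r. Qed.

Lemma G_bound f (rad : R) : PC K f -> exists C : R, forall M x, a <= M -> `|x| <= rad ->
  `|G M f x| <= C.
Proof.
move=> Pf; have [C [L [C0 L1 H]]] := G_list_bound rK rad Pf B0.
exists (C * L) => M x aM xr.
have := H [:: M] x; rewrite /= expr1 divr1; apply=> // N.
by rewrite inE => /eqP ->; exact: MB.
Qed.

Lemma G_adm f x : PC K f -> adm a (fun M => G M f x).
Proof.
move=> Pf; split; first exact: (G_cts_mass rK Pf).
by have [C H] := G_bound `|x| Pf; exists C => M aM; exact: H.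
Qed.

Definition V h x : R := wint nu a (fun M => G M h x).

(** [G M] commutes with partials, so its second-order Taylor remainder is bounded by [G M] of second
    partials, uniformly for M >= a. This estimate survives integration against nu and gives
    smoothness and differentiation under the mass integral. *)
Lemma V_Adm : Adm V.
Proof.
have Vlin f g (r t : R) : PC K f -> PC K g ->
    V (fun y => r * f y + t * g y) = (fun y => r * V f y + t * V g y).
  move=> Pf Pg; apply/funext => x.
  rewrite /V -(wint_lin inu r t (G_adm x Pf) (G_adm x Pg)).
  by apply: eq_wint => M _; rewrite (G_L rK).
have VS f : PC K f -> Smooth (V f) /\ forall i, pd i (V f) = V (pd i f).
  apply: (@operator_smooth R V (PC K)).
  - by move=> g i; exact: PC_pd.
  - move=> g rad Pg; have [C H] := G_bound rad Pg.
    exists (wmass nu a * C) => x xr.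
    by apply: (wint_bound inu (G_adm x Pg)) => M aM; exact: H.
  - move=> g i rad Pg.
    have Pi := PC_pd i rK Pg; have Pii := PC_pd i rK Pi.
    have [C H] := G_bound (rad + 1) Pii.
    exists (wmass nu a * C) => x h xr h1.
    have a1 := G_adm (x + h *: evec R i) Pg.
    have a2 := G_adm x Pg; have a3 := G_adm x Pi.
    have a12 := adm_lin 1 (-1) a1 a2.
    have E : V g (x + h *: evec R i) - V g x - h * V (pd i g) x =
      wint nu a (fun M => 1 * (1 * G M g (x + h *: evec R i) + -1 * G M g x) + - h * G M (pd i g) x).
      rewrite (wint_lin inu 1 (- h) a12 a3) (wint_lin inu 1 (-1) a1 a2) -!/(V _ _).
      by move: (V g _) (V g x) (V (pd i g) x) => *; ring.
    rewrite E -mulrA; apply: (wint_bound inu); first exact: adm_lin.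
    move=> M aM.
    have -> : 1 * (1 * G M g (x + h *: evec R i) + -1 * G M g x) + - h * G M (pd i g) x =
      G M g (x + h *: evec R i) - G M g x - h * pd i (G M g) x.
      rewrite (pd_G rK)//; move: (G M g _) (G M g x) (G M (pd i g) x) => *; ring.
    apply: taylor2_le => //; first exact: PC_smooth (G_PC rK M Pg).
    move=> y yr; rewrite (pd_G rK)// (pd_G rK)//; apply: H => //.
    by apply: le_trans yr _; rewrite lerD2r.
split=> // [f Pf|f i Pf]; last by have [_ ->] := VS f Pf.
split; first by have [] := VS f Pf.
move=> x nKx; rewrite /V (@eq_wint _ nu a _ (fun M => 0 * (0 : R) + 0 * 0)); last first.
  by move=> M _; have [_ ->//] := G_PC rK M Pf; rewrite !mul0r addr0.
by rewrite (wint_lin inu 0 0 (adm_cst a 0) (adm_cst a 0)) !mul0r addr0.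
Qed.

End Operators.

(** * Neumann series *)

Section DominatedSeries.
Context {R : realType}.
Implicit Types (u b : nat -> R) (c D : R).

Lemma cvg_le_eventually (w : nat -> R) (l M : R) (N : nat) : w @ \oo --> l ->
  (forall m, (N <= m)%N -> w m <= M) -> l <= M.
Proof.
move=> wl H; rewrite leNgt; apply/negP => Ml.
have e0 : 0 < l - M by rewrite subr_gt0.
have /cvgrPdist_lt/(_ _ e0) [n _ Hn] := wl.
have := Hn (maxn n N) (leq_maxl _ _); have := H (maxn n N) (leq_maxr _ _).
rewrite /= ltr_distlC => h /andP[h1 _]; lra.
Qed.

Lemma series_dominated u b c : 0 <= c -> (forall n, `|u n| <= c * b n) ->
  (forall n, 0 <= b n) -> cvgn (series b) ->
  cvgn (series u) /\
  forall N, `|limn (series u) - series u N| <= c * (limn (series b) - series b N).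
Proof.
move=> c0 ub b0 cb.
have cu : cvgn (series u).
  apply: normed_cvg; apply: (@series_le_cvg _ _ (fun n => c * b n)).
  - by move=> n /=.
  - by move=> n /=; rewrite mulr_ge0.
  - by move=> n /=; exact: ub.
  - by have := is_cvg_seriesZ (k := c) cb.
split=> // N.
have mono m : (N <= m)%N -> `|series u m - series u N| <= c * (limn (series b) - series b N).
  move=> Nm; rewrite sub_series_geq//.
  apply: le_trans (ler_norm_sum _ _ _) _.
  apply: le_trans (_ : c * (series b m - series b N) <= _).
    by rewrite sub_series_geq// mulr_sumr; apply: ler_sum => i _.
  rewrite ler_wpM2l// lerD2r; apply: nondecreasing_cvgn_le => //.
  by apply: nondecreasing_series => n _.
have cv : (fun m => `|series u m - series u N|) @ \oo --> `|limn (series u) - series u N|.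
  by apply: cvg_norm; apply: cvgB; [exact: cu|exact: cvg_cst].
exact: cvg_le_eventually cv mono.
Qed.

(* The bound of W^n f is geometric over factorial: each G gains a power of s in its
   kernel, and each term of W contains at least one G. *)
Definition gev D (n : nat) : R := D ^+ n / n.-1`!%:R.

Lemma gev_ge0 D n : 0 <= D -> 0 <= gev D n.
Proof. by move=> D0; rewrite divr_ge0// exprn_ge0. Qed.

Lemma gev_cvg D : cvgn (series (gev D)).
Proof.
have E1 : (fun n => series (gev D) n.+1) = (fun n => 1 + D * series (exp_coeff D) n).
  apply/funext => n; rewrite /series /= big_nat_recl//= /gev expr0 divr1 mulr_sumr.
  congr (_ + _); apply: eq_bigr => i _.
  by rewrite /exp_coeff /= exprS mulrA.
apply/cvg_ex; exists (1 + D * limn (series (exp_coeff D))).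
have H : (fun n => series (gev D) n.+1) @ \oo --> 1 + D * limn (series (exp_coeff D)).
  rewrite E1; apply: cvgD; first exact: cvg_cst.
  by apply: cvgM; [exact: cvg_cst|exact: is_cvg_series_exp_coeff].
by have := H; rewrite (cvg_shiftS (series (gev D))).
Qed.

End DominatedSeries.

Section Neumann.
Context {R : realType}.
Local Notation pt := (pt R).
Implicit Types (f g : pt -> R) (x y : pt) (M : R) (Ms : seq R).
Variable K : set pt.
Hypothesis rK : Reg K.
Variables (nu : R -> R) (a B : R).
Hypothesis inu : (@lebesgue_measure R).-integrable (from a) (EFin \o nu).
Hypothesis B0 : 0 <= B.
Hypothesis aB : 4 <= a + B.
Variables (gam A Bc : 'I_3 -> R) (al : R).
Hypothesis gB : forall i, 4 <= gam i + B.

Let Va := V nu a.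

Definition qop f x : R := al * f x + 1 * \sum_i Bc i * G (gam i) f x.

(** The form to which [Wret_eq] brings [Wret]: no derivative of f occurs, and each term carries at
    least one Green operator. *)
Definition W f x : R := 1 * (\sum_i A i * G (gam i) f x) + -1 * Va (qop f) x.

Lemma qop_Adm : Adm K qop.
Proof.
apply: (Adm_lin al 1 (Adm_id K)).
exact: (@Adm_sum R K 3 Bc (fun i => G (gam i)) (fun i => Adm_G rK (gam i))).
Qed.

Lemma Va_Adm : Adm K Va.
Proof. exact: (V_Adm rK inu B0 aB). Qed.

Lemma W_Adm : Adm K W.
Proof.
apply: (Adm_lin 1 (-1) _ (Adm_comp Va_Adm qop_Adm)).
exact: (@Adm_sum R K 3 A (fun i => G (gam i)) (fun i => Adm_G rK (gam i))).
Qed.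

Let Wn n : Adm K (iter n W). Proof. exact: Adm_iter W_Adm. Qed.

Definition Wsize (L : R) : R :=
  \sum_i `|A i| + wmass nu a * (`|al| + L * \sum_i `|Bc i|).

Lemma Wsize_ge0 (L : R) : 0 <= L -> 0 <= Wsize L.
Proof.
move=> L0; rewrite addr_ge0//; first by rewrite sumr_ge0.
by rewrite mulr_ge0 ?wmass_ge0// addr_ge0// mulr_ge0// sumr_ge0.
Qed.

(** Commuting [qop] past [G M] leaves one or two Green operators applied to H and evaluated at the
    single point x. So pointwise bounds can be iterated, with no derivatives and no
    neighbourhoods. *)
Lemma W_le H x (b1 b2 : R) : PC K H -> 0 <= b1 -> 0 <= b2 ->
  (forall i, `|G (gam i) H x| <= b1) -> (forall M, a <= M -> `|G M H x| <= b1) ->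
  (forall M i, a <= M -> `|G M (G (gam i) H) x| <= b2) ->
  `|W H x| <= (\sum_i `|A i|) * b1 + wmass nu a * (`|al| * b1 + (\sum_i `|Bc i|) * b2).
Proof.
move=> PH b10 b20 h1 h2 h3; rewrite /W mul1r mulN1r.
apply: le_trans (ler_normB _ _) _; apply: lerD.
  apply: le_trans (ler_norm_sum _ _ _) _; rewrite mulr_suml; apply: ler_sum => i _.
  by rewrite normrM ler_wpM2l.
have Pq : PC K (qop H) by have [p _ _] := qop_Adm; exact: p.
apply: (wint_bound inu (G_adm rK B0 aB x Pq)) => M aM.
rewrite -/(qop H) (Adm_GC rK M qop_Adm PH) /qop mul1r.
apply: le_trans (ler_normD _ _) _; apply: lerD.
  by rewrite normrM ler_wpM2l// h2.
apply: le_trans (ler_norm_sum _ _ _) _; rewrite mulr_suml; apply: ler_sum => i _.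
by rewrite normrM ler_wpM2l// (Adm_GC rK _ (Adm_G rK M) PH) h3.
Qed.

Let nilB : forall M, M \in [::] -> 4 <= M + B. Proof. by []. Qed.

Let MB M : a <= M -> 4 <= M + B. Proof. by move=> aM; rewrite (le_trans aB)// lerD2r. Qed.

(** Generalised over the list: each new W, once its Green operators are commuted through the earlier
    iterates, prepends one or two masses, and the factorial counts the length reached. *)
Lemma iterW_bound f (rad : R) : PC K f -> exists C L : R, [/\ 0 <= C, 1 <= L &
  forall n Ms x, (forall M, M \in Ms -> 4 <= M + B) -> `|x| <= rad ->
   `|iter n W (foldr G f Ms) x| <= C * Wsize L ^+ n * gev L (n + size Ms)].
Proof.
move=> Pf; have [C [L [C0 L1 HC]]] := G_list_bound rK rad Pf B0.
have L0 : 0 <= L by exact: le_trans L1.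
exists C, L; split=> // n; elim: n => [|n IH] Ms x HMs xr.
  by rewrite expr0 mulr1 add0n; exact: HC.
(* Terms with two new masses are charged as if they had one, at the price of a factor L. *)
have gS k : gev L k.+1 <= L * gev L k.
  rewrite /gev exprS -mulrA ler_wpM2l// ler_wpM2l ?exprn_ge0//.
  rewrite lef_pV2 ?posrE ?ltr0n ?fact_gt0// ler_nat.
  by case: k => //= k; rewrite factS leq_pmull.
have g0 k : 0 <= gev L k by exact: gev_ge0.
have PF := foldr_PC rK Ms Pf.
have [pn _ _] := Wn n.
have PH := pn _ PF.
set D := C * Wsize L ^+ n.
have D0 : 0 <= D by rewrite mulr_ge0// exprn_ge0// Wsize_ge0.
have H1 M : 4 <= M + B -> `|G M (iter n W (foldr G f Ms)) x| <= D * gev L (n + (size Ms).+1).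
  move=> MB'; rewrite (Adm_GC rK M (Wn n) PF).
  apply: (IH (M :: Ms)) => // N; rewrite in_cons => /orP[/eqP ->//|]; exact: HMs.
have H2 M i : 4 <= M + B ->
    `|G M (G (gam i) (iter n W (foldr G f Ms))) x| <= D * (L * gev L (n + (size Ms).+1)).
  move=> MB'; rewrite (Adm_GC rK (gam i) (Wn n) PF) (Adm_GC rK M (Wn n) (G_PC rK _ PF)).
  apply: le_trans (IH (M :: gam i :: Ms) x _ xr) _.
    by move=> N; rewrite !in_cons => /or3P[/eqP ->//|/eqP ->//|]; exact: HMs.
  by rewrite ler_wpM2l//= addnS gS.
rewrite iterS.
apply: le_trans (W_le (b1 := D * gev L (n + (size Ms).+1))
  (b2 := D * (L * gev L (n + (size Ms).+1))) PH _ _ _ _ _) _.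
- exact: mulr_ge0.
- by rewrite mulr_ge0// mulr_ge0.
- by move=> i; apply: H1.
- by move=> M aM; apply: H1; exact: MB.
- by move=> M i aM; apply: H2; exact: MB.
have -> : C * Wsize L ^+ n.+1 = D * Wsize L by rewrite exprSr mulrA.
rewrite addSnnS /Wsize; clearbody D.
rewrite le_eqVlt; apply/orP; left; apply/eqP.
by move: (gev L _) (\sum_i `|A i|) (\sum_i `|Bc i|) (wmass nu a) => u v w z; ring.
Qed.


(** Removes the list from the bound: up to two masses cost the factor L^2, and longer lists only
    enlarge the factorial. *)
Lemma iterW_gev f (rad : R) : PC K f -> exists C D : R, [/\ 0 <= C, 0 <= D &
  forall n Ms x, (size Ms <= 2)%N -> (forall M, M \in Ms -> 4 <= M + B) -> `|x| <= rad ->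
   `|iter n W (foldr G f Ms) x| <= C * gev D n].
Proof.
move=> Pf; have [C [L [C0 L1 HC]]] := iterW_bound rad Pf.
have L0 : 0 <= L by exact: le_trans L1.
have w0 := Wsize_ge0 L0.
exists (C * L ^+ 2), (Wsize L * L); split; [by rewrite mulr_ge0// exprn_ge0|exact: mulr_ge0|].
move=> n Ms x s2 HM xr; apply: le_trans (HC n Ms x HM xr) _.
have E1 : C * Wsize L ^+ n * gev L (n + size Ms) =
    (C * Wsize L ^+ n * L ^+ n) * (L ^+ size Ms / (n + size Ms).-1`!%:R).
  by rewrite /gev exprD; move: (_^-1) => q; ring.
have E2 : C * L ^+ 2 * gev (Wsize L * L) n = (C * Wsize L ^+ n * L ^+ n) * (L ^+ 2 / n.-1`!%:R).
  by rewrite /gev exprMn; move: (_^-1) => q; ring.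
rewrite E1 E2 ler_wpM2l//; first by rewrite !mulr_ge0// exprn_ge0.
rewrite ler_pM ?exprn_ge0 ?invr_ge0//; first by rewrite ler_weXn2l.
rewrite lef_pV2 ?posrE ?ltr0n ?fact_gt0// ler_nat.
have mono k l : (k <= l)%N -> (k`! <= l`!)%N.
  move=> kl; rewrite -(subnKC kl); elim: (l - k)%N => [|d IH]; first by rewrite addn0.
  by rewrite addnS factS (leq_trans IH)// leq_pmull.
by apply: mono; rewrite -!subn1 leq_sub2r// leq_addr.
Qed.

Definition SN N f x : R := \sum_(n < N) (-1) ^+ n * iter n W f x.

Definition Rs f x : R := lim ((fun N => SN N f x) @ \oo).

Lemma SN_series f x : (fun N => SN N f x) = series (fun n => (-1) ^+ n * iter n W f x).
Proof. by apply/funext => N; rewrite /SN /series /= big_mkord. Qed.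

Lemma sign_norm n (r : R) : `|(-1) ^+ n * r| = `|r|.
Proof. by rewrite normrM normrX normrN normr1 expr1n mul1r. Qed.

(* Uniformity over lists of length at most 2 lets W be applied to the limit. *)
Lemma Rs_tail f (rad : R) : PC K f -> exists (t : nat -> R), t @ \oo --> 0 /\
  forall Ms x, (size Ms <= 2)%N -> (forall M, M \in Ms -> 4 <= M + B) -> `|x| <= rad ->
   cvgn (fun N => SN N (foldr G f Ms) x) /\
   forall N, `|Rs (foldr G f Ms) x - SN N (foldr G f Ms) x| <= t N.
Proof.
move=> Pf; have [C [D [C0 D0 HC]]] := iterW_gev rad Pf.
exists (fun N => C * (limn (series (gev D)) - series (gev D) N)); split.
  rewrite -[X in _ --> X](mulr0 C) -(subrr (limn (series (gev D)))).
  by apply: cvgM; [exact: cvg_cst|apply: cvgB; [exact: cvg_cst|exact: gev_cvg]].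
move=> Ms x s2 HM xr.
have [|cu tail] := @series_dominated R (fun n => (-1) ^+ n * iter n W (foldr G f Ms) x) (gev D) C C0 _
  (fun n => gev_ge0 n D0) (@gev_cvg _ D).
  by move=> n; rewrite sign_norm; exact: HC.
have SE N : SN N (foldr G f Ms) x = series (fun n => (-1) ^+ n * iter n W (foldr G f Ms) x) N.
  by rewrite -SN_series.
split; first by rewrite SN_series.
by move=> N; rewrite /Rs SN_series SE; exact: tail.
Qed.

Lemma SN_Adm N : Adm K (SN N).
Proof.
exact: (@Adm_sum R K N (fun n => (-1) ^+ n) (fun n => iter n W) (fun n => Wn n)).
Qed.

Lemma Rs_cvg f x : PC K f -> (fun N => SN N f x) @ \oo --> Rs f x.
Proof.
move=> Pf; have [t [_ H]] := Rs_tail `|x| Pf.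
by have [] := H [::] x isT nilB (lexx _).
Qed.

Lemma SN_bound f (rad : R) : PC K f -> exists C : R, forall N x, `|x| <= rad -> `|SN N f x| <= C.
Proof.
move=> Pf; have [C [D [C0 D0 HC]]] := iterW_gev rad Pf.
exists (C * limn (series (gev D))) => N x xr.
apply: le_trans (ler_norm_sum _ _ _) _.
apply: le_trans (_ : C * series (gev D) N <= _).
  rewrite /series /= big_mkord mulr_sumr; apply: ler_sum => n _.
  by rewrite sign_norm; apply: (HC n [::]).
rewrite ler_wpM2l//; apply: nondecreasing_cvgn_le; last exact: gev_cvg.
by apply: nondecreasing_series => n _ _; exact: gev_ge0.
Qed.

(** Local bounds and Taylor remainders of the partial sums are uniform in N, so they pass to the
    limit; hence the sum is smooth and is differentiated term by term. *)
Lemma Rs_Adm : Adm K Rs.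
Proof.
have Rlin f g (r s : R) : PC K f -> PC K g ->
    Rs (fun y => r * f y + s * g y) = (fun y => r * Rs f y + s * Rs g y).
  move=> Pf Pg; apply/funext => x; rewrite {1}/Rs; apply: cvg_lim => //.
  have -> : (fun N => SN N (fun y => r * f y + s * g y) x) = (fun N => r * SN N f x + s * SN N g x).
    by apply/funext => N; have [_ _ l] := SN_Adm N; rewrite l.
  by apply: cvgD; apply: cvgM; try exact: cvg_cst; exact: Rs_cvg.
have RS f : PC K f -> Smooth (Rs f) /\ forall i, pd i (Rs f) = Rs (pd i f).
  apply: (@operator_smooth R Rs (PC K)).
  - by move=> g i; exact: PC_pd.
  - move=> g rad Pg; have [C H] := SN_bound rad Pg.
    exists C => x xr.
    have cv : (fun N => `|SN N g x|) @ \oo --> `|Rs g x| by apply: cvg_norm; exact: Rs_cvg.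
    by apply: (cvg_le_eventually (N := 0) cv) => N _; exact: H.
  - move=> g i rad Pg.
    have Pi := PC_pd i rK Pg; have Pii := PC_pd i rK Pi.
    have [C H] := SN_bound (rad + 1) Pii.
    exists C => x h xr h1.
    have cv : (fun N => `|SN N g (x + h *: evec R i) - SN N g x - h * SN N (pd i g) x|) @ \oo -->
        `|Rs g (x + h *: evec R i) - Rs g x - h * Rs (pd i g) x|.
      apply: cvg_norm; apply: cvgB.
        by apply: cvgB; exact: Rs_cvg.
      by apply: cvgM; [exact: cvg_cst|exact: Rs_cvg].
    apply: (cvg_le_eventually (N := 0) cv) => N _.
    have [p d l] := SN_Adm N.
    rewrite -(d _ _ Pg); apply: taylor2_le => //; first exact: PC_smooth (p _ Pg).
    move=> y yr; rewrite (d _ _ Pg) (d _ _ Pi); apply: H.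
    by apply: le_trans yr _; rewrite lerD2r.
split=> // [f Pf|f i Pf]; last by have [_ ->] := RS f Pf.
split; first by have [] := RS f Pf.
move=> x nKx; rewrite /Rs; apply: cvg_lim => //; apply: cvg_near_cst.
by exists 0%N => // N _; have [p _ _] := SN_Adm N; have [_ ->] := p _ Pf.
Qed.

Lemma SN_W N f x : PC K f -> SN N f x + W (SN N f) x = f x - (-1) ^+ N * iter N W f x.
Proof.
move=> Pf.
have E1 : W (SN N f) = (fun x => \sum_(n < N) (-1) ^+ n * iter n.+1 W f x).
  elim: N => [|N IH].
    have -> : SN 0 f = fun=> 0 by apply/funext => y; rewrite /SN big_ord0.
    by rewrite (Adm0 W_Adm); apply/funext => y; rewrite big_ord0.
  have -> : SN N.+1 f = (fun y => 1 * SN N f y + (-1) ^+ N * iter N W f y).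
    by apply/funext => y; rewrite /SN big_ord_recr mul1r.
  have [_ _ l] := W_Adm; have [pS _ _] := SN_Adm N; have [pW _ _] := Wn N.
  rewrite (l _ _ _ _ (pS _ Pf) (pW _ Pf)) IH; apply/funext => y.
  by rewrite big_ord_recr mul1r.
rewrite E1 /SN; elim: N {E1} => [|N IH]; first by rewrite !big_ord0 expr0 mul1r subrr addr0.
rewrite !big_ord_recr exprS mulN1r mulNr opprK.
set p := \sum_(i < N) _ in IH *; set q := \sum_(i < N) _ in IH *.
by rewrite addrACA IH /= addrA subrK.
Qed.

Lemma Rs_solves f : PC K f -> (fun x => Rs f x + W (Rs f) x) = f.
Proof.
move=> Pf; apply/funext => x.
have [p _ _] := Rs_Adm; have PR := p _ Pf.
have [t [t0 Ht]] := Rs_tail `|x| Pf.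
have tp N : 0 <= t N.
  have [_ /(_ N) h] := Ht [::] x isT nilB (lexx _).
  by apply: le_trans h.
pose c := \sum_i `|A i| + wmass nu a * (`|al| + \sum_i `|Bc i|).
have key N : `|W (Rs f) x - W (SN N f) x| <= c * t N.
  have [pS _ _] := SN_Adm N; have PS := pS _ Pf.
  have [_ _ l] := W_Adm.
  have -> : W (Rs f) x - W (SN N f) x = W (fun y => 1 * Rs f y + -1 * SN N f y) x.
    by rewrite (l _ _ _ _ PR PS) mul1r mulN1r.
  have PD : PC K (fun y => 1 * Rs f y + -1 * SN N f y) by exact: PC_L.
  (* [G M] of a remainder is the remainder of the series for the datum [G M] g. Thus [Rs_tail]
     controls it uniformly in M, as is needed to let N tend to infinity inside the mass integral. *)
  have GD M g : PC K g -> G M (fun y => 1 * Rs g y + -1 * SN N g y) =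
      (fun y => 1 * Rs (G M g) y + -1 * SN N (G M g) y).
    move=> Pg; have aO := Adm_lin 1 (-1) Rs_Adm (SN_Adm N).
    exact: (Adm_GC rK M aO Pg).
  apply: le_trans (W_le (b1 := t N) (b2 := t N) PD _ _ _ _ _) _ => //.
  - move=> i; rewrite (GD _ _ Pf) mul1r mulN1r.
    have [|_] := Ht [:: gam i] x isT _ (lexx _); last exact.
    by move=> M; rewrite inE => /eqP ->.
  - move=> M aM; rewrite (GD _ _ Pf) mul1r mulN1r.
    have [|_] := Ht [:: M] x isT _ (lexx _); last exact.
    by move=> N'; rewrite inE => /eqP ->; exact: MB.
  - move=> M i aM; rewrite (GD _ _ Pf) (GD _ _ (G_PC rK _ Pf)) mul1r mulN1r.
    have [|_] := Ht [:: M; gam i] x isT _ (lexx _); last exact.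
    by move=> N'; rewrite !inE => /orP[] /eqP ->; [exact: MB|].
  by rewrite /c; move: (t N) (\sum_i _) (\sum_i _) (wmass nu a) => u v w z; lra.
have c0 : 0 <= c by rewrite addr_ge0 ?mulr_ge0 ?wmass_ge0 ?addr_ge0 ?sumr_ge0.
have cvW : (fun N => W (SN N f) x) @ \oo --> W (Rs f) x.
  apply/cvgrPdist_le => e e0.
  have e1 : 0 < e / (c + 1) by rewrite divr_gt0// ltr_wpDl.
  have /cvgrPdist_le/(_ _ e1) := t0; apply: filterS => N.
  rewrite sub0r normrN ger0_norm// => tN.
  apply: le_trans (key N) _; apply: le_trans (_ : c * (e / (c + 1)) <= _).
    exact: ler_wpM2l.
  by rewrite mulrCA ler_piMr ?(ltW e0)// ler_pdivrMr ?ltr_wpDl// mul1r lerDl.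
have cv1 : (fun N => SN N f x + W (SN N f) x) @ \oo --> Rs f x + W (Rs f) x.
  by apply: cvgD => //; exact: Rs_cvg.
have cv2 : (fun N => SN N f x + W (SN N f) x) @ \oo --> f x.
  have -> : (fun N => SN N f x + W (SN N f) x) = (fun N => f x - (-1) ^+ N * iter N W f x).
    by apply/funext => N; exact: SN_W.
  rewrite -[X in _ --> X]subr0; apply: cvgB; first exact: cvg_cst.
  apply: cvg_series_cvg_0; rewrite -SN_series.
  by have [] := Ht [::] x isT nilB (lexx _).
exact: cvg_unique cv1 cv2.
Qed.

(** The difference d satisfies W d = - d, so every term of its Neumann series equals d, whereas the
    terms of a convergent series tend to 0. *)
Lemma W_unique f g : PC K f -> PC K g -> (forall x, f x + W f x = g x + W g x) -> f = g.
Proof.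
move=> Pf Pg H; apply/funext => x.
pose d y := 1 * f y + -1 * g y.
have Pd : PC K d by exact: PC_L.
have Wd : W d = (fun y => -1 * d y + 0 * d y).
  have [_ _ l] := W_Adm; rewrite /d (l _ _ _ _ Pf Pg); apply/funext => y.
  have := H y; move: (W f y) (W g y) (f y) (g y) => p q r s h.
  have -> : p = s + q - r by rewrite -h [r + p]addrC addrK.
  ring.
have Wnd n : iter n W d = (fun y => (-1) ^+ n * d y + 0 * d y).
  elim: n => [|n IH]; first by apply/funext => y /=; rewrite expr0 mul1r mul0r addr0.
  have [_ _ l] := W_Adm; rewrite iterS IH (l _ _ _ _ Pd Pd) Wd; apply/funext => y.
  by rewrite exprS; ring.
have cv : (fun n => (-1) ^+ n * iter n W d x) @ \oo --> (0 : R).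
  have [t [_ Ht]] := Rs_tail `|x| Pd.
  apply: cvg_series_cvg_0; rewrite -SN_series.
  by have [] := Ht [::] x isT nilB (lexx _).
have E n : (-1) ^+ n * iter n W d x = d x.
  by rewrite Wnd mul0r addr0 mulrA -exprMn mulrNN mulr1 expr1n mul1r.
have cv2 : (fun n => (-1) ^+ n * iter n W d x) @ \oo --> d x.
  by under eq_fun do rewrite E; exact: cvg_cst.
have dx : d x = 0 by exact: cvg_unique cv2 cv.
move: dx; rewrite /d mul1r mulN1r => dx.
by apply/eqP; rewrite -subr_eq0; apply/eqP.
Qed.

End Neumann.

(** * Reduction of the equation to an integrable weight *)

Section Reduction.
Context {R : realType}.
Local Notation pt := (pt R).
Variables (m a1 a2 g0 g1 g2 c b0 b1 bt0 bt1 : R).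
Hypothesis m0 : 0 < m.
Hypotheses (g01 : g0 != g1) (g02 : g0 != g2) (g12 : g1 != g2).

Let a := 4 * m ^+ 2.
Let nu M := mucon m a1 a2 g0 g1 g2 c M / M.

Hypothesis inu : (@lebesgue_measure R).-integrable (from a) (EFin \o nu).

Let a0 : 0 < a. Proof. by rewrite mulr_gt0// exprn_gt0. Qed.

(* 4 <= M + shiftB for every mass M in play, as the energy estimate requires. *)
Definition shiftB : R := 4 + `|g0| + `|g1| + `|g2|.

Let B0 : 0 <= shiftB. Proof. by rewrite !addr_ge0. Qed.
Let aB : 4 <= a + shiftB.
Proof.
rewrite /shiftB; have := normr_ge0 g0; have := normr_ge0 g1; have := normr_ge0 g2.
by have := a0; lra.
Qed.

Definition gams (i : 'I_3) : R := nth 0 [:: g0; g1; g2] i.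
Definition lagr (i : 'I_3) : R :=
  nth 0 [:: ((g0 - g1) * (g0 - g2))^-1; ((g1 - g0) * (g1 - g2))^-1; ((g2 - g0) * (g2 - g1))^-1] i.

Let gB i : 4 <= gams i + shiftB.
Proof.
have h0 := ler_norm (- g0); have h1 := ler_norm (- g1); have h2 := ler_norm (- g2).
have p0 := normr_ge0 g0; have p1 := normr_ge0 g1; have p2 := normr_ge0 g2.
rewrite !normrN in h0 h1 h2; rewrite /gams /shiftB.
by case: i => [[|[|[|//]]] ?] /=; lra.
Qed.

(* M G^M f = G^M (box f) - f trades the weight mu_con for the integrable weight
   nu = mu_con / M, at the price of the multiple n0 of the identity. *)
Definition bet := bt1 - b1.
Definition del := bt0 - b0.
Definition n0 := wint nu a (fun=> 1).
Definition kap := (gfun m a1 a2 g0 g1 g2 c)^-1.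
(** On the range of G^(gamma_i), [box] acts as gamma_i up to terms without that Green operator. So
    [Acoef] is the Lagrange weight times n0 (box - c) - kap times bet box + del at box = gamma_i,
    and [Bcoef] uses box (box - c) (bet box + del) likewise. *)
Definition Acoef (i : 'I_3) := lagr i * (n0 * (gams i - c) - kap) * (bet * gams i + del).
Definition Bcoef (i : 'I_3) := lagr i * gams i * (gams i - c) * (bet * gams i + del).

Definition Wr := W nu a gams Acoef Bcoef bet.

Lemma sum3 (F : 'I_3 -> R) : \sum_i F i = F 0 + F 1 + F 2.
Proof.
rewrite !big_ord_recl big_ord0 addr0 addrA.
have -> : lift ord0 (lift ord0 ord0) = 2 :> 'I_3 by apply: val_inj.
by have -> : lift ord0 ord0 = 1 :> 'I_3 by apply: val_inj.
Qed.

Lemma Ginv_eq K (Psi : pt -> R) : Reg K -> PC K Psi ->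
  Ginv m a1 a2 g0 g1 g2 c Psi =
  (fun x => 1 * (- kap * Psi x + n0 * (1 * dal Psi x + - c * Psi x))
     + -1 * V nu a (dal (fun y => 1 * dal Psi y + - c * Psi y)) x).
Proof.
move=> rK PP; apply/funext => x.
set f := fun y => 1 * dal Psi y + - c * Psi y.
have Pf : PC K f by apply: PC_L => //; exact: PC_dal.
have Pdf := PC_dal rK Pf.
have fE : (fun y => box Psi y - c * Psi y) = f.
  by apply/funext => y; rewrite dalE /f mul1r mulNr.
rewrite /Ginv fE.
have -> : \int[@leb R]_(M in from (4 * m ^+ 2)) (mucon m a1 a2 g0 g1 g2 c M * Gret M f x) =
  wint nu a (fun M => 1 * G M (dal f) x + - f x * 1).
  rewrite wintE; apply: eq_Rintegral => M; rewrite inE /= => aM.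
  have M0 : M != 0 by rewrite gt_eqF// (lt_le_trans a0).
  rewrite (Gret_G M rK Pf) -(dal_G rK M Pf) (G_sol rK M x Pf) /nu.
  by move: (mucon _ _ _ _ _ _ _ _) (G M f x) (f x) => p q r; field.
rewrite (wint_lin inu 1 (- f x) (G_adm rK B0 aB x Pdf) (adm_cst a 1)) -/n0 -/(V nu a (dal f) x).
rewrite -/kap -/(f x).
by move: (V nu a (dal f) x) (f x) (Psi x) => p q r; ring.
Qed.

(** Every [box] is moved onto a Green operator and resolved there. Each resolution leaves a local
    term in phi, Psi or f; summed with the Lagrange weights, these cancel except for [bet] times phi
    inside the mass integral. *)
Lemma Wret_eq K (phi : pt -> R) : Reg K -> PC K phi ->
  Wret m a1 a2 g0 g1 g2 c b0 b1 bt0 bt1 phi = Wr phi.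
Proof.
move=> rK Pp.
pose Psi := fun y => bet * dal phi y + del * phi y.
have Pd := PC_dal rK Pp.
have PP : PC K Psi by exact: PC_L.
have PsiE : (fun x => (bt1 - b1) * box phi x + (bt0 - b0) * phi x) = Psi.
  by apply/funext => y; rewrite dalE.
rewrite /Wret PsiE (Ginv_eq rK PP).
pose f := fun y => 1 * dal Psi y + - c * Psi y.
have Pf : PC K f by apply: PC_L => //; exact: PC_dal.
have Pdf := PC_dal rK Pf.
have aV : Adm K (V nu a) by exact: (V_Adm rK inu B0 aB).
have [pV _ lV] := aV.
pose Y := fun x => - kap * Psi x + n0 * f x.
have PY : PC K Y by exact: PC_L.
pose X := fun x => 1 * Y x + -1 * V nu a (dal f) x.
have PX : PC K X by apply: PC_L => //; exact: pV.
rewrite -/X.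
have Gd M (h : pt -> R) : PC K h -> G M (dal h) = (fun x => M * G M h x + 1 * h x).
  by move=> Ph; rewrite -(dal_G rK)//; apply/funext => x; rewrite (G_sol rK)// mul1r.
have GPsi M : G M Psi = (fun x => (bet * M + del) * G M phi x + bet * phi x).
  rewrite /Psi (G_L rK _ _ _ Pd Pp) (Gd _ _ Pp); apply/funext => x; ring.
have Gf M : G M f = (fun x => (M - c) * G M Psi x + 1 * Psi x).
  rewrite /f (G_L rK _ _ _ (PC_dal rK PP) PP) (Gd _ _ PP); apply/funext => x; ring.
pose F M := fun x => 1 * (M * (M - c) * G M Psi x + M * Psi x) + 1 * f x.
have Gdf M : G M (dal f) = F M.
  rewrite (Gd _ _ Pf) Gf /F; apply/funext => x; ring.
have PG M h : PC K h -> PC K (G M h) by exact: (G_PC rK).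
have PF M : PC K (F M) by rewrite -Gdf; exact: PG.
have GX M x : G M X x = (n0 * (M - c) - kap) * G M Psi x + n0 * Psi x - V nu a (F M) x.
  rewrite /X (G_L rK _ _ _ PY (pV _ Pdf)) (Adm_GC rK M aV Pdf) Gdf /Y (G_L rK _ _ _ PP Pf) Gf.
  by move: (V nu a (F M) x) (G M Psi x) (Psi x) => p q r; ring.
rewrite /GLret /Wr /W; apply/funext => x.
rewrite !(Gret_G _ rK PX) !GX !GPsi.
have n01 : g0 - g1 != 0 by rewrite subr_eq0.
have n02 : g0 - g2 != 0 by rewrite subr_eq0.
have n12 : g1 - g2 != 0 by rewrite subr_eq0.
have n10 : g1 - g0 != 0 by rewrite subr_eq0 eq_sym.
have n20 : g2 - g0 != 0 by rewrite subr_eq0 eq_sym.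
have n21 : g2 - g1 != 0 by rewrite subr_eq0 eq_sym.
set l0 := ((g0 - g1) * (g0 - g2))^-1; set l1 := ((g1 - g0) * (g1 - g2))^-1.
set l2 := ((g2 - g0) * (g2 - g1))^-1.
(* For a polynomial P of degree at most 2, the weighted sum of P(g_i) is its coefficient of X^2.
   [L0] and [L1] kill the terms in Psi and f, which contain [box] phi; [L2] leaves the multiple
   [bet] of phi. *)
have L0 : l0 + l1 + l2 = 0 by rewrite /l0 /l1 /l2; field; rewrite n01 n02 n12 n10 n20 n21.
have L1 : l0 * g0 + l1 * g1 + l2 * g2 = 0.
  by rewrite /l0 /l1 /l2; field; rewrite n01 n02 n12 n10 n20 n21.
have L2 : l0 * g0 ^+ 2 + l1 * g1 ^+ 2 + l2 * g2 ^+ 2 = 1.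
  by rewrite /l0 /l1 /l2; field; rewrite n01 n02 n12 n10 n20 n21.
have EV : V nu a (qop gams Bcoef bet phi) x =
    l0 * V nu a (F g0) x + l1 * V nu a (F g1) x + l2 * V nu a (F g2) x.
  have P01 := PC_L l0 l1 (PF g0) (PF g1).
  have -> : qop gams Bcoef bet phi =
      (fun y => 1 * (l0 * F g0 y + l1 * F g1 y) + l2 * F g2 y).
    apply/funext => y; rewrite /qop sum3 /F !GPsi /Bcoef /lagr /gams /= -/l0 -/l1 -/l2.
    move: (G g0 phi y) (G g1 phi y) (G g2 phi y) (phi y) (Psi y) (f y) => p q r s t u.
    apply/eqP; rewrite -subr_eq0; apply/eqP.
    transitivity (- (bet * s * ((l0 * g0 ^+ 2 + l1 * g1 ^+ 2 + l2 * g2 ^+ 2 - 1)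
      - c * (l0 * g0 + l1 * g1 + l2 * g2)) + t * (l0 * g0 + l1 * g1 + l2 * g2)
      + u * (l0 + l1 + l2))); first by ring.
    by rewrite L0 L1 L2; ring.
  by rewrite (lV _ _ _ _ P01 (PF g2)) (lV _ _ _ _ (PF g0) (PF g1)) mul1r.
rewrite EV sum3 /Acoef /lagr /gams /= -/l0 -/l1 -/l2.
move: (V nu a (F g0) x) (V nu a (F g1) x) (V nu a (F g2) x) => v0 v1 v2.
move: (G g0 phi x) (G g1 phi x) (G g2 phi x) (phi x) (Psi x) => p q r s t.
apply/eqP; rewrite -subr_eq0; apply/eqP.
transitivity (bet * s * (n0 * (l0 * g0 + l1 * g1 + l2 * g2) - (n0 * c + kap) * (l0 + l1 + l2))
  + n0 * t * (l0 + l1 + l2)); first by ring.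
by rewrite L0 L1; ring.
Qed.

Theorem solution (eps : R) (S : pt -> R) :
  Cpc S -> supp S `<=` [set x | - eps <= tcoord x] ->
  let W := Wret m a1 a2 g0 g1 g2 c b0 b1 bt0 bt1 in
  exists phi : pt -> R,
    [/\ Cpc phi,
        (fun x => phi x + W phi x) = S,
        (forall psi : pt -> R, Cpc psi -> (fun x => psi x + W psi x) = S -> psi = phi),
        supp phi `<=` [set x | - eps <= tcoord x] &
        abs_conv_pc (fun n x => (-1) ^+ n * iter n W S x)] /\
        forall x : pt,
          (fun N : nat => \sum_(n < N) (-1) ^+ n * iter n W S x) @ \oo --> phi x.
Proof.
move=> CS suppS W0.
have [K rK [PS Kt]] := Cpc_PC CS.
have aW : Adm K Wr by exact: (W_Adm rK inu B0 aB).
have iterE n : iter n W0 S = iter n Wr S /\ PC K (iter n Wr S).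
  elim: n => [//|n [IH Pn]]; rewrite !iterS IH; split.
    by rewrite /W0 (Wret_eq rK Pn).
  by have [p _ _] := aW; exact: p.
have [pR _ _] := Rs_Adm rK inu B0 aB Acoef Bcoef bet gB.
set phi := Rs nu a gams Acoef Bcoef bet S.
have Pphi : PC K phi by exact: pR.
have phisol : (fun x => phi x + W0 phi x) = S.
  by rewrite /W0 (Wret_eq rK Pphi); exact: (Rs_solves rK inu B0 aB Acoef Bcoef bet gB PS).
exists phi; split; first split.
- exact: PC_Cpc Pphi.
- exact: phisol.
(* A competing solution may live on another support set, so both are placed on the union before the
   bounds are used. *)
- move=> psi /Cpc_PC[K' rK' [Ppsi _]] psisol.
  have rKK := Reg_setU rK rK'.
  have P1 : PC (K `|` K') psi by apply: PC_sub Ppsi; exact: subsetUr.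
  have P2 : PC (K `|` K') phi by apply: PC_sub Pphi; exact: subsetUl.
  apply: (@W_unique _ _ rKK nu a _ inu B0 aB gams Acoef Bcoef bet gB _ _ P1 P2) => x.
  rewrite -!/(Wr _) -(Wret_eq rKK P1) -(Wret_eq rKK P2).
  by have := congr1 (fun h => h x) psisol; have := congr1 (fun h => h x) phisol => /= -> ->.
- by apply: subset_trans (PC_supp rK Pphi) _; exact: Kt.
- have Pn n : PC K (fun x => (-1) ^+ n * iter n W0 S x).
    have [-> P] := iterE n; have := PC_L ((-1) ^+ n) 0 P P.
    by congr PC; apply/funext => x; rewrite mul0r addr0.
  split; first by move=> n; exact: PC_Cpc (Pn n).
  split.
    by exists K; split; [case: rK|move=> n; exact: PC_supp].
  move=> C s cC.
  have [rad _ Hrad] := @cts_bounded R pt C (fun x => `|x|) cC (@norm_continuous _ _).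
  have Ps : PC K (pmulti s S) by elim: s => //= i s; exact: PC_pd.
  have [c1 [D [c10 D0 HD]]] := iterW_gev rK inu B0 aB Acoef Bcoef bet gB rad Ps.
  exists (fun n => c1 * gev D n); split.
    exists (c1 * limn (series (gev D))) => N.
    rewrite -mulr_sumr ler_wpM2l//.
    have -> : \sum_(n < N) gev D n = series (gev D) N by rewrite /series /= big_mkord.
    apply: nondecreasing_cvgn_le; last exact: gev_cvg.
    by apply: nondecreasing_series => n _ _; exact: gev_ge0.
  move=> n x Cx.
  (* W commutes with partials, so a derivative seminorm of the n-th term is a sup bound for the n-th
     term with the differentiated datum. *)
  have Es : dmulti s (fun x => (-1) ^+ n * iter n W0 S x) =
      (fun x => (-1) ^+ n * iter n Wr (pmulti s S) x + 0 * iter n Wr (pmulti s S) x).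
    rewrite pmultiE; have [-> P] := iterE n.
    have sP := PC_smooth P.
    have -> : (fun x => (-1) ^+ n * iter n Wr S x) = (fun x => (-1) ^+ n * iter n Wr S x + 0 * iter n Wr S x).
      by apply/funext => y; rewrite mul0r addr0.
    rewrite (pmultiL _ _ _ sP sP).
    have -> : pmulti s (iter n Wr S) = iter n Wr (pmulti s S).
      have [_ d _] := Adm_iter n aW.
      elim: s {Ps HD} => //= i s ->; apply: d.
      by elim: s => //= j s; exact: PC_pd.
    by [].
  rewrite Es mul0r addr0 sign_norm.
  apply: (HD n [::]) => //.
  by have := Hrad x Cx; rewrite normr_id.
- move=> x.
  have H : (fun N => SN nu a gams Acoef Bcoef bet N S x) @ \oo --> phi x.
    exact: (Rs_cvg rK inu B0 aB gB PS).
  have -> // : (fun N : nat => \sum_(n < N) (-1) ^+ n * iter n W0 S x) =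
    (fun N => SN nu a gams Acoef Bcoef bet N S x).
  apply/funext => N; rewrite /SN; apply: eq_bigr => n _; by have [-> _] := iterE n.
Qed.

End Reduction.

(** * Integrability of the weight *)

Section PrimitiveIntegrable.
Context {R : realType}.
Notation mu := (@lebesgue_measure R).
Implicit Types (f F : R -> R) (D : set R).

Lemma measurable_inv_fun : measurable_fun setT (fun x : R => x^-1).
Proof.
have m0 : measurable [set x : R | x != 0].
  by apply: open_measurable; exact: open_neq.
have -> : [set: R] = [set x : R | x != 0] `|` [set 0].
  by apply/seteqP; split=> // x _; case: (eqVneq x 0) => [->|]; [right|left].
apply/measurable_funU => //; split.
  apply: open_continuous_measurable_fun; first exact: open_neq.
  by move=> x; rewrite inE/= => x0; exact: inv_continuous.
exact: measurable_fun_set1.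
Qed.

Lemma measurable_funV d (T : measurableType d) (D : set T) (f : T -> R) :
  measurable_fun D f -> measurable_fun D (fun x => (f x)^-1).
Proof. by move=> mf; exact: (measurableT_comp measurable_inv_fun mf). Qed.

Lemma primitive_integral f F (u v : R) : u < v ->
  (forall x, u <= x <= v -> is_derive x 1 F (f x)) ->
  (forall x, u <= x <= v -> {for x, continuous f}) ->
  (\int[mu]_(x in `[u, v]) (f x)%:E = (F v)%:E - (F u)%:E)%E.
Proof.
move=> uv dF cf.
have cF x : u <= x <= v -> {for x, continuous F}.
  move=> /dF d; apply/differentiable_continuous/derivable1_diffP.
  by case: d.
have uu : u <= u <= v by rewrite lexx ltW.
have vv : u <= v <= v by rewrite lexx ltW.
apply: (@continuous_FTC2 _ f F) => //.
- apply: continuous_in_subspaceT => x; rewrite inE/= in_itv/=; exact: cf.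
- split.
  + by move=> x; rewrite in_itv/= => /andP[ux xv]; case: (dF x _); rewrite ?ltW.
  + exact/cvg_at_right_filter/cF.
  + exact/cvg_at_left_filter/cF.
- move=> x; rewrite in_itv/= => /andP[ux xv].
  rewrite derive1E; case: (dF x _) => [|_ <-//].
  by rewrite !ltW.
Qed.

(** On each exhausting segment the integral is F(v) - F(u) <= 2 B, and monotone convergence passes
    to D. The three model singularities below differ only in their bounded primitive. *)
Lemma primitive_integrable f F D (u v : nat -> R) (B : R) :
  (forall n, u n < v n) -> D = \bigcup_n `[u n, v n]%classic ->
  (forall n, u n.+1 <= u n) -> (forall n, v n <= v n.+1) -> open D ->
  (forall x, D x -> is_derive x 1 F (f x)) ->
  (forall x, D x -> {for x, continuous f}) ->
  (forall x, D x -> 0 <= f x) -> (forall x, D x -> `|F x| <= B) ->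
  mu.-integrable D (EFin \o f) /\ (\int[mu]_(x in D) f x <= 2 * B)%R.
Proof.
move=> uv DE du dv oD dF cf f0 FB.
have sub n x : u n <= x <= v n -> D x.
  by move=> xuv; rewrite DE; exists n => //=; rewrite in_itv.
have mf : measurable_fun D (EFin \o f).
  apply/measurable_EFinP; apply: open_continuous_measurable_fun => //.
  by move=> x; rewrite inE => /cf.
suff H : (\int[mu]_(x in D) `|(EFin \o f) x| <= (2 * B)%:E)%E.
  have intf : mu.-integrable D (EFin \o f).
    by apply/integrableP; split => //; apply: le_lt_trans H _; exact: ltry.
  split=> //.
  rewrite -lee_fin /Rintegral fineK; last first.
    by apply: integrable_fin_num => //; exact: open_measurable.
  apply: le_trans H; apply: le_integral => //.
  - exact: open_measurable.
  - exact: integrable_abse.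
  - by move=> x _; rewrite lee_abs.
have nd : nondecreasing_seq (fun n => `[u n, v n]%classic : set R).
  apply/nondecreasing_seqP => n; apply/subsetPset => x /=.
  rewrite !in_itv/= => /andP[ux xv].
  by rewrite (le_trans (du n) ux) (le_trans xv (dv n)).
have f0' n x : `[u n, v n]%classic x -> (0 <= (EFin \o f) x)%E.
  by rewrite /= in_itv lee_fin => /sub/f0.
have -> : (\int[mu]_(x in D) `|(EFin \o f) x| = \int[mu]_(x in \bigcup_n `[u n, v n]%classic) (EFin \o f) x)%E.
  by rewrite -DE; apply: eq_integral => x; rewrite inE => /f0 ?; rewrite gee0_abs ?lee_fin.
have mf' n : measurable_fun `[u n, v n]%classic (EFin \o f).
  apply: measurable_funS mf; first exact: open_measurable.
  by move=> x /=; rewrite in_itv; exact: sub.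
have cv := @ge0_nondecreasing_set_cvg_integral _ (measurableTypeR R) R _ _ mu nd (fun=> measurable_itv _) mf' f0'.
have <- := cvg_lim _ cv => //.
apply: lime_le.
  by apply/cvg_ex; eexists; exact: cv.
apply: nearW => n.
have un : u n <= u n <= v n by rewrite lexx ltW.
have vn : u n <= v n <= v n by rewrite lexx ltW.
have -> := @primitive_integral f F _ _ (uv n) (fun x h => dF x (sub n x h)) (fun x h => cf x (sub n x h)).
rewrite -EFinB lee_fin.
have := FB _ (sub _ _ un); have := FB _ (sub _ _ vn).
rewrite !ler_norml; lra.
Qed.


Lemma archi_lt (x : R) : exists n : nat, x < n%:R.
Proof.
exists (Num.truncn `|x|).+1; apply: le_lt_trans (ler_norm x) _.
by apply: truncnS_gt; rewrite ?num_real.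
Qed.

Lemma archi_inv_lt (x : R) : 0 < x -> exists n : nat, n.+1%:R^-1 < x.
Proof.
move=> x0; have [n nx] := archi_lt x^-1; exists n.
rewrite -[x]invrK ltf_pV2 ?posrE ?invr_gt0//.
by apply: lt_trans nx _; rewrite ltr_nat.
Qed.

Lemma bigcup_ray (b : R) :
  `]b, +oo[%classic = \bigcup_n `[b + n.+1%:R^-1, b + n.+2%:R]%classic.
Proof.
apply/seteqP; split=> x /=; rewrite ?in_itv/= ?andbT.
- move=> bx; have xb : 0 < x - b by lra.
  have [n nx] := archi_inv_lt xb; have [k kx] := archi_lt (x - b).
  exists (maxn n k) => //=; rewrite in_itv/=; apply/andP; split.
    rewrite -lerBrDl; apply: le_trans (ltW nx).
    by rewrite lef_pV2 ?posrE// ler_nat ltnS leq_maxl.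
  rewrite -lerBlDl; apply: le_trans (ltW kx) _.
  by rewrite ler_nat; apply: leq_trans (leq_maxr n k) _; exact: leqW.
- move=> [n _ /=]; rewrite in_itv/= => /andP[+ _].
  by apply: lt_le_trans; rewrite ltrDl invr_gt0.
Qed.

Lemma primitive_integrable_ray f F (b B : R) :
  (forall x, b < x -> is_derive x 1 F (f x)) ->
  (forall x, b < x -> {for x, continuous f}) ->
  (forall x, b < x -> 0 <= f x) -> (forall x, b < x -> `|F x| <= B) ->
  mu.-integrable `]b, +oo[ (EFin \o f) /\ (\int[mu]_(x in `]b, +oo[) f x <= 2 * B)%R.
Proof.
move=> dF cf f0 FB.
apply: (@primitive_integrable f F _ (fun n => b + n.+1%:R^-1) (fun n => b + n.+2%:R)) => //.
- move=> n; rewrite ltrD2l (@le_lt_trans _ _ 1)// ?invf_le1 ?ler1n ?ltr1n//.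
- exact: bigcup_ray.
- by move=> n; rewrite lerD2l lef_pV2 ?posrE// ler_nat.
- by move=> n; rewrite lerD2l ler_nat.
- by move=> x /=; rewrite in_itv/= andbT; exact: dF.
- by move=> x /=; rewrite in_itv/= andbT; exact: cf.
- by move=> x /=; rewrite in_itv/= andbT; exact: f0.
- by move=> x /=; rewrite in_itv/= andbT; exact: FB.
Qed.

Lemma inv_sqr_integrable (b : R) : 0 < b ->
  mu.-integrable (from b) (EFin \o (fun M => (M ^+ 2)^-1)) /\
  (\int[mu]_(M in from b) (M ^+ 2)^-1 <= 4 / b)%R.
Proof.
move=> b0.
have pos x : b / 2 < x -> 0 < x by lra.
(* The ray is open, so it starts at b / 2 in order to contain b; this doubles the constant. *)
have [] := @primitive_integrable_ray (fun M => (M ^+ 2)^-1) (fun M => - M^-1) (b / 2) (2 / b).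
- move=> x /pos x0.
  have : is_derive x 1 (fun M : R => - M^-1) (- (- x ^- 2 *: 1)).
    by apply: is_deriveN; apply: is_deriveV; rewrite gt_eqF.
  by congr is_derive; rewrite /GRing.scale/= mulr1 opprK.
- move=> x /pos x0; apply: cvgV; first by rewrite expf_neq0// gt_eqF.
  exact: exprn_continuous.
- by move=> x _; rewrite invr_ge0 sqr_ge0.
- move=> x bx; have x0 := pos _ bx.
  rewrite normrN ger0_norm ?invr_ge0 ?(ltW x0)//.
  have -> : 2 / b = (b / 2)^-1 by rewrite invf_div.
  by rewrite lef_pV2 ?posrE ?divr_gt0// ltW.
move=> i h.
have sub : from b `<=` `]b / 2, +oo[%classic.
  by move=> x; rewrite /from /= in_itv/= andbT; lra.
have mb := measurable_from b.
split; first exact: integrableS i.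
apply: le_trans (_ : 2 * (2 / b) <= _); last by lra.
apply: le_trans h.
apply: fine_le.
- by apply: integrable_fin_num => //; exact: integrableS i.
- exact: integrable_fin_num.
- apply: ge0_subset_integral => //.
  + by case/integrableP: i.
  + by move=> x _; rewrite lee_fin invr_ge0 sqr_ge0.
Qed.

Lemma inv_ln_sqr_integrable (k : R) : 0 < k ->
  mu.-integrable `]k * expR 1, +oo[ (EFin \o (fun M => (M * ln (M / k) ^+ 2)^-1)).
Proof.
move=> k0.
have e0 : 0 < k * expR 1 :> R by rewrite mulr_gt0 ?expR_gt0.
have ln1 x : k * expR 1 < x -> 1 < ln (x / k).
  move=> kx; have x0 := lt_trans e0 kx.
  by rewrite -[1]expRK ltr_ln ?posrE ?expR_gt0 ?divr_gt0// ltr_pdivlMr// mulrC.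
have dln x : k * expR 1 < x -> is_derive x 1 (fun M => ln (M / k)) x^-1.
  move=> kx; have x0 := lt_trans e0 kx.
  have d1 : is_derive (x : R) 1 (fun M : R => M / k) k^-1.
    have : is_derive (x : R) 1 (fun M : R => k^-1 *: M) (k^-1 *: 1).
      by apply: is_deriveZ.
    rewrite [X in is_derive _ _ _ X]mulr1; congr is_derive.
    by apply/funext => y; rewrite /GRing.scale/= mulrC.
  have d2 : is_derive (x / k) 1 (@ln R) (x / k)^-1 by apply: is_derive1_ln; rewrite divr_gt0.
  have := @is_derive1_comp R (@ln R) (fun M => M / k) x _ _ d2 d1.
  rewrite /comp; congr is_derive.
  by rewrite invf_div mulrAC divff ?mul1r// gt_eqF.
have [] // := @primitive_integrable_ray (fun M => (M * ln (M / k) ^+ 2)^-1) (fun M => - (ln (M / k))^-1) (k * expR 1) 1.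
- move=> x kx; have l1 := ln1 _ kx; have x0 := lt_trans e0 kx.
  have l0 : ln (x / k) != 0 by rewrite gt_eqF// (lt_trans _ l1).
  have := is_deriveN (@is_deriveV R (fun M => ln (M / k)) x _ _ l0 (dln _ kx)).
  congr is_derive; rewrite /GRing.scale/= mulNr opprK invfM mulrC.
  by rewrite -invfM -expr2 -invfM.
- move=> x kx; have l1 := ln1 _ kx; have x0 := lt_trans e0 kx.
  have l0 : ln (x / k) != 0 by rewrite gt_eqF// (lt_trans _ l1).
  have cl : {for x, continuous (fun M : R => ln (M / k))}.
    by apply/differentiable_continuous/derivable1_diffP; case: (dln _ kx).
  apply: cvgV; first by rewrite mulf_neq0 ?expf_neq0// gt_eqF.
  by apply: cvgM; [exact: cvg_id|apply: cvgM; exact: cl].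
- move=> x kx; have x0 := lt_trans e0 kx.
  by rewrite invr_ge0 mulr_ge0 ?sqr_ge0// ltW.
- move=> x /ln1 l1; rewrite normrN ger0_norm ?invr_ge0 ?invf_le1; lra.
Qed.

Lemma inv_sqrt_integrable (a b : R) : a < b ->
  mu.-integrable `]a, b[ (EFin \o (fun M => (Num.sqrt (M - a))^-1)).
Proof.
move=> ab.
(* The offset 3 keeps twice the margin below b - a, so the segments are nondegenerate from n = 0
   on. *)
pose e n := (b - a) / n.+3%:R.
have e0 n : 0 < e n by rewrite divr_gt0 ?subr_gt0.
have eS n : e n.+1 <= e n.
  by rewrite ler_wpM2l ?subr_ge0 ?(ltW ab)// lef_pV2 ?posrE// ler_nat.
have e3 n : e n * 2 < b - a.
  rewrite mulrAC ltr_pdivrMr// ltr_pM2l ?subr_gt0//.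
  by rewrite (ltr_nat _ 2).
have elim x : 0 < x -> exists n, e n < x.
  move=> x0; have ba : 0 < b - a by lra.
  have [n nx] := archi_inv_lt (divr_gt0 x0 ba).
  exists n; rewrite /e mulrC -ltr_pdivlMr//; apply: le_lt_trans nx.
  by rewrite lef_pV2 ?posrE// ler_nat -addn2 leq_addr.
have ds x : a < x -> is_derive x 1 (fun M => 2 * Num.sqrt (M - a)) (Num.sqrt (x - a))^-1.
  move=> ax; have xa : 0 < x - a by lra.
  have d1 : is_derive (x : R) 1 (fun M : R => M - a) 1.
    have : is_derive (x : R) 1 (fun M : R => M - a) (1 - 0) by apply: is_deriveB.
    by rewrite subr0.
  have := @is_derive1_comp R (@Num.sqrt R) (fun M => M - a) x _ _ (is_derive1_sqrt xa) d1.
  move=> /(is_deriveZ 2); congr is_derive.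
  rewrite /GRing.scale/= mulr1 invfM mulrA divff ?mul1r//.
apply: (proj1 (@primitive_integrable _ (fun M => 2 * Num.sqrt (M - a)) _ (fun n => a + e n) (fun n => b - e n) (2 * Num.sqrt (b - a)) _ _ _ _ _ _ _ _ _)).
- by move=> n; have := e3 n; lra.
- apply/seteqP; split=> x /=; rewrite ?in_itv/=.
    move=> /andP[ax xb].
    have [n nx] : exists n, e n < Num.min (x - a) (b - x).
      by apply: elim; rewrite lt_min !subr_gt0 ax.
    exists n => //=; rewrite in_itv/=; move: nx; rewrite lt_min => /andP[].
    by move: (e n) => u u1 u2; apply/andP; split; lra.
  move=> [n _ /=]; rewrite in_itv/= => /andP[ax xb].
  by have := e0 n; move: (e n) ax xb => u u1 u2 u3; apply/andP; split; lra.
- by move=> n; have := eS n; lra.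
- by move=> n; have := eS n; lra.
- exact: itv_open.
- by move=> x /=; rewrite in_itv/= => /andP[/ds].
- move=> x /=; rewrite in_itv/= => /andP[ax _].
  apply: cvgV; first by rewrite sqrtr_eq0 -ltNge subr_gt0.
  apply: (@continuous_comp _ _ _ (fun M => M - a) (@Num.sqrt R)).
    by apply: cvgB; [exact: cvg_id|exact: cvg_cst].
  exact: sqrt_continuous.
- by move=> x _; rewrite invr_ge0 sqrtr_ge0.
- move=> x /=; rewrite in_itv/= => /andP[ax xb].
  rewrite ger0_norm ?mulr_ge0 ?sqrtr_ge0// ler_pM2l// ler_sqrt; lra.
Qed.

End PrimitiveIntegrable.

(** * Principal values: existence, measurability, and logarithmic decay *)

Section PrincipalValue.
Context {R : realType}.
Notation mu := (@lebesgue_measure R).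
Variables (s : R -> R) (a C c1 : R).
Hypotheses (a0 : 0 < a) (C0 : 0 <= C) (c10 : 0 < c1).
Hypothesis ms : measurable_fun setT s.
Hypothesis s_ge0 : forall M, a <= M -> 0 <= s M.
Hypothesis s_le : forall M, a <= M -> s M <= C / M.
Hypothesis s_ge : forall M, a <= M -> c1 / M * Num.sqrt (1 - a / M) <= s M.
Hypothesis s_lip : forall b, a < b -> exists2 L, 0 <= L &
  forall M N, b <= M -> b <= N -> `|s N - s M| <= L * `|N - M| / (N * M).

Definition trunc (z d : R) : set R := from a `\` `]z - d, z + d[%classic.
Definition ptrunc (z d : R) : R := (\int[mu]_(M in trunc z d) (s M / (M - z)))%R.
Definition pvt (z : R) : R := lim (ptrunc z d @[d --> 0^'+]).

Lemma truncE z d M : trunc z d M = (a <= M /\ d <= `|M - z|).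
Proof.
rewrite /trunc/from/= in_itv/=; apply/propext; split=> -[aM H]; split=> //.
  by rewrite leNgt ltr_norml; apply/negP => ?; apply: H; lra.
by apply/negP; move: H; rewrite leNgt ltr_norml; apply: contra => ?; lra.
Qed.

Lemma measurable_trunc z d : measurable (trunc z d : set (measurableTypeR R)).
Proof. by apply: measurableD; [exact: measurable_from|exact: measurable_itv]. Qed.

Lemma measurable_quot z : measurable_fun setT (fun M => s M / (M - z)).
Proof.
apply: measurable_funM => //; apply: measurable_funV.
by apply: measurable_funB => //; exact: measurable_cst.
Qed.

(** Away from z the integrand is O(M^-2): for M <= 2 z use |M - z| >= d, for larger M use |M - z| >=
    M / 2; the two cases give the summands 2 z / d and 2. *)
Lemma quot_bound (z d M : R) : a < z -> 0 < d -> a <= M -> d <= `|M - z| ->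
  `|s M / (M - z)| <= (C * (2 * z / d + 2)) * (M ^+ 2)^-1.
Proof.
have A0 : 0 < a := a0; move=> az d0 aM dM.
have M0 : 0 < M by exact: lt_le_trans a0 aM.
have K0 : 0 <= 2 * (z / d) by rewrite mulr_ge0 ?divr_ge0; lra.
have Mz0 : 0 < `|M - z| by lra.
rewrite normrM normfV ger0_norm ?s_ge0//.
rewrite ler_pdivrMr//; apply: (le_trans (s_le aM)).
rewrite -!mulrA; apply: ler_wpM2l => //.
have -> : M^-1 = (M ^+ 2)^-1 * M by rewrite expr2 invfM mulfVK// gt_eqF.
rewrite mulrCA; apply: ler_wpM2l; first by rewrite invr_ge0 sqr_ge0.
have zd : z / d * d = z by rewrite divfK// gt_eqF.
have zd0 : 0 <= z / d by lra.
move: (z / d) zd zd0 {K0} => k kd k0.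
have [M2|M2] := leP M (2 * z).
  have : k * d <= k * `|M - z| by apply: ler_wpM2l.
  move: (`|M - z|) Mz0 dM => w w0 dw; nra.
have : M <= 2 * `|M - z| by rewrite ger0_norm; lra.
by move: (`|M - z|) Mz0 dM => w w0 dw; nra.
Qed.

Lemma ptrunc_integrable (z d : R) : a < z -> 0 < d ->
  mu.-integrable (trunc z d) (EFin \o (fun M => s M / (M - z))).
Proof.
move=> az d0.
have mT := measurable_trunc z d.
have [i _] := inv_sqr_integrable a0.
have iT : mu.-integrable (trunc z d) (EFin \o (fun M => (M ^+ 2)^-1)).
  by apply: integrableS i => //; [exact: measurable_from|move=> M; rewrite truncE => -[]].
have := integrableZl mT (C * (2 * z / d + 2)) iT.
apply: le_integrable => //.
  by apply/measurable_EFinP; apply: measurable_funTS; exact: measurable_quot.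
move=> M; rewrite truncE => -[aM dM].
rewrite /comp -EFinM !abse_EFin lee_fin.
by apply: le_trans (quot_bound az d0 aM dM) _; exact: ler_norm.
Qed.

Lemma inv_symmetric_integral (z d e : R) : 0 < d -> d < e ->
  (\int[mu]_(M in `[z - e, z - d]) (M - z)^-1 +
   \int[mu]_(M in `[z + d, z + e]) (M - z)^-1 = 0)%R.
Proof.
move=> d0 de.
have dB (x : R) : is_derive x 1 (fun M : R => M - z) 1.
  have : is_derive x 1 (fun M : R => M - z) (1 - 0) by apply: is_deriveB.
  by rewrite subr0.
have cI (x : R) : x != z -> {for x, continuous (fun M : R => (M - z)^-1)}.
  move=> xz; apply: cvgV; first by rewrite subr_eq0.
  by apply: cvgB; [exact: cvg_id|exact: cvg_cst].
have dl (x : R) : x - z < 0 -> is_derive x 1 (fun M : R => ln (z - M)) (x - z)^-1.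
  move=> xz; have zx : 0 < z - x by lra.
  have d1 : is_derive x 1 (fun M : R => z - M) (-1).
    have : is_derive x 1 (fun M : R => z - M) (0 - 1) by apply: is_deriveB.
    by rewrite sub0r.
  have := @is_derive1_comp R (@ln R) (fun M => z - M) x _ _ (is_derive1_ln zx) d1.
  by congr is_derive; rewrite mulrN1 -invrN opprB.
have dr (x : R) : 0 < x - z -> is_derive x 1 (fun M : R => ln (M - z)) (x - z)^-1.
  move=> xz.
  have := @is_derive1_comp R (@ln R) (fun M => M - z) x _ _ (is_derive1_ln xz) (dB x).
  by rewrite mulr1.
have E1 : (\int[mu]_(x in `[(z - e)%R, (z - d)%R]) ((x - z)^-1)%R%:E = (ln (z - (z - d)))%R%:E - (ln (z - (z - e)))%R%:E)%E.
  apply: (@primitive_integral _ _ (fun M => ln (z - M))) => [|x /andP[_ xz]|x /andP[_ xz]].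
  - lra.
  - by apply: dl; lra.
  - by apply: cI; apply/eqP; lra.
have E2 : (\int[mu]_(x in `[(z + d)%R, (z + e)%R]) ((x - z)^-1)%R%:E = (ln (z + e - z))%R%:E - (ln (z + d - z))%R%:E)%E.
  apply: (@primitive_integral _ _ (fun M => ln (M - z))) => [|x /andP[xz _]|x /andP[xz _]].
  - lra.
  - by apply: dr; lra.
  - by apply: cI; apply/eqP; lra.
rewrite /Rintegral E1 E2 /=.
have -> : z - (z - d) = d by ring.
have -> : z - (z - e) = e by ring.
have -> : z + d - z = d by ring.
have -> : z + e - z = e by ring.
by ring.
Qed.

Lemma segment_bound (z u v B : R) : u <= v -> (forall M, u <= M <= v -> M != z) ->
  mu.-integrable `[u, v] (EFin \o (fun M => s M / (M - z))) ->
  (forall M, u <= M <= v -> `|s M - s z| <= B * `|M - z|) ->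
  `|(\int[mu]_(M in `[u, v]) (s M / (M - z)) -
     s z * \int[mu]_(M in `[u, v]) (M - z)^-1)%R| <= B * (v - u).
Proof.
move=> uv zuv is_ sB.
have mI : measurable (`[u, v]%classic : set (measurableTypeR R)) by exact: measurable_itv.
have ii : mu.-integrable `[u, v] (EFin \o (fun M => (M - z)^-1)).
  apply: continuous_compact_integrable; first exact: segment_compact.
  apply: continuous_in_subspaceT => x; rewrite inE/= in_itv/= => xuv.
  apply: cvgV; first by rewrite subr_eq0; exact: zuv.
  by apply: cvgB; [exact: cvg_id|exact: cvg_cst].
have iz : mu.-integrable `[u, v] (EFin \o (fun M => s z * (M - z)^-1)).
  by have := integrableZl mI (s z) ii; apply: eq_integrable.
rewrite -RintegralZl// -RintegralB//.
have id_ : mu.-integrable `[u, v] (EFin \o (fun M => s M / (M - z) - s z * (M - z)^-1)).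
  by have := integrableB mI is_ iz; apply: eq_integrable.
apply: (le_trans (le_normr_Rintegral mI id_)).
have -> : B * (v - u) = (\int[mu]_(M in `[u, v]) B)%R.
  rewrite Rintegral_cst//= lebesgue_measure_itv/= lte_fin; case: ltP => //= vu; have -> : v = u by apply: le_anti; rewrite uv vu.
  by rewrite subrr.
apply: le_Rintegral => //.
- by have := integrable_abse id_; apply: eq_integrable.
- apply: continuous_compact_integrable; first exact: segment_compact.
  by apply: continuous_subspaceT => x; exact: cvg_cst.
- move=> M; rewrite /= in_itv/= => Muv.
  have Mz : M - z != 0 by rewrite subr_eq0; exact: zuv.
  rewrite -mulrBl normrM normfV ler_pdivrMr ?normr_gt0//; exact: sB.
Qed.

(** The constant part s z integrates to 0 by oddness around z, and the quotient of the rest is at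
    most B on a set of length 2 (e - d). This is the Cauchy estimate behind the principal value. *)
Lemma ptrunc_increment (z d e B : R) : a < z - e -> 0 < d -> d < e ->
  (forall M, z - e <= M <= z + e -> `|s M - s z| <= B * `|M - z|) ->
  `|ptrunc z d - ptrunc z e| <= 2 * (e - d) * B.
Proof.
move=> aze d0 de sB.
have az : a < z by lra.
have iT := ptrunc_integrable az d0.
have mT e' := measurable_trunc z e'.
pose l := `]z - e, z - d]%classic : set R.
pose r := `[z + d, z + e[%classic : set R.
have ml : measurable (l : set (measurableTypeR R)) by exact: measurable_itv.
have mr : measurable (r : set (measurableTypeR R)) by exact: measurable_itv.
have E M : trunc z d M <-> (trunc z e `|` (l `|` r)) M.
  rewrite /setU /l /r /mkset !truncE /= !in_itv/=; split.
    move=> [aM dM].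
    have [eM|eM] := leP e `|M - z|; [by left|right].
    move: eM dM; rewrite ltr_norml ler_normr => /andP[? ?] /orP[?|?]; [right|left]; lra.
  case=> [[aM eM]|[/andP[? ?]|/andP[? ?]]]; split; try lra.
  - by rewrite ler_normr; apply/orP; right; lra.
  - by rewrite ler_normr; apply/orP; left; lra.
have ET : trunc z d = trunc z e `|` (l `|` r) by apply/seteqP; split=> M /E.
have sub A : measurable (A : set (measurableTypeR R)) -> A `<=` trunc z d ->
    mu.-integrable A (EFin \o (fun M => s M / (M - z))).
  by move=> mA AT; apply: integrableS iT.
have cl : `[z - e, z - d]%classic `<=` trunc z d.
  move=> M; rewrite /= in_itv/= truncE => /andP[? ?]; split; first lra.
  by rewrite ler_normr; apply/orP; right; lra.
have cr : `[z + d, z + e]%classic `<=` trunc z d.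
  move=> M; rewrite /= in_itv/= truncE => /andP[? ?]; split; first lra.
  by rewrite ler_normr; apply/orP; left; lra.
have il := sub _ (measurable_itv _) cl; have ir := sub _ (measurable_itv _) cr.
have -> : ptrunc z d - ptrunc z e =
    (\int[mu]_(M in `[z - e, z - d]) (s M / (M - z)) +
     \int[mu]_(M in `[z + d, z + e]) (s M / (M - z)))%R.
  rewrite /ptrunc ET Rintegral_setU//; last 3 first.
  - exact: measurableU.
  - by rewrite -ET.
  - apply/disj_setPS => M [/=]; rewrite truncE /l /r /= !in_itv/= => -[_].
    by rewrite ler_normr => /orP[?|?] [|] /andP[? ?]; lra.
  rewrite addrC addKr Rintegral_setU//; last 2 first.
  - apply: sub; first exact: measurableU.
    by move=> M lr; apply/E; right.
  - by apply/disj_setPS => M [/=]; rewrite /l /r /= !in_itv/= => /andP[? ?] /andP[? ?]; lra.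
  rewrite Rintegral_itv_obnd_cbnd ?Rintegral_itv_bndo_bndc//.
  - by apply: integrableS ir => // M; rewrite /= !in_itv/= => /andP[? ?]; apply/andP; split; lra.
  - by apply: integrableS il => // M; rewrite /= !in_itv/= => /andP[? ?]; apply/andP; split; lra.
have lb : z - e <= z - d by lra.
have rb : z + d <= z + e by lra.
have b1 := @segment_bound z (z - e) (z - d) B lb _ il _.
have b2 := @segment_bound z (z + d) (z + e) B rb _ ir _.
have {}b1 : `|(\int[mu]_(M in `[(z - e), (z - d)]) (s M / (M - z)) -
      s z * \int[mu]_(M in `[(z - e), (z - d)]) (M - z)^-1)%R| <= B * (e - d).
  have -> : e - d = z - d - (z - e) by ring.
  apply: b1 => M /andP[? ?]; first by apply/eqP; lra.
  by apply: sB; apply/andP; split; lra.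
have {}b2 : `|(\int[mu]_(M in `[(z + d), (z + e)]) (s M / (M - z)) -
      s z * \int[mu]_(M in `[(z + d), (z + e)]) (M - z)^-1)%R| <= B * (e - d).
  have -> : e - d = z + e - (z + d) by ring.
  apply: b2 => M /andP[? ?]; first by apply/eqP; lra.
  by apply: sB; apply/andP; split; lra.
have := inv_symmetric_integral z d0 de.
move: b1 b2; move: (Rintegral _ _ _) (Rintegral _ _ _) (Rintegral _ _ _) (Rintegral _ _ _) => p q p' q' + + pq.
have -> : p' = - p by lra.
rewrite mulrN; move: (s z * p) => w.
rewrite !ler_norml => /andP[? ?] /andP[? ?]; apply/andP; split; lra.
Qed.

Lemma lip_center (b z e : R) : a < b -> b <= z - e -> 0 <= e -> exists2 B, 0 <= B &
  forall M, z - e <= M <= z + e -> `|s M - s z| <= B * `|M - z|.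
Proof.
move=> ab bz e0; have [L L0 HL] := s_lip ab; have A0 : 0 < a := a0.
have b0 : 0 < b by lra.
exists (L / (b * z)); first by rewrite divr_ge0// mulr_ge0; lra.
move=> M /andP[Ml Mr]; have zb : b <= z by lra.
have bM : b <= M by lra.
apply: le_trans (HL z M zb bM) _.
rewrite mulrAC; apply: ler_wpM2r => //; apply: ler_wpM2l => //.
rewrite lef_pV2 ?posrE ?mulr_gt0; try lra.
by apply: ler_wpM2r; lra.
Qed.

Lemma near0_right (r : R) (P : R -> Prop) : 0 < r ->
  (forall d, 0 < d -> d < r -> P d) -> \forall d \near 0^'+, P d.
Proof.
move=> r0 H; near=> d; apply: H; first by near: d; exact: nbhs_right_gt.
by near: d; exact: nbhs_right_lt.
Unshelve. all: by end_near. Qed.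

Lemma ptrunc_cvg (z : R) : a < z -> ptrunc z d @[d --> 0^'+] --> pvt z.
Proof.
move=> az.
have e0 : 0 < (z - a) / 2 by lra.
have [B B0 HB] := @lip_center ((z + a) / 2) z ((z - a) / 2) ltac:(lra) ltac:(lra) (ltW e0).
suff : cvg (ptrunc z d @[d --> 0^'+]) by [].
apply: cauchy_cvg; apply: cauchy_exP => eps eps0.
pose e := Num.min ((z - a) / 2) (eps / (2 * (B + 1))).
have ee0 : 0 < e by rewrite lt_min e0 divr_gt0 ?mulr_gt0//; lra.
have e1 : e <= (z - a) / 2 by rewrite ge_min lexx.
have e2 : e <= eps / (2 * (B + 1)) by rewrite ge_min lexx orbT.
exists (ptrunc z e).
apply: (near0_right ee0) => d d0 de; rewrite /ball/= distrC.
have := @ptrunc_increment z d e B ltac:(lra) d0 de _.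
move=> H; apply: le_lt_trans (H _) _.
  by move=> M /andP[? ?]; apply: HB; apply/andP; split; lra.
move: e2; rewrite ler_pdivlMr; last by lra.
nra.
Qed.

Lemma pvt_ptrunc (z e B : R) : a < z - e -> 0 < e ->
  (forall M, z - e <= M <= z + e -> `|s M - s z| <= B * `|M - z|) -> 0 <= B ->
  `|pvt z - ptrunc z e| <= 2 * e * B.
Proof.
move=> aze e0 sB B0.
have cv : `|ptrunc z d - ptrunc z e| @[d --> 0^'+] --> `|pvt z - ptrunc z e|.
  apply: cvg_norm; apply: cvgB; last exact: cvg_cst.
  by apply: ptrunc_cvg; lra.
rewrite -(cvg_lim _ cv)//; apply: limr_le.
  by apply/cvg_ex; eexists; exact: cv.
apply: (near0_right e0) => d d0 de.
apply: (le_trans (ptrunc_increment aze d0 de sB)); nra.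
Qed.

(** The truncated integrand is jointly measurable in z and M; Tonelli applies to its positive and
    negative parts separately. *)
Lemma measurable_ptrunc (d : R) : measurable_fun setT (fun z : measurableTypeR R => ptrunc z d).
Proof.
pose T := measurableTypeR R.
pose h (p : T * T) : \bar R := (if (a <= p.2) && (d <= `|p.2 - p.1|) then s p.2 / (p.2 - p.1) else 0)%:E.
have mh : measurable_fun setT h.
  apply/measurable_EFinP.
  have m2 : measurable_fun setT (fun p : T * T => (p.2 : R)) by exact: measurable_snd.
  have m1 : measurable_fun setT (fun p : T * T => (p.1 : R)) by exact: measurable_fst.
  have mB : measurable_fun setT (fun p : T * T => (p.2 : R) - p.1) by exact: measurable_funB.
  apply: measurable_fun_ifT.
  - apply: measurable_and; apply: measurable_fun_ler => //; try exact: measurable_cst.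
    by apply: measurableT_comp mB.
  - by apply: measurable_funM; [exact: (measurableT_comp ms m2)|exact: measurable_funV].
  - exact: measurable_cst.
have hE z M : ((fun M : R => (s M / (M - z))%:E) \_ (trunc z d)) M = h (z, M).
  rewrite /patch /h /=; case: ifPn => [|].
    by rewrite inE truncE => -[-> ->].
  rewrite notin_setE truncE => H; case: ifPn => // /andP[? ?]; by case: H.
have -> : (fun z : T => ptrunc z d) =
    fun z => fine (fubini_F mu (h^\+)%E z - fubini_F mu (h^\-)%E z).
  apply/funext => z; rewrite /ptrunc /Rintegral integral_mkcond.
  congr fine; rewrite integralE /fubini_F.
  by congr (_ - _)%E; apply: eq_integral => M _; rewrite ?funeposE ?funenegE hE.
apply: measurableT_comp; first exact: fine_measurable.
apply: emeasurable_funB.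
- by apply: measurable_fun_fubini_tonelli_F => //; exact: measurable_funepos.
- by apply: measurable_fun_fubini_tonelli_F => //; exact: measurable_funeneg.
Qed.

Lemma measurable_pvt : measurable_fun `]a, +oo[ pvt.
Proof.
apply: (@measurable_fun_cvg _ _ _ _ (fun n z => ptrunc z n.+1%:R^-1)).
  by move=> n; apply: measurable_funTS; exact: measurable_ptrunc.
move=> z; rewrite /= in_itv/= andbT => /ptrunc_cvg cz.
have /cvg_at_rightP : ptrunc z d @[d --> 0^'+] --> pvt z by [].
move=> /(_ (fun n => n.+1%:R^-1)); apply; split; first by move=> n; rewrite invr_gt0.
by have := @cvg_harmonic R.
Qed.

Lemma s_ge_half M : 2 * a <= M -> c1 / 2 / M <= s M.
Proof.
move=> aM; have A0 : 0 < a := a0; have C1 : 0 < c1 := c10.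
have aM' : a <= M by lra.
have M0 : 0 < M by lra.
apply: le_trans (s_ge aM').
have -> : c1 / 2 / M = c1 / M * (1 / 2) by rewrite mul1r mulrAC.
apply: ler_wpM2l; first by rewrite divr_ge0// ltW.
have q : 1 / 2 <= 1 - a / M.
  suff : a / M <= 1 / 2 by lra.
  by rewrite ler_pdivrMr//; lra.
have h2 : 0 <= 1 / 2 :> R by lra.
rewrite -[leLHS]ger0_norm// -sqrtr_sqr ler_sqrt; last lra.
by apply: le_trans q; rewrite expr2; lra.
Qed.

(** On [a, 2a) the integrand is nonpositive and is dropped. On [2a, z/2] one has s >= c1 / (2 M) and
    1 / (M - z) <= -1 / z, which produces the logarithm. Beyond 3z/2 one has M - z >= M / 3, whence
    8 C / z. *)
Lemma ptrunc_le z : 4 * a < z -> ptrunc z (z / 2) <= (8 * C - c1 / 2 * ln (z / (4 * a))) / z.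
Proof.
move=> az; have A0 : 0 < a := a0; have C1 : 0 < c1 := c10; have C00 := C0.
have az' : a < z by lra.
have z0 : 0 < z by lra.
have z20 : 0 < z / 2 by lra.
have iT := ptrunc_integrable az' z20.
pose l := `[2 * a, z / 2]%classic : set R.
pose p := `[a, 2 * a[%classic : set R.
pose q := from (3 * z / 2) : set R.
have ml : measurable (l : set (measurableTypeR R)) by exact: measurable_itv.
have mp : measurable (p : set (measurableTypeR R)) by exact: measurable_itv.
have mq : measurable (q : set (measurableTypeR R)) by exact: measurable_from.
have E M : trunc z (z / 2) M <-> (l `|` (p `|` q)) M.
  rewrite /setU /l /p /q /from /mkset !truncE /= !in_itv/=; split.
    move=> [aM]; rewrite ler_normr => /orP[?|?]; first by right; right; lra.
    by have [?|?] := ltP M (2 * a); [right; left|left]; lra.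
  case=> [/andP[? ?]|[/andP[? ?]|?]]; split; try lra.
  - by rewrite ler_normr; apply/orP; right; lra.
  - by rewrite ler_normr; apply/orP; right; lra.
  - by rewrite ler_normr; apply/orP; left; lra.
have ET : trunc z (z / 2) = l `|` (p `|` q) by apply/seteqP; split=> M /E.
have sub A : measurable (A : set (measurableTypeR R)) -> A `<=` l `|` (p `|` q) ->
    mu.-integrable A (EFin \o (fun M => s M / (M - z))).
  by move=> mA; rewrite -ET => AT; apply: integrableS iT => //; exact: measurable_trunc.
have il := sub l ml (fun M h => or_introl h).
have ip := sub p mp (fun M h => or_intror (or_introl h)).
have iq := sub q mq (fun M h => or_intror (or_intror h)).
rewrite /ptrunc ET Rintegral_setU//; last 3 first.
- exact: measurableU.
- by rewrite -ET.
- by apply/disj_setPS => M [/=]; rewrite /l /p /q /from /= !in_itv/= => /andP[? ?] [/andP[? ?]|?]; lra.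
rewrite Rintegral_setU//; last 2 first.
- by apply: sub; [exact: measurableU|move=> M h; right].
- by apply/disj_setPS => M [/=]; rewrite /p /q /from /= !in_itv/= => /andP[? ?] ?; lra.
have bp : (\int[mu]_(M in p) (s M / (M - z)) <= 0)%R.
  have <- : (\int[mu]_(M in p) 0 = 0 :> R)%R by rewrite Rintegral_cst// mul0r.
  apply: le_Rintegral => //; first exact: integrable0.
  move=> M; rewrite /p /= in_itv/= => /andP[aM M2].
  by rewrite mulr_ge0_le0 ?s_ge0// invr_le0; lra.
have bq : (\int[mu]_(M in q) (s M / (M - z)) <= 8 * C / z)%R.
  have [i hb] := @inv_sqr_integrable R (3 * z / 2) ltac:(lra).
  have i3 := integrableZl mq (3 * C) i.
  apply: (@le_trans _ _ (\int[mu]_(M in q) (3 * C * (M ^+ 2)^-1))%R).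
    apply: le_Rintegral => //.
    move=> M; rewrite /q /from /= => zM.
    have M0 : 0 < M by lra.
    have aM : a <= M by lra.
    rewrite ler_pdivrMr; last lra.
    apply: le_trans (s_le aM) _.
    have -> : M^-1 = (M ^+ 2)^-1 * M by rewrite expr2 invfM mulfVK// gt_eqF.
    rewrite -!mulrA [3 * _]mulrCA; apply: ler_wpM2l => //.
    rewrite [3 * _]mulrCA; apply: ler_wpM2l; first by rewrite invr_ge0 sqr_ge0.
    lra.
  rewrite RintegralZl//.
  have -> : 8 * C / z = 3 * C * (4 / (3 * z / 2)).
    rewrite !invfM invrK; field; lra.
  by apply: ler_wpM2l => //; lra.
have bl : (\int[mu]_(M in l) (s M / (M - z)) <= - (c1 / 2 * ln (z / (4 * a)) / z))%R.
  have dl (x : R) : 2 * a <= x <= z / 2 -> is_derive x 1 (@ln R) x^-1.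
    by move=> /andP[? ?]; apply: is_derive1_ln; lra.
  have ci (x : R) : 2 * a <= x <= z / 2 -> {for x, continuous (fun M : R => M^-1)}.
    by move=> /andP[? ?]; apply: inv_continuous; apply/eqP; lra.
  have EI : (\int[mu]_(x in l) x^-1%:E = (ln (z / 2)%R)%:E - (ln (2 * a)%R)%:E)%E.
    apply: (@primitive_integral _ _ (@ln R)) => //; lra.
  have ii : mu.-integrable l (EFin \o (fun M => M^-1)).
    apply: continuous_compact_integrable; first exact: segment_compact.
    by apply: continuous_in_subspaceT => x; rewrite inE /l /= in_itv/=; exact: ci.
  have i2 := integrableZl ml (- (c1 / 2 / z)) ii.
  apply: (@le_trans _ _ (\int[mu]_(M in l) (- (c1 / 2 / z) * M^-1))%R).
    apply: le_Rintegral => //.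
    move=> M; rewrite /l /= in_itv/= => /andP[aM Mz].
    have M0 : 0 < M by lra.
    rewrite ler_ndivrMr; last lra.
    have h := s_ge_half aM.
    apply: le_trans h.
    have -> : - (c1 / 2 / z) / M * (M - z) = c1 / 2 / M * ((z - M) / z) by ring.
    rewrite -[leRHS]mulr1; apply: ler_wpM2l; first by rewrite !divr_ge0// ltW.
    by rewrite ler_pdivrMr//; lra.
  rewrite RintegralZl// /Rintegral EI /=.
  have -> : ln (z / (4 * a)) = ln (z / 2) - ln (2 * a).
    rewrite -ln_div ?posrE; try lra.
    by congr ln; field; lra.
  by rewrite mulNr [c1 / 2 / z * _]mulrAC.
apply: le_trans (lerD bl (lerD bp bq)) _.
rewrite mulrBl; lra.
Qed.

End PrincipalValue.

Section IntegrableSets.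
Context {R : realType}.
Notation mu := (@lebesgue_measure R).

Lemma integrable_setU (A B : set (measurableTypeR R)) (f : R -> \bar R) :
  measurable A -> measurable B -> mu.-integrable A f -> mu.-integrable B f ->
  mu.-integrable (A `|` B) f.
Proof.
move=> mA mB iA iB.
have [mfA fA] := integrableP _ _ _ iA; have [mfB fB] := integrableP _ _ _ iB.
have mf : measurable_fun (A `|` B) f by apply/measurable_funU.
apply/integrableP; split=> //.
have mBA : measurable (B `\` A) by exact: measurableD.
have E : A `|` B = A `|` (B `\` A).
  apply/seteqP; split=> x; last by move=> [|[]]; [left|right].
  by move=> [|Bx]; [left|have [?|?] := pselect (A x); [left|right]].
rewrite E integral_setU//; last 2 first.
- by rewrite -E; exact: measurableT_comp.
- by apply/disj_setPS => x [/= Ax []].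
apply: lte_add_pinfty => //; apply: le_lt_trans fB.
apply: ge0_subset_integral => //; exact: measurableT_comp.
Qed.

Lemma integrable_set1 (r : R) (f : R -> \bar R) : mu.-integrable [set r] f.
Proof.
apply/integrableP; split; first exact: measurable_fun_set1.
by rewrite (integral_Sset1 r).
Qed.

End IntegrableSets.

(** * Integrability of the weight near the threshold and at infinity *)

Section Weight.
Context {R : realType}.
Notation mu := (@lebesgue_measure R).
Variables (s : R -> R) (a C c1 c : R).
Hypotheses (a0 : 0 < a) (C0 : 0 <= C) (c10 : 0 < c1) (c_lt : c < a).
Hypothesis ms : measurable_fun setT s.
Hypothesis s_ge0 : forall M, a <= M -> 0 <= s M.
Hypothesis s_le : forall M, a <= M -> s M <= C / M.
Hypothesis s_ge : forall M, a <= M -> c1 / M * Num.sqrt (1 - a / M) <= s M.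
Hypothesis s_lip : forall b, a < b -> exists2 L, 0 <= L &
  forall M N, b <= M -> b <= N -> `|s N - s M| <= L * `|N - M| / (N * M).

Let p := pvt s a.
Definition weight M := s M / ((M - c) * (p M ^+ 2 + pi ^+ 2 * s M ^+ 2)) / M.

Lemma measurable_weight : measurable_fun `]a, +oo[ weight.
Proof.
have m1 : measurable_fun `]a, +oo[ s by exact: measurable_funTS.
have mp : measurable_fun `]a, +oo[ p by exact: (measurable_pvt a0 C0).
have mid : measurable_fun `]a, +oo[ (fun M : R => M) by exact: measurable_id.
have mc (r : R) : measurable_fun `]a, +oo[ (fun _ : R => r) by exact: measurable_cst.
apply: measurable_funM; last exact: measurable_funV.
apply: measurable_funM => //; apply: measurable_funV; apply: measurable_funM.
  by apply: measurable_funB.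
apply: measurable_funD; first exact: measurable_funX.
by apply: measurable_funM => //; exact: measurable_funX.
Qed.

Lemma weight_ge0 M : a <= M -> 0 <= weight M.
Proof.
move=> aM; have A0 : 0 < a := a0; have ca := c_lt.
have q : 0 <= p M ^+ 2 + pi ^+ 2 * s M ^+ 2 by apply: addr_ge0; [exact: sqr_ge0|apply: mulr_ge0; exact: sqr_ge0].
by rewrite /weight !divr_ge0 ?s_ge0// ?mulr_ge0//; lra.
Qed.

Lemma weight_near (b M : R) : a < M -> M <= b ->
  weight M <= b * Num.sqrt b / ((a - c) * pi ^+ 2 * c1 * a) * (Num.sqrt (M - a))^-1.
Proof.
move=> aM Mb; have A0 : 0 < a := a0; have ca := c_lt; have C1 : 0 < c1 := c10.
have b0 : 0 < b by lra.
have M0 : 0 < M by lra.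
have r0 : 0 < Num.sqrt (M - a) by rewrite sqrtr_gt0; lra.
have b20 : 0 < Num.sqrt b by rewrite sqrtr_gt0; lra.
have pi0 := @pi_gt0 R.
have sM : c1 / b * (Num.sqrt (M - a) / Num.sqrt b) <= s M.
  apply: le_trans (s_ge (ltW aM)).
  apply: ler_pM.
  - by rewrite divr_ge0// ltW.
  - by rewrite divr_ge0// ltW.
  - by apply: ler_wpM2l; [exact: ltW|rewrite lef_pV2].
  rewrite ler_pdivrMr// -sqrtrM; last by rewrite subr_ge0 ler_pdivrMr// mul1r ltW.
  rewrite ler_sqrt; last by rewrite mulr_ge0 ?subr_ge0 ?ler_pdivrMr ?mul1r// ltW.
  have -> : M - a = (1 - a / M) * M by rewrite mulrBl mul1r divfK// gt_eqF.
  apply: ler_wpM2l => //; by rewrite subr_ge0 ler_pdivrMr// mul1r ltW.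
have k0 : 0 < c1 / b * (Num.sqrt (M - a) / Num.sqrt b) by rewrite mulr_gt0 ?divr_gt0.
have s0 : 0 < s M by exact: lt_le_trans k0 sM.
have D0 : 0 < (a - c) * pi ^+ 2 * s M ^+ 2 by rewrite !mulr_gt0 ?exprn_gt0//; lra.
apply: (@le_trans _ _ (s M / ((a - c) * pi ^+ 2 * s M ^+ 2) / a)).
  rewrite /weight; apply: ler_pM.
  - have q : 0 <= p M ^+ 2 + pi ^+ 2 * s M ^+ 2 by apply: addr_ge0; [exact: sqr_ge0|apply: mulr_ge0; exact: sqr_ge0].
    by rewrite divr_ge0 ?(ltW s0)// mulr_ge0//; lra.
  - by rewrite invr_ge0 ltW.
  - apply: ler_wpM2l; first exact: ltW.
    have P : (a - c) * pi ^+ 2 * s M ^+ 2 <= (M - c) * (p M ^+ 2 + pi ^+ 2 * s M ^+ 2).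
      rewrite -mulrA; apply: ler_pM; [lra|by apply: mulr_ge0; exact: sqr_ge0|lra|].
      by rewrite lerDr sqr_ge0.
    by rewrite lef_pV2 ?posrE//; exact: lt_le_trans P.
  - by rewrite lef_pV2 ?posrE// ltW.
have -> : s M / ((a - c) * pi ^+ 2 * s M ^+ 2) / a = ((a - c) * pi ^+ 2 * a)^-1 * (s M)^-1.
  move: (pi ^+ 2) (exprn_gt0 2 pi0) => P P0; field.
  by rewrite !gt_eqF//; lra.
have -> : b * Num.sqrt b / ((a - c) * pi ^+ 2 * c1 * a) * (Num.sqrt (M - a))^-1 =
    ((a - c) * pi ^+ 2 * a)^-1 * (c1 / b * (Num.sqrt (M - a) / Num.sqrt b))^-1.
  move: (pi ^+ 2) (exprn_gt0 2 pi0) (Num.sqrt (M - a)) (Num.sqrt b) r0 b20 => P P0 r r' r0 r0'; field.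
  by rewrite !gt_eqF//; lra.
apply: ler_wpM2l; first by rewrite invr_ge0 !mulr_ge0 ?sqr_ge0//; lra.
by rewrite lef_pV2.
Qed.

Lemma weight_far : exists k, exists2 A : R, 4 * a <= k &
  forall M, k * expR 1 < M -> weight M <= A * (M * ln (M / (4 * a)) ^+ 2)^-1.
Proof.
have A0 : 0 < a := a0; have C1 : 0 < c1 := c10; have ca := c_lt; have C00 := C0.
have pi0 := @pi_gt0 R.
have [L L0 HL] := s_lip (ltac:(lra) : a < 2 * a).
(* 8 C is the far part of the truncated integral; 2 L bounds the core |x - M| < M / 2, where s has
   Lipschitz constant 2 L / M^2. *)
pose K := 8 * C + 2 * L.
have K0 : 0 <= K by rewrite addr_ge0 ?mulr_ge0.
have e1 : 1 < expR 1 :> R by rewrite expR_gt1.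
(* Beyond this point K is at most half of the logarithmic term, so the principal value stays below
   -(c1 / 4) ln (M / (4 a)) / M. *)
pose k := 4 * a * expR (4 * K / c1).
have k4 : 4 * a <= k.
  rewrite -[leLHS]mulr1; apply: ler_wpM2l; first lra.
  by rewrite -expR0 ler_expR divr_ge0 ?mulr_ge0// ltW.
(* C divided by (c1 / 4)^2 and by the 1/2 from M - c >= M / 2. *)
exists k, (32 * C / c1 ^+ 2) => // M kM.
have kM' : k < M by apply: le_lt_trans kM; rewrite ler_peMr ?(ltW e1)//; lra.
have aM : 4 * a < M by lra.
have M0 : 0 < M by lra.
have lnM : 4 * K / c1 < ln (M / (4 * a)).
  have a4 : 0 < 4 * a by lra.
  rewrite -[ltLHS]expRK ltr_ln ?posrE ?expR_gt0; [|by []|exact: divr_gt0].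
  rewrite ltr_pdivlMr; last exact: a4.
  by rewrite mulrC; exact: kM'.
have ln0 : 0 < ln (M / (4 * a)).
  apply: le_lt_trans lnM; rewrite divr_ge0 ?mulr_ge0// ltW//.
have pM : p M <= - (c1 / 4 * ln (M / (4 * a)) / M).
  have sB x : M - M / 2 <= x <= M + M / 2 -> `|s x - s M| <= (2 * L / M ^+ 2) * `|x - M|.
    move=> /andP[x1 x2]; apply: le_trans (HL M x ltac:(lra) ltac:(lra)) _.
    have -> : 2 * L / M ^+ 2 * `|x - M| = L * `|x - M| * (M / 2 * M)^-1.
      by field; lra.
    apply: ler_wpM2l; first by rewrite mulr_ge0.
    rewrite lef_pV2 ?posrE ?mulr_gt0//; try lra.
    by apply: ler_wpM2r; lra.
  have B0 : 0 <= 2 * L / M ^+ 2 by apply: divr_ge0; [exact: mulr_ge0|exact: sqr_ge0].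
  have := pvt_ptrunc a0 C0 ms s_ge0 s_le s_lip (ltac:(lra) : a < M - M / 2) (ltac:(lra) : 0 < M / 2) sB B0.
  have -> : 2 * (M / 2) * (2 * L / M ^+ 2) = 2 * L / M by field; lra.
  rewrite ler_norml => /andP[_ h1].
  have := ptrunc_le a0 C0 c10 ms s_ge0 s_le s_ge aM.
  rewrite -/p in h1.
  move: (ptrunc s a M (M / 2)) h1 => u h1 h2.
  have : p M <= (8 * C - c1 / 2 * ln (M / (4 * a))) / M + 2 * L / M by lra.
  move=> h; apply: (le_trans h).
  rewrite -mulrDl -[leRHS]mulNr; apply: ler_wpM2r; first by rewrite invr_ge0 ltW.
  move: lnM; rewrite ltr_pdivrMr// /K; lra.
have l2 : 0 < c1 / 4 * ln (M / (4 * a)) / M by rewrite divr_gt0// mulr_gt0//; lra.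
have p2 : (c1 / 4 * ln (M / (4 * a)) / M) ^+ 2 <= p M ^+ 2.
  rewrite -[leRHS]sqrrN; apply: lerXn2r; rewrite ?nnegrE; lra.
have sM : s M <= C / M by apply: s_le; lra.
have q : 0 < (c1 / 4 * ln (M / (4 * a)) / M) ^+ 2 by rewrite exprn_gt0.
rewrite /weight.
apply: (@le_trans _ _ (C / M / (M / 2 * (c1 / 4 * ln (M / (4 * a)) / M) ^+ 2) / M)).
  apply: ler_wpM2r; first by rewrite invr_ge0 ltW.
  have P : M / 2 * (c1 / 4 * ln (M / (4 * a)) / M) ^+ 2 <= (M - c) * (p M ^+ 2 + pi ^+ 2 * s M ^+ 2).
    apply: ler_pM; [lra|exact: ltW|lra|].
    by apply: (le_trans p2); rewrite lerDl; apply: mulr_ge0; exact: sqr_ge0.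
  have P0 : 0 < M / 2 * (c1 / 4 * ln (M / (4 * a)) / M) ^+ 2 by rewrite mulr_gt0//; lra.
  apply: ler_pM => //.
  - by apply: s_ge0; lra.
  - by rewrite invr_ge0; apply: ltW; exact: lt_le_trans P.
  - by rewrite lef_pV2 ?posrE//; exact: lt_le_trans P.
move: (ln (M / (4 * a))) ln0 => l l0.
rewrite le_eqVlt; apply/orP; left; apply/eqP; field.
by rewrite !gt_eqF.
Qed.

Lemma weight_integrable : mu.-integrable (from a) (EFin \o weight).
Proof.
have A0 : 0 < a := a0.
have [k [A k4 HA]] := weight_far.
have e0 : 0 < expR 1 :> R by rewrite expR_gt0.
have e1 : 1 < expR 1 :> R by rewrite expR_gt1.
have ke : 4 * a * expR 1 <= k * expR 1 by apply: ler_wpM2r => //; exact: ltW.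
have ka : a < k * expR 1 by nra.
pose b := k * expR 1 + 1.
have mw := measurable_weight.
have sub (D : set (measurableTypeR R)) (g : R -> R) : measurable D -> D `<=` `]a, +oo[%classic ->
    mu.-integrable D (EFin \o g) -> (forall x : R, D x -> weight x <= g x) ->
    mu.-integrable D (EFin \o weight).
  move=> mD Da ig wg; apply: le_integrable ig => //.
    by apply/measurable_EFinP; apply: measurable_funS mw => //.
  move=> x Dx; have ax : a < x by have := Da _ Dx; rewrite /= in_itv/= andbT.
  rewrite /comp !abse_EFin lee_fin [leLHS]ger0_norm; last by apply: weight_ge0; exact: ltW.
  by apply: le_trans (wg _ Dx) _; exact: ler_norm.
(* The threshold itself is a null set, split off because the square root bound holds only above it;
   b overshoots so that the two other pieces overlap. *)
have E : from a = [set a] `|` (`]a, b[%classic `|` `]k * expR 1, +oo[%classic).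
  apply/seteqP; split=> x; rewrite /from /setU /mkset /= !in_itv/= ?andbT /b.
    by rewrite le_eqVlt => /orP[/eqP->|ax]; [left|right; have [?|?] := ltP (k * expR 1) x; [right|left]; lra].
  by case=> [->//|[/andP[/ltW]//|]]; lra.
rewrite E; apply: integrable_setU => //; first exact: measurableU.
  exact: integrable_set1.
apply: integrable_setU => //.
- have ab : a < b by rewrite /b; lra.
  have mab : measurable (`]a, b[%classic : set (measurableTypeR R)) by exact: measurable_itv.
  have j := integrableZl mab (b * Num.sqrt b / ((a - c) * pi ^+ 2 * c1 * a)) (inv_sqrt_integrable ab).
  apply: (sub _ (fun M => b * Num.sqrt b / ((a - c) * pi ^+ 2 * c1 * a) * (Num.sqrt (M - a))^-1) mab _ j).
    by move=> x; rewrite /= !in_itv/= => /andP[->].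
  by move=> x; rewrite /= in_itv/= => /andP[ax xb]; apply: weight_near => //; exact: ltW.
- have i := @inv_ln_sqr_integrable R (4 * a) ltac:(lra).
  have i' : mu.-integrable `]k * expR 1, +oo[ (EFin \o (fun M => (M * ln (M / (4 * a)) ^+ 2)^-1)).
    apply: integrableS i => //.
    by move=> x; rewrite /= !in_itv/= !andbT; exact: le_lt_trans.
  have mk : measurable (`]k * expR 1, +oo[%classic : set (measurableTypeR R)) by exact: measurable_itv.
  have j := integrableZl mk A i'.
  apply: (sub _ (fun M => A * (M * ln (M / (4 * a)) ^+ 2)^-1) mk _ j).
    by move=> x; rewrite /= !in_itv/= !andbT; exact: lt_trans.
  by move=> x; rewrite /= in_itv/= andbT; exact: HA.
Qed.

End Weight.

(** * Two-sided bounds and Lipschitz estimates in 1/M *)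

Section Rays.
Context {R : realType}.
Implicit Types (f g : R -> R) (a b r : R).

Definition pinched a f := exists l u : R, 0 < l /\ forall M, a <= M -> l <= f M <= u.

(* Lipschitz in the variable 1/M, since 1/M - 1/N = (N - M) / (N M) *)
Definition inv_lip b f := exists B L : R, [/\ 0 <= B, 0 <= L,
  forall M, b <= M -> `|f M| <= B &
  forall M N, b <= M -> b <= N -> `|f N - f M| <= L * (`|N - M| / (N * M))].

Lemma pinchedM a f g : pinched a f -> pinched a g -> pinched a (fun M => f M * g M).
Proof.
move=> [l [u [l0 H]]] [l' [u' [l0' H']]]; exists (l * l'), (u * u'); split.
  exact: mulr_gt0.
by move=> M aM; move: (H M aM) (H' M aM) => /andP[? ?] /andP[? ?]; apply/andP; split; apply: ler_pM => //; lra.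
Qed.

Lemma pinchedV a f : pinched a f -> pinched a (fun M => (f M)^-1).
Proof.
move=> [l [u [l0 H]]].
have lu : l <= u by have /andP[? ?] := H a (lexx a); lra.
exists u^-1, l^-1; split; first by rewrite invr_gt0; lra.
move=> M aM; have /andP[h1 h2] := H M aM.
by apply/andP; split; rewrite lef_pV2 ?posrE//; lra.
Qed.

Lemma pinched_root a r : 0 < a -> r < a -> pinched a (fun M => 1 - r / M).
Proof.
move=> a0 ra; exists (Num.min 1 (1 - r / a)), (1 + `|r| / a); split.
  by rewrite lt_min ltr01 subr_gt0 ltr_pdivrMr// mul1r.
move=> M aM; have M0 : 0 < M by lra.
have Va : M^-1 <= a^-1 by rewrite lef_pV2.
have V0 : 0 <= M^-1 by rewrite invr_ge0 ltW.
apply/andP; split; last first.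
  have := ler_norm (- r); rewrite normrN => h.
  have n0 : 0 <= `|r| by [].
  by move: (`|r|) n0 h => n n0 h; nra.
have [r0|r0] := leP 0 r.
  by rewrite ge_min; apply/orP; right; nra.
by rewrite ge_min; apply/orP; left; nra.
Qed.

Lemma inv_lipM b f g : 0 < b -> inv_lip b f -> inv_lip b g -> inv_lip b (fun M => f M * g M).
Proof.
move=> b0 [B [L [B0 L0 fB fL]]] [B' [L' [B0' L0' gB gL]]].
exists (B * B'), (B * L' + L * B'); split; rewrite ?addr_ge0 ?mulr_ge0//.
  by move=> M bM; rewrite normrM ler_pM// ?fB ?gB.
move=> M N bM bN.
have -> : f N * g N - f M * g M = f N * (g N - g M) + (f N - f M) * g M by ring.
rewrite [leRHS]mulrDl; apply: le_trans (ler_normD _ _) _; apply: lerD.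
  by rewrite normrM -mulrA; apply: ler_pM => //; [exact: fB|exact: gL].
by rewrite normrM mulrAC; apply: ler_pM => //; [exact: fL|exact: gB].
Qed.

Lemma inv_lipV b f l : 0 < b -> 0 < l -> (forall M, b <= M -> l <= f M) ->
  inv_lip b f -> inv_lip b (fun M => (f M)^-1).
Proof.
move=> b0 l0 lf [B [L [B0 L0 fB fL]]].
have f0 M : b <= M -> 0 < f M by move=> /lf; exact: lt_le_trans.
exists l^-1, (L / l ^+ 2); split.
- by rewrite invr_ge0 ltW.
- by rewrite divr_ge0 ?sqr_ge0.
- by move=> M bM; rewrite ger0_norm ?invr_ge0 ?(ltW (f0 _ bM))// lef_pV2 ?posrE ?f0 ?lf.
move=> M N bM bN; have fM := f0 _ bM; have fN := f0 _ bN.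
have -> : (f N)^-1 - (f M)^-1 = (f M - f N) * (f N * f M)^-1.
  by field; rewrite !gt_eqF.
rewrite normrM distrC mulrAC; apply: ler_pM => //; first exact: fL.
have P : 0 < f N * f M by exact: mulr_gt0.
rewrite gtr0_norm ?invr_gt0// lef_pV2 ?posrE ?exprn_gt0// expr2.
by apply: ler_pM => //; [exact: ltW|exact: ltW|exact: lf|exact: lf].
Qed.

Lemma inv_lip_sqrt b f l : 0 < b -> 0 < l -> (forall M, b <= M -> l <= f M) ->
  inv_lip b f -> inv_lip b (fun M => Num.sqrt (f M)).
Proof.
move=> b0 l0 lf [B [L [B0 L0 fB fL]]].
have sl0 : 0 < Num.sqrt l by rewrite sqrtr_gt0.
have f0 M : b <= M -> 0 < f M by move=> /lf; exact: lt_le_trans.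
have sl M : b <= M -> Num.sqrt l <= Num.sqrt (f M) by move=> bM; rewrite ler_sqrt ?f0 ?lf// ltW// f0.
exists (Num.sqrt B), (L / Num.sqrt l); split.
- exact: sqrtr_ge0.
- by rewrite divr_ge0// ltW.
- move=> M bM; rewrite ger0_norm ?sqrtr_ge0// ler_sqrt//.
  by apply: le_trans (fB _ bM); exact: ler_norm.
move=> M N bM bN; rewrite mulrAC ler_pdivlMr//.
apply: le_trans (fL M N bM bN).
have -> : f N - f M = (Num.sqrt (f N) - Num.sqrt (f M)) * (Num.sqrt (f N) + Num.sqrt (f M)).
  rewrite -[in LHS](sqr_sqrtr (ltW (f0 _ bN))) -[in LHS](sqr_sqrtr (ltW (f0 _ bM))); ring.
rewrite normrM; apply: ler_wpM2l => //; apply: le_trans (ler_norm _).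
by apply: le_trans (sl _ bN) _; rewrite lerDl sqrtr_ge0.
Qed.

Lemma inv_lip_root b r : 0 < b -> inv_lip b (fun M => 1 - r / M).
Proof.
move=> b0; exists (1 + `|r| / b), `|r|; split=> //.
- by rewrite addr_ge0// divr_ge0// ltW.
- move=> M bM; have M0 : 0 < M by lra.
  apply: le_trans (ler_normB _ _) _; rewrite normr1 lerD2l normrM normfV (gtr0_norm M0).
  by apply: ler_wpM2l => //; rewrite lef_pV2.
move=> M N bM bN; have M0 : 0 < M by lra.
have N0 : 0 < N by lra.
have -> : 1 - r / N - (1 - r / M) = r * ((N - M) / (N * M)) by field; rewrite !gt_eqF.
by rewrite normrM normrM normfV (gtr0_norm (mulr_gt0 N0 M0)).
Qed.

Lemma inv_lip_cst b (k : R) : inv_lip b (fun=> k).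
Proof. by exists `|k|, 0; split=> // M N _ _; rewrite subrr normr0 mul0r. Qed.

Lemma inv_lip_inv b : 0 < b -> inv_lip b (fun M => M^-1).
Proof.
move=> b0; exists b^-1, 1; split=> //.
- by rewrite invr_ge0 ltW.
- move=> M bM; have M0 : 0 < M by lra.
  by rewrite normfV gtr0_norm// lef_pV2.
move=> M N bM bN; have M0 : 0 < M by lra.
have N0 : 0 < N by lra.
have -> : N^-1 - M^-1 = (M - N) / (N * M) by field; rewrite !gt_eqF.
by rewrite normrM normfV (gtr0_norm (mulr_gt0 N0 M0)) distrC mul1r.
Qed.

End Rays.

(** * The density [varsigma] satisfies the hypotheses on the weight *)

Section Varsigma.
Context {R : realType}.
Notation mu := (@lebesgue_measure R).
Variables (m a1 a2 g0 g1 g2 c : R).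
Let a : R := 4 * m ^+ 2.
Hypothesis m0 : 0 < m.
Hypotheses (a1a : a1 < a) (a2a : a2 < a) (g0a : g0 < a) (g1a : g1 < a) (g2a : g2 < a).
Hypothesis ca : c < a.

Let s := varsigma m a1 a2 g0 g1 g2.
Let kap : R := (16 * pi ^+ 2)^-1.
(** The rational factor of [varsigma] in the variable 1/M. All the roots lie below the threshold a,
    so it stays between positive constants; decay is left to [kap] / M, and vanishing at the
    threshold to the square root. *)
Let h (M : R) := (1 - a1 / M) * (1 - a2 / M) *
  ((1 - g0 / M)^-1 * ((1 - g1 / M)^-1 * (1 - g2 / M)^-1)).

Let a_gt0 : 0 < a. Proof. by rewrite mulr_gt0// exprn_gt0. Qed.
Let kap_gt0 : 0 < kap.
Proof. by rewrite invr_gt0 mulr_gt0// exprn_gt0// pi_gt0. Qed.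

Lemma varsigmaE M : a <= M -> s M = kap * M^-1 * h M * Num.sqrt (1 - a / M).
Proof.
move=> aM; rewrite /s /varsigma /rho -/a -/kap /h.
have M0 : 0 < M by exact: lt_le_trans a_gt0 aM.
have ne r : r < a -> M - r != 0 by move=> ra; rewrite gt_eqF// subr_gt0; exact: lt_le_trans ra aM.
have ner := ne _ g0a; have ner1 := ne _ g1a; have ner2 := ne _ g2a.
move: (Num.sqrt _) kap => w k; field.
by rewrite (gt_eqF M0) ner ner1 ner2.
Qed.

Lemma h_pinched : pinched a h.
Proof.
have p r : r < a -> pinched a (fun M => 1 - r / M) by exact: pinched_root.
apply: pinchedM; first by apply: pinchedM; exact: p.
by apply: pinchedM; [|apply: pinchedM]; apply: pinchedV; exact: p.
Qed.

(** The ray starts strictly above a, since the square root is not Lipschitz at the threshold. *)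
Lemma varsigma_inv_lip b : a < b -> inv_lip b s.
Proof.
move=> ab; have A0 := a_gt0; have b0 : 0 < b by exact: lt_trans A0 ab.
have V r : r < a -> inv_lip b (fun M => (1 - r / M)^-1).
  move=> ra; have [l [u [l0 H]]] := pinched_root A0 ra.
  apply: (inv_lipV b0 l0); last exact: inv_lip_root.
  by move=> M bM; have /andP[] := H M (le_trans (ltW ab) bM).
have sq : inv_lip b (fun M => Num.sqrt (1 - a / M)).
  have [l [u [l0 H]]] := pinched_root b0 ab.
  apply: (inv_lip_sqrt b0 l0); last exact: inv_lip_root.
  by move=> M bM; have /andP[] := H M bM.
have hl : inv_lip b h.
  apply: inv_lipM => //; first by apply: inv_lipM => //; exact: inv_lip_root.
  by apply: inv_lipM => //; [|apply: inv_lipM => //]; exact: V.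
have [B [L [B0 L0 HB HL]]] : inv_lip b (fun M => kap * M^-1 * h M * Num.sqrt (1 - a / M)).
  apply: inv_lipM => //; apply: inv_lipM => //; apply: inv_lipM => //; first exact: inv_lip_cst.
  exact: inv_lip_inv.
exists B, L; split=> // [M bM|M N bM bN].
  by rewrite varsigmaE ?HB// (le_trans (ltW ab)).
by rewrite !varsigmaE ?HL// (le_trans (ltW ab)).
Qed.

Lemma measurable_varsigma : measurable_fun setT s.
Proof.
have mid : measurable_fun setT (fun M : R => M) by exact: measurable_id.
have mB (r : R) : measurable_fun setT (fun M : R => M - r).
  by apply: measurable_funB => //; exact: measurable_cst.
rewrite /s /varsigma /rho; apply: measurable_funM; apply: measurable_funM.
- by apply: measurable_funM => //; exact: measurable_funM.
- by apply: measurable_funV; apply: measurable_funM => //; exact: measurable_funM.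
- apply: measurable_funM; first exact: measurable_cst.
  apply: (@measurableT_comp _ _ _ _ _ _ (@Num.sqrt R)).
    by apply: continuous_measurable_fun; exact: sqrt_continuous.
  apply: measurable_funB; first exact: measurable_cst.
  by apply: measurable_funM; [exact: measurable_cst|exact: measurable_funV].
- exact: measurable_funV.
Qed.

Lemma mucon_integrable :
  mu.-integrable (from a) (EFin \o (fun M => mucon m a1 a2 g0 g1 g2 c M / M)).
Proof.
have [l [u [l0 H]]] := h_pinched.
have A0 := a_gt0; have K0 := kap_gt0.
have u0 : 0 < u by have /andP[? ?] := H a (lexx a); lra.
have sq M : a <= M -> 0 <= Num.sqrt (1 - a / M) <= 1.
  move=> aM; have M0 : 0 < M by exact: lt_le_trans A0 aM.
  rewrite sqrtr_ge0 -[leRHS]sqrtr1 ler_sqrt// lerBlDr lerDl.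
  by rewrite divr_ge0// ltW.
have kM M : a <= M -> 0 < kap / M.
  by move=> aM; rewrite divr_gt0//; exact: lt_le_trans A0 aM.
(* The upper and lower constants of [varsigma] are [kap] times those of h. *)
apply: (@weight_integrable R s a (kap * u) (kap * l) c) => //.
- by rewrite mulr_ge0 ?ltW.
- exact: mulr_gt0.
- exact: measurable_varsigma.
- move=> M aM; have /andP[h1 h2] := H M aM; have /andP[q0 q1] := sq M aM.
  by rewrite varsigmaE// mulr_ge0// mulr_ge0 ?(ltW (kM _ aM))//; lra.
- move=> M aM; have /andP[h1 h2] := H M aM; have /andP[q0 q1] := sq M aM.
  rewrite varsigmaE// -[leRHS]mulr1; apply: ler_pM => //.
    by rewrite mulr_ge0 ?(ltW (kM _ aM))//; lra.
  by rewrite [leRHS]mulrAC; apply: ler_wpM2l => //; rewrite ltW ?kM.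
- move=> M aM; have /andP[h1 h2] := H M aM; have /andP[q0 q1] := sq M aM.
  rewrite varsigmaE//; apply: ler_wpM2r => //.
  by rewrite [leLHS]mulrAC; apply: ler_wpM2l => //; rewrite ltW ?kM.
- move=> b ab; have [B [L [_ L0 _ HL]]] := varsigma_inv_lip ab.
  by exists L => // M N bM bN; rewrite -mulrA; exact: HL.
Qed.

End Varsigma.

Theorem theorem4p11 (R : realType) (m a1 a2 bt0 bt1 b0 b1 b2 g0 g1 g2 eps c : R)
  (S : pt R -> R) :
  0 < m ->
  a1 < 4 * m ^+ 2 -> a2 < 4 * m ^+ 2 ->
  g0 < 4 * m ^+ 2 -> g1 < 4 * m ^+ 2 -> g2 < 4 * m ^+ 2 ->
  g0 != g1 -> g0 != g2 -> g1 != g2 ->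
  (forall g, g \in [:: g0; g1; g2] ->
     g * (a1 - g) * (a2 - g) * Jfun m g = b0 + b1 * g + b2 * g ^+ 2) ->
  0 < eps ->
  0 < c -> c < 4 * m ^+ 2 ->
  Cpc S -> supp S `<=` [set x | - eps <= tcoord x] ->
  let W := Wret m a1 a2 g0 g1 g2 c b0 b1 bt0 bt1 in
  exists phi : pt R -> R,
    [/\ Cpc phi,
        (fun x => phi x + W phi x) = S,
        (forall psi : pt R -> R, Cpc psi -> (fun x => psi x + W psi x) = S -> psi = phi),
        supp phi `<=` [set x | - eps <= tcoord x] &
        abs_conv_pc (fun n x => (-1) ^+ n * iter n W S x)] /\
        forall x : pt R,
          (fun N : nat => \sum_(n < N) (-1) ^+ n * iter n W S x) @ \oo --> phi x.
Proof.
move=> m0 a1a a2a g0a g1a g2a g01 g02 g12 _ _ _ ca CS suppS.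
have inu := mucon_integrable m0 a1a a2a g0a g1a g2a ca.
exact: (@solution R m a1 a2 g0 g1 g2 c b0 b1 bt0 bt1 m0 g01 g02 g12 inu eps S CS suppS).
Qed.
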